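(* Suppose every activation function is ReLU, i.e. $\sigma_i(z)=\max\{0,z\}$ for $i=1,\dots,d-1$. Let $\mu,\nu\in\mathcal{P}_{uB}$ and let $\hat\mu_n,\hat\nu_m$ be their empirical measures. Let $\delta\in(0,1)$ satisfy $\sqrt{6h}\,\min\{n,m\}\sqrt{m^{-1}+n^{-1}}\ge4\sqrt{\log(1/\delta)}$. (I) If $\mathcal{F}_{nn}$ is the class of depth-$d$ networks with parameter set $\mathcal{W}_F$, then with probability at least $1-\delta$ over the randomness of $\hat\mu_n$ and $\hat\nu_m$, $$|d_{\mathcal{F}_{nn}}(\mu,\nu)-d_{\mathcal{F}_{nn}}(\hat\mu_n,\hat\nu_m)|\le2\Gamma_{uB}\prod_{i=1}^dM_F(i)\left(\sqrt{6d\log2+5h/4}+\sqrt{2h\log(1/\delta)}\right)\left(n^{-1/2}+m^{-1/2}\right).$$ (II) If $\mathcal{F}_{nn}$ is the class of depth-$d$ networks with parameter set $\mathcal{W}_{1,\infty}$, then with probability at least $1-\delta$ over the randomness of $\hat\mu_n$ and $\hat\nu_m$, $$|d_{\mathcal{F}_{nn}}(\mu,\nu)-d_{\mathcal{F}_{nn}}(\hat\mu_n,\hat\nu_m)|\le2\Gamma_{uB}\prod_{i=1}^dM_{1,\infty}(i)\left(\sqrt{2d\log2+2\log h}+\sqrt{2h\log(1/\delta)}\right)\left(n^{-1/2}+m^{-1/2}\right).$$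
   Context: Fix integers $h\ge1$ (input dimension), $d\ge2$ (depth), layer widths $k_1=h,k_2,\dots,k_d\ge1$, and sample sizes $n,m\ge1$. For a matrix $\mathbf{W}$, $\|\mathbf{W}\|_F$ is the Frobenius norm and $\|\mathbf{W}\|_{1,\infty}$ is the maximal $\ell_1$ norm of its rows; $\|\cdot\|$ on vectors is the $\ell_2$ norm and $\|\cdot\|_1$ the $\ell_1$ norm. $\log$ is the natural logarithm. Networks: a depth-$d$ neural network is a function $f:\mathbb{R}^h\to\mathbb{R}$, $f(\mathbf{x})=\mathbf{w}_d^T\sigma_{d-1}(\mathbf{W}_{d-1}\sigma_{d-2}(\cdots\sigma_1(\mathbf{W}_1\mathbf{x})))$, where $\mathbf{W}_i\in\mathbb{R}^{k_{i+1}\times k_i}$ for $i=1,\dots,d-1$, $\mathbf{w}_d\in\mathbb{R}^{k_d}$, and the $\sigma_i$ are applied entrywise. Given positive constants $M_F(i)$, $M_{1,\infty}(i)$, $i=1,\dots,d$, the parameter sets are: $\mathcal{W}_F$, all $(\mathbf{W}_1,\dots,\mathbf{W}_{d-1},\mathbf{w}_d)$ with $\|\mathbf{W}_i\|_F\le M_F(i)$ for $i\le d-1$ and $\|\mathbf{w}_d\|\le M_F(d)$; and $\mathcal{W}_{1,\infty}$, all such tuples with $\|\mathbf{W}_i\|_{1,\infty}\le M_{1,\infty}(i)$ for $i\le d-1$ and $\|\mathbf{w}_d\|_1\le M_{1,\infty}(d)$. $\mathcal{F}_{nn}$ is the set of all such networks with parameters in the given parameter set. Neural net distance: $d_{\mathcal{F}_{nn}}(\mu,\nu)=\sup_{f\in\mathcal{F}_{nn}}|\mathbb{E}_{\mathbf{x}\sim\mu}f(\mathbf{x})-\mathbb{E}_{\mathbf{x}\sim\nu}f(\mathbf{x})|$.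 Class $\mathcal{P}_{uB}$: given $\Gamma_{uB}>0$, $\mathcal{P}_{uB}$ is the set of all Borel probability measures $\mu$ on $\mathbb{R}^h$ with unbounded support such that $\|\mathbb{E}_{\mathbf{x}\sim\mu}\mathbf{x}\|\le\Gamma_{uB}$ and, for some $\tau$ with $0<\tau\le\Gamma_{uB}$, $\mathbb{E}_{\mathbf{x}\sim\mu}e^{\mathbf{a}^T(\mathbf{x}-\mathbb{E}\mathbf{x})}\le e^{\|\mathbf{a}\|^2\tau^2/2}$ for all $\mathbf{a}\in\mathbb{R}^h$. Empirical measures: $\hat\mu_n$ puts mass $1/n$ on each of $n$ i.i.d. samples from $\mu$, and $\hat\nu_m$ puts mass $1/m$ on each of $m$ i.i.d. samples from $\nu$, the two samples being independent of each other. *)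

(* Defs.v *)
From HB Require Import structures.
From mathcomp Require Import all_boot all_order all_algebra.
From mathcomp Require Import all_classical all_reals all_analysis.

Set Implicit Arguments.
Unset Strict Implicit.
Unset Printing Implicit Defensive.

Import Order.TTheory GRing.Theory Num.Theory.
Import numFieldNormedType.Exports.

Local Open Scope classical_set_scope.
Local Open Scope ring_scope.

(* On a column vector (q = 1) this is the Euclidean norm; the library's norm on
   matrices is the maximum norm. *)
Definition frobenius_norm (R : realType) (p q : nat) (W : 'M[R]_(p, q)) : R :=
  Num.sqrt (\sum_i \sum_j W i j ^+ 2).

Definition l2_norm (R : realType) (p : nat) (x : 'cV[R]_p) : R :=
  frobenius_norm x.

Definition l1_norm (R : realType) (p : nat) (x : 'cV[R]_p) : R :=
  \sum_i `|x i ord0|.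

Definition one_inf_norm (R : realType) (p q : nat) (W : 'M[R]_(p, q)) : R :=
  \big[Num.max/0]_(i < p) \sum_(j < q) `|W i j|.

(* [k i] is the width of layer i for 1 <= i <= d; the input dimension is
   h = k 1, and [k 0] plays no role.

   Weights for depth d. [hidden_weight i] is W_i, meaningful for 1 <= i <= d-1;
   the other members of the family are never read by [network].
   [output_weight] is w_d: its dimension is k d, written [k d.-1.+1] so that it
   matches the type of the last hidden layer. *)
Record params (R : realType) (d : nat) (k : nat -> nat) := Params {
  hidden_weight : forall i, 'M[R]_(k i.+1, k i);
  output_weight : 'cV[R]_(k d.-1.+1) }.

(* Output of layer i, a vector of dimension k (i + 1); layer 0 is the input. *)
Fixpoint hidden_layer (R : realType) (k : nat -> nat) (sigma : nat -> R -> R)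
    (W : forall i, 'M[R]_(k i.+1, k i)) (x : 'cV[R]_(k 1%N)) (i : nat) :
    'cV[R]_(k i.+1) :=
  match i with
  | 0 => x
  | j.+1 => map_mx (sigma j.+1) (W j.+1 *m hidden_layer sigma W x j)
  end.

Definition network (R : realType) (d : nat) (k : nat -> nat)
    (sigma : nat -> R -> R) (w : params R d k) (x : 'cV[R]_(k 1%N)) : R :=
  ((output_weight w)^T *m hidden_layer sigma (hidden_weight w) x d.-1)
    ord0 ord0.

Definition params_F (R : realType) (d : nat) (k : nat -> nat) (M : nat -> R) :
    set (params R d k) :=
  [set w | (forall i, (1 <= i < d)%N ->
              frobenius_norm (hidden_weight w i) <= M i)
           /\ l2_norm (output_weight w) <= M d].

Definition params_1inf (R : realType) (d : nat) (k : nat -> nat)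
    (M : nat -> R) : set (params R d k) :=
  [set w | (forall i, (1 <= i < d)%N ->
              one_inf_norm (hidden_weight w i) <= M i)
           /\ l1_norm (output_weight w) <= M d].

Arguments params_F {R} d k M.
Arguments params_1inf {R} d k M.

Definition network_class (R : realType) (d : nat) (k : nat -> nat)
    (sigma : nat -> R -> R) (Theta : set (params R d k)) :
    set ('cV[R]_(k 1%N) -> R) :=
  [set network sigma w | w in Theta].

Definition relu (R : realType) (z : R) : R := Num.max 0 z.

(* R^h with its Borel sigma-algebra *)
Definition euclidean (R : realType) (h : nat) :=
  g_sigma_algebraType (@open 'cV[R]_h).

HB.instance Definition _ (R : realType) (h : nat) :=
  Measurable.on (euclidean R h).

(* The supremum is taken in the extended reals, so that no convention is
   needed for the supremum of an unbounded set. *)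
Definition neural_net_distance (R : realType) (h : nat)
    (F : set ('cV[R]_h -> R))
    (mu nu : {measure set (euclidean R h) -> \bar R}) : \bar R :=
  ereal_sup
    [set `|\int[mu]_x (f x)%:E - \int[nu]_x (f x)%:E|%E | f in F].

Definition empirical_measure (R : realType) (h n : nat)
    (x : 'I_n -> euclidean R h) (A : set (euclidean R h)) : \bar R :=
  ((n%:R^-1)%:E * \sum_(i < n) \d_(x i) A)%E.

Section empirical_measure_is_measure.
Local Open Scope ereal_scope.
Context (R : realType) (h n : nat) (x : 'I_n -> euclidean R h).

Let atom (k : nat) : {measure set (euclidean R h) -> \bar R} :=
  oapp (fun i : 'I_n =>
          (dirac (x i) : {measure set (euclidean R h) -> \bar R}))
    mzero (insub k).

Let weight : {nonneg R} := ((n%:R : R)^-1)%:nng%R.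

Let empirical_measureE :
  empirical_measure x = mscale weight (msum atom n).
Proof.
apply/funext => A; rewrite /empirical_measure /mscale /msum /=.
by congr (_ * _); apply: eq_bigr => i _; rewrite /atom valK.
Qed.

Let empirical0 : empirical_measure x set0 = 0.
Proof. by rewrite empirical_measureE measure0. Qed.

Let empirical_ge0 A : 0 <= empirical_measure x A.
Proof. by rewrite empirical_measureE measure_ge0. Qed.

Let empirical_sigma_additive : semi_sigma_additive (empirical_measure x).
Proof. by rewrite empirical_measureE; exact: measure_semi_sigma_additive. Qed.

HB.instance Definition _ := isMeasure.Build _ _ _ (empirical_measure x)
  empirical0 empirical_ge0 empirical_sigma_additive.

End empirical_measure_is_measure.

Definition mean (R : realType) (h : nat)
    (mu : probability (euclidean R h) R) : 'cV[R]_h :=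
  \col_i fine (\int[mu]_x ((x : 'cV[R]_h) i ord0)%:E)%E.

Definition support_of (R : realType) (h : nat)
    (mu : probability (euclidean R h) R) : set 'cV[R]_h :=
  [set x | forall U : set 'cV[R]_h, open U -> U x -> (0 < mu U)%E].

(* The mean is only meaningful for integrable coordinates, hence the second
   clause; it is implied by the bound on the moment generating function. *)
Definition class_uB (R : realType) (h : nat) (Gamma : R)
    (mu : probability (euclidean R h) R) : Prop :=
  [/\ forall B : R, exists2 x, support_of mu x & B < l2_norm x,
      forall i : 'I_h,
        mu.-integrable setT (fun x => ((x : 'cV[R]_h) i ord0)%:E),
      l2_norm (mean mu) <= Gamma
    & exists tau : R, [/\ 0 < tau, tau <= Gamma
      & forall a : 'cV[R]_h,
        (\int[mu]_x (expR ((a^T *m ((x : 'cV[R]_h) - mean mu)) ord0 ord0))%:E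
         <= (expR (l2_norm a ^+ 2 * tau ^+ 2 / 2))%:E)%E]].

Definition mutually_independent (dO dT : measure_display)
    (Omega : measurableType dO) (T : measurableType dT) (R : realType)
    (P : probability Omega R) (I : finType) (Z : I -> {RV P >-> T}) : Prop :=
  forall (J : {set I}) (A : I -> set T), (forall i, measurable (A i)) ->
    P (\bigcap_(i in [set` J]) (Z i @^-1` A i)) =
    (\prod_(i in J) P (Z i @^-1` A i))%E.

Definition has_law (dO dT : measure_display)
    (Omega : measurableType dO) (T : measurableType dT) (R : realType)
    (P : probability Omega R) (Z : {RV P >-> T}) (mu : probability T R) : Prop :=
  forall A, measurable A -> distribution P Z A = mu A.

(* X_1, ..., X_n i.i.d. from mu and Y_1, ..., Y_m i.i.d. from nu, with the two
   samples independent of each other: all n + m variables are mutually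
   independent. *)
Definition independent_samples (dO dT : measure_display)
    (Omega : measurableType dO) (T : measurableType dT) (R : realType)
    (P : probability Omega R) (mu nu : probability T R) (n m : nat)
    (X : 'I_n -> {RV P >-> T}) (Y : 'I_m -> {RV P >-> T}) : Prop :=
  [/\ forall i, has_law (X i) mu,
      forall j, has_law (Y j) nu
    & mutually_independent
        (fun s : 'I_n + 'I_m =>
           match s with inl i => X i | inr j => Y j end)].

(* The values of P outside the sigma-algebra carry no meaning, so measurability
   is part of the assertion. *)
Definition with_probability_at_least (dO : measure_display)
    (Omega : measurableType dO) (R : realType) (P : probability Omega R)
    (p : R) (E : set Omega) : Prop :=
  measurable E /\ (p%:E <= P E)%E.

Definition distance_error (dO : measure_display)
    (Omega : measurableType dO) (R : realType) (P : probability Omega R)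
    (h n m : nat) (F : set ('cV[R]_h -> R))
    (mu nu : probability (euclidean R h) R)
    (X : 'I_n -> {RV P >-> euclidean R h})
    (Y : 'I_m -> {RV P >-> euclidean R h}) (omega : Omega) : \bar R :=
  (`|neural_net_distance F mu nu
     - neural_net_distance F
         (empirical_measure (fun i => X i omega))
         (empirical_measure (fun j => Y j omega))|)%E.

(* Main.v *)
(* Normalising the rows of the weight matrices and using that relu is positively
   homogeneous, every network is [\prod_i M i] times an element of a tower of
   hulls: start from the linear functionals of norm at most 1 and iterate
   [D |-> {\sum_k a k * relu (g k) | \sum_k |a k| <= 1, g k \in D}].

   For one sample, symmetrization bounds the exponential moment of the supremum
   over a finite part of the tower of the deviation of the empirical mean by the
   square of a Rademacher average; since relu t = (t + |t|) / 2 and taking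
   absolute values does not increase Rademacher averages, each layer costs only
   a factor sqrt 2. For linear functionals the average is computed from the
   sub-Gaussian bound: through the coordinates for the l1 ball, through an
   auxiliary Gaussian vector for the Euclidean ball. Markov's inequality with a
   suitable exponent gives the deviation bound, and the convexity of exp combines
   the two samples into a single exponential.

   The networks are equi-Lipschitz, so a countable subfamily computes all the
   suprema; this gives both the measurability of the event and the passage from
   finite families to the whole class. *)
Require Import Defs.
From HB Require Import structures.
From mathcomp Require Import all_boot all_order all_algebra.
From mathcomp Require Import all_classical all_reals all_analysis.
From mathcomp Require Import measurable_realfun ring lra zify.

Set Implicit Arguments.
Unset Strict Implicit.
Unset Printing Implicit Defensive.

Import Order.TTheory GRing.Theory Num.Theory.
Import numFieldNormedType.Exports.

Local Open Scope classical_set_scope.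
Local Open Scope ring_scope.

(** * ReLU hulls and Rademacher averages *)

(** Unbounded support rules out a bounded-difference argument, so mean and fluctuation of the
    supremum are not estimated separately: its exponential moment is bounded at once. The factor
    sqrt 2 per layer then multiplies the moment and not the deviation. After the squaring done by
    symmetrization and with both signs counted, d - 1 layers cost 2 * (sqrt 2)^(2 (d - 1)) = 2^d, so
    that depth enters the exponent only as d ln 2; optimizing the exponent turns this into a square
    root.

    For the l1 ball a sharper recursion is used. The identity relu t = (t + |t|) / 2 is applied to
    the deviation itself: its linear half is controlled by the previous layer, only its
    absolute-value half is symmetrized, and the two exponents are averaged. At the bottom the linear
    deviations are centered and need no symmetrization; this cheaper estimate keeps the weight 2^-(d
    - 1).

    For the Euclidean ball each coordinate costs a Gaussian integral 1 / sqrt(3/4), and 5 h / 4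
    comes from ln(4/3) <= 5/16. *)

Section signed_sums.
Context {R : realType} {n : nat}.
Implicit Types (e : {ffun 'I_n -> bool}) (v : 'I_n -> R) (i : 'I_n).

Definition signed_sum e v : R := \sum_i (-1) ^+ e i * v i.

Definition flip_sign i e : {ffun 'I_n -> bool} :=
  [ffun k => if k == i then ~~ e k else e k].

Definition neg_sign e : {ffun 'I_n -> bool} := [ffun k => ~~ e k].

Lemma flip_signK i : involutive (flip_sign i).
Proof. by move=> e; apply/ffunP => k; rewrite !ffunE; case: eqP; rewrite ?negbK. Qed.

Lemma neg_signK : involutive neg_sign.
Proof. by move=> e; apply/ffunP => k; rewrite !ffunE negbK. Qed.

Lemma signed_sumN e v : signed_sum (neg_sign e) v = - signed_sum e v.
Proof.
rewrite /signed_sum -sumrN; apply: eq_bigr => i _.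
by rewrite ffunE signrN mulNr.
Qed.

Lemma signed_sum_oppr e v : signed_sum e (fun i => - v i) = - signed_sum e v.
Proof. by rewrite /signed_sum -sumrN; apply: eq_bigr => i _; rewrite mulrN. Qed.

Lemma sum_flip_sign i (G : {ffun 'I_n -> bool} -> R) :
  \sum_e G e = \sum_(e : {ffun 'I_n -> bool} | ~~ e i) (G e + G (flip_sign i e)).
Proof.
rewrite (bigID (fun e : {ffun 'I_n -> bool} => ~~ e i)) /= big_split /=; congr (_ + _).
rewrite (reindex_inj (can_inj (flip_signK i))) /=.
by apply: eq_bigl => e; rewrite ffunE eqxx negbK.
Qed.

(** Interpolates between [|v i|] at k = 0 and [v i] at k = n, so that the contraction removes one
    absolute value per step. *)
Let partial_abs (k : nat) v i := if (i < k)%N then v i else `|v i|.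

(* For the absolute value the contraction principle needs only an exchange of
   the selected points between the two sign patterns that differ at i. *)
Lemma sum_abs_contraction {T : Type} (v : T -> 'I_n -> R) (F : R -> R)
    (g : {ffun 'I_n -> bool} -> T) : {homo F : x y / x <= y} ->
  exists2 g' : {ffun 'I_n -> bool} -> T, (forall e, exists e', g' e = g e') &
    \sum_e F (signed_sum e (fun i => `|v (g e) i|))
      <= \sum_e F (signed_sum e (v (g' e))).
Proof.
move=> hF.
suff H (k : nat) : (k <= n)%N ->
    exists2 g' : {ffun 'I_n -> bool} -> T, (forall e, exists e', g' e = g e') &
    \sum_e F (signed_sum e (fun i => `|v (g e) i|))
      <= \sum_e F (signed_sum e (partial_abs k (v (g' e)))).
  have [g' g'g le] := H n (leqnn n); exists g' => //.
  rewrite (le_trans le)//; apply: ler_sum => e _; apply/hF.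
  by apply: ler_sum => i _; rewrite /partial_abs ltn_ord.
elim: k => [_|k IH kn].
  by exists g => // e; exists e.
have [g0 g0g le0] := IH (ltnW kn).
pose i := Ordinal kn.
(* [ep] is the member of the pair with sign +1 at i. If its value at i is nonnegative, dropping the
   absolute values changes nothing for it and can only raise the term of its partner. If the value
   is negative, exchanging the two selected points puts it under the sign -1, where it equals its
   absolute value. *)
pose g1 e := let ep := if e i then flip_sign i e else e in
  if 0 <= v (g0 ep) i then g0 e else g0 (flip_sign i e).
exists g1.
  by move=> e; rewrite /g1; case: ifP => _; exact: g0g.
apply: (le_trans le0); rewrite !(sum_flip_sign i).
apply: ler_sum => e /negbTE ei.
set e' := flip_sign i e.
have e'i : e' i = true by rewrite /e' ffunE eqxx ei.
have e'e : flip_sign i e' = e by rewrite /e' flip_signK.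
pose rest t := \sum_(j | j != i) (-1) ^+ e j * partial_abs k (v t) j.
have Mk u t : (u == e) || (u == e') ->
   signed_sum u (partial_abs k (v t)) = (-1) ^+ u i * `|v t i| + rest t.
  move=> ue; rewrite /signed_sum (bigD1 i)//=; congr (_ * _ + _).
    by rewrite /partial_abs ltnn.
  apply: eq_bigr => j ji; congr ((-1) ^+ _ * _).
  by case/orP: ue => /eqP-> //; rewrite /e' ffunE (negbTE ji).
have MSk u t : (u == e) || (u == e') ->
   signed_sum u (partial_abs k.+1 (v t)) = (-1) ^+ u i * v t i + rest t.
  move=> ue; rewrite /signed_sum (bigD1 i)//=; congr (_ * _ + _).
    by rewrite /partial_abs ltnSn.
  apply: eq_bigr => j ji; congr ((-1) ^+ _ * _).
    by case/orP: ue => /eqP-> //; rewrite /e' ffunE (negbTE ji).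
  rewrite /partial_abs ltnS leq_eqVlt; case: (ltnP j k) => [_|]; first by rewrite orbT.
  move=> kj; rewrite orbF; case: eqP => // jk.
  by move/eqP: ji; case; apply/val_inj.
rewrite !Mk ?MSk ?eqxx ?orbT// ei e'i expr0 expr1 /g1 ei e'i e'e.
case: ifPn => [v0|]; last rewrite -ltNge => v0.
  rewrite (ger0_norm v0) lerD2l; apply: hF.
  by rewrite lerD2r; rewrite !mulN1r lerN2 ler_norm.
rewrite (ltr0_norm v0) [leLHS]addrC; apply: lerD; apply: hF.
  by rewrite lerD2r mul1r mulN1r lerNl -normrN ler_norm.
by rewrite lerD2r mul1r mulN1r.
Qed.

End signed_sums.

Section relu_hull.
Context {R : realType} {T : Type}.
Implicit Types (D : set (T -> R)) (f g : T -> R).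

Lemma relu_half (t : R) : relu t = 2^-1 * t + 2^-1 * `|t|.
Proof.
rewrite /relu; case: (leP 0 t) => t0.
  by rewrite ger0_norm//; lra.
by rewrite ltr0_norm//; lra.
Qed.

Lemma relu_norm_le (t : R) : `|relu t| <= `|t|.
Proof. by rewrite /relu; case: (leP 0 t) => t0; rewrite ?normr0. Qed.

Lemma relu_lip (s t : R) : `|relu s - relu t| <= `|s - t|.
Proof.
rewrite !relu_half -[leRHS]mul1r.
have -> : 2^-1 * s + 2^-1 * `|s| - (2^-1 * t + 2^-1 * `|t|) =
  2^-1 * ((s - t) + (`|s| - `|t|)) by ring.
rewrite normrM ger0_norm ?invr_ge0//.
have h1 := ler_normD (s - t) (`|s| - `|t|).
have h2 := ler_dist_dist s t.
lra.
Qed.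

Definition relu_hull D : set (T -> R) :=
  [set f | exists K (a : 'I_K -> R) (g : 'I_K -> T -> R),
    [/\ forall k, D (g k), \sum_k `|a k| <= 1
      & f = fun x => \sum_k a k * relu (g k x)]].

Lemma relu_hull0 D : relu_hull D (fun=> 0).
Proof.
exists 0%N, (fun=> 0), (fun=> fun=> 0); split; first by case.
  by rewrite big_ord0.
by apply/funext => x; rewrite big_ord0.
Qed.

Fixpoint relu_tower D (j : nat) : set (T -> R) :=
  if j is j'.+1 then relu_hull (relu_tower D j') else D.

Lemma norm_sum_hull K (a s : 'I_K -> R) (c : R) : 0 <= c ->
  \sum_k `|a k| <= 1 -> (forall k, `|s k| <= c) -> `|\sum_k a k * s k| <= c.
Proof.
move=> c0 a1 sc; apply: (le_trans (ler_norm_sum _ _ _)).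
apply: (@le_trans _ _ (\sum_k `|a k| * c)).
  by apply: ler_sum => k _; rewrite normrM ler_wpM2l.
by rewrite -mulr_suml ler_piMl.
Qed.

(** The sum is linear in the coefficients [a], so over the l1 ball its absolute value is largest at
    a single generator, to which the identity for relu is applied. For K = 0 there is no generator
    and [g0] serves. *)
Lemma relu_hull_dominated D (f : T -> R) (I : finType) (c : I -> R) (x : I -> T) :
  (exists g, D g) -> relu_hull D f ->
  exists2 g, D g & `|\sum_i c i * f (x i)| <=
    2^-1 * `|\sum_i c i * g (x i)| + 2^-1 * `|\sum_i c i * `|g (x i)| |.
Proof.
move=> [g0 Dg0] [K [a [g [Dg a1 ->]]]].
pose s k := \sum_i c i * relu (g k (x i)).
have -> : \sum_i c i * (\sum_k a k * relu (g k (x i))) = \sum_k a k * s k.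
  under eq_bigr do rewrite mulr_sumr.
  rewrite exchange_big /=; apply: eq_bigr => k _; rewrite mulr_sumr.
  by apply: eq_bigr => i _; rewrite mulrCA.
have half (u : T -> R) : `|\sum_i c i * relu (u (x i))| <=
    2^-1 * `|\sum_i c i * u (x i)| + 2^-1 * `|\sum_i c i * `|u (x i)| |.
  under eq_bigr do rewrite relu_half mulrDr.
  rewrite big_split /= (le_trans (ler_normD _ _))//.
  under eq_bigr do rewrite mulrCA.
  under [in X in _ + X <= _]eq_bigr do rewrite mulrCA.
  by rewrite -!mulr_sumr !normrM normfV normr_nat.
case: K a g Dg a1 @s => [|K] a g Dg a1 s.
  by exists g0 => //; rewrite big_ord0 normr0 addr_ge0// mulr_ge0// invr_ge0.
pose k := [arg max_(k > ord0) `|s k|]%O.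
exists (g k) => //; apply: le_trans (half (g k)).
apply: norm_sum_hull => // l; rewrite -/(s k) /k.
by case: arg_maxP => // k' _ le_k'; exact: (le_k' l isT).
Qed.

End relu_hull.

Section rademacher_peeling.
Context {R : realType} {T : Type} {n : nat}.
Implicit Types (D : set (T -> R)) (x : 'I_n -> T).

(* weighted AM-GM; the free weight [c] plays the role of Cauchy-Schwarz *)
Lemma expR_half_le (c a b : R) : 0 < c ->
  expR (2^-1 * a + 2^-1 * b) <= 2^-1 * (c * expR a + c^-1 * expR b).
Proof.
move=> c0; set u := expR (2^-1 * a); set v := expR (2^-1 * b).
have -> : expR a = u ^+ 2.
  by rewrite /u expr2 -expRD; congr expR; lra.
have -> : expR b = v ^+ 2.
  by rewrite /v expr2 -expRD; congr expR; lra.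
rewrite expRD -/u -/v.
have c20 : 0 <= (c * u - v) ^+ 2 / c by rewrite divr_ge0 ?sqr_ge0// ltW.
have : (c * u - v) ^+ 2 / c = c * u ^+ 2 + c^-1 * v ^+ 2 - 2 * (u * v).
  by field; rewrite gt_eqF.
lra.
Qed.

Lemma expR_norm_le (t : R) : expR `|t| <= expR t + expR (- t).
Proof.
by case: (leP 0 t) => t0; rewrite ?(ger0_norm t0) ?(ltr0_norm t0);
  rewrite ?lerDl ?lerDr ?expR_ge0.
Qed.

(** Bounds 2^n times the Rademacher average of exp(theta sup |.|). An arbitrary choice of a member
    of [D] for each sign pattern stands for the supremum, which therefore need be neither finite nor
    attained. *)
Definition rademacher_le D x (theta b : R) := forall f : {ffun 'I_n -> bool} -> T -> R,
  (forall e, D (f e)) ->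
  \sum_e expR (theta * `|signed_sum e (fun i => f e (x i))|) <= b.

Lemma rademacher_le_abs D x (theta b : R) (g : {ffun 'I_n -> bool} -> T -> R) :
  0 <= theta -> rademacher_le D x theta b -> (forall e, D (g e)) ->
  \sum_e expR (theta * signed_sum e (fun i => `|g e (x i)|)) <= b.
Proof.
move=> t0 Db Dg.
have hF : {homo (fun t => expR (theta * t)) : s t / s <= t}.
  by move=> s t st; rewrite ler_expR ler_wpM2l.
have [g' g'g le] := @sum_abs_contraction R n _ (fun (g : T -> R) i => g (x i)) _ g hF.
apply: (le_trans le); apply: le_trans (Db g' _); last first.
  by move=> e; have [e' ->] := g'g e.
by apply: ler_sum => e _; rewrite ler_expR ler_wpM2l// ler_norm.
Qed.

Lemma rademacher_le_hull D x (theta b : R) : 0 <= theta -> D (fun=> 0) ->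
  rademacher_le D x theta b ->
  rademacher_le (relu_hull D) x theta (Num.sqrt 2 * b).
Proof.
move=> t0 D0 Db f hf.
have /choice[g hg] : forall e, exists g, D g /\
  `|signed_sum e (fun i => f e (x i))| <=
    2^-1 * `|signed_sum e (fun i => g (x i))|
    + 2^-1 * `|signed_sum e (fun i => `|g (x i)|)|.
  move=> e; have [g Dg le] := relu_hull_dominated (fun i => (-1) ^+ e i) x
    (ex_intro _ _ D0) (hf e).
  by exists g.
have Dg e : D (g e) by have [] := hg e.
(* sqrt 2 balances the two halves: the linear one sums to at most b, the absolute-value one to at
   most 2 b because both of its signs are needed, and their geometric mean is sqrt 2 * b. *)
set q := Num.sqrt 2; have q0 : 0 < q by rewrite sqrtr_gt0.
have q2 : q * q = 2 by rewrite -expr2 sqr_sqrtr.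
apply: (@le_trans _ _ (\sum_e 2^-1 *
   (q * expR (theta * `|signed_sum e (fun i => g e (x i))|)
    + q^-1 * expR (theta * `|signed_sum e (fun i => `|g e (x i)|)|)))).
  apply: ler_sum => e _; apply: le_trans (expR_half_le _ _ q0).
  rewrite ler_expR; have [_ le] := hg e.
  apply: (le_trans (ler_wpM2l t0 le)); lra.
rewrite -mulr_sumr big_split /= -!mulr_sumr.
have h1 := Db g Dg.
have h2 : \sum_e expR (theta * `|signed_sum e (fun i => `|g e (x i)|)|) <= 2 * b.
  apply: (@le_trans _ _ (\sum_e expR (theta * signed_sum e (fun i => `|g e (x i)|))
     + \sum_e expR (theta * signed_sum e (fun i => `|g (neg_sign e) (x i)|)))).
    rewrite [X in _ <= _ + X](reindex_inj (can_inj neg_signK)) -big_split /=.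
    apply: ler_sum => e _; rewrite signed_sumN neg_signK mulrN.
    by rewrite -{1}(ger0_norm t0) -normrM expR_norm_le.
  have := rademacher_le_abs t0 Db Dg.
  have := @rademacher_le_abs D x theta b (g \o neg_sign) t0 Db (fun e => Dg _).
  rewrite /=; lra.
have -> : q * b = 2^-1 * (q * b + q^-1 * (q * q * b)) by field; rewrite gt_eqF.
rewrite q2.
rewrite ler_wpM2l ?invr_ge0// lerD// ler_wpM2l ?invr_ge0// ltW//.
Qed.

Lemma relu_tower0 D j : D (fun=> 0) -> relu_tower D j (fun=> 0).
Proof. by case: j => [//|j] _; exact: relu_hull0. Qed.

Lemma rademacher_le_tower D x (theta b : R) j : 0 <= theta -> D (fun=> 0) ->
  rademacher_le D x theta b ->
  rademacher_le (relu_tower D j) x theta (Num.sqrt 2 ^+ j * b).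
Proof.
move=> t0 D0 Db; elim: j => [|j IH] /=; first by rewrite mul1r.
rewrite exprS -mulrA; apply: rademacher_le_hull => //.
exact: relu_tower0.
Qed.

End rademacher_peeling.

(** * Laws of i.i.d. samples *)

Section iid_law.
Local Open Scope ereal_scope.
Context {d : measure_display} {T : measurableType d} {R : realType}.
Variable mu : probability T R.

Definition cons_pair n (p : T * n.-tuple T) : n.+1.-tuple T :=
  [the n.+1.-tuple T of p.1 :: p.2].

Lemma measurable_cons_pair n : measurable_fun [set: T * n.-tuple T] (@cons_pair n).
Proof. by apply: measurable_cons. Qed.

HB.instance Definition _ n := isMeasurableFun.Build _ _ _ _ (@cons_pair n)
  (@measurable_cons_pair n).

(** The n-fold product law, by recursion on n so that Fubini peels off one sample at a time. *)
Fixpoint iid n : probability (n.-tuple T) R :=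
  if n is n'.+1 then distribution (mu \x iid n')%E (@cons_pair n')
  else \d_([tuple]).

Lemma integral_iid0 (f : 0.-tuple T -> \bar R) :
  measurable_fun [set: 0.-tuple T] f ->
  \int[iid 0%N]_t f t = f [tuple].
Proof. by move=> mf; rewrite /= integral_dirac// diracT mul1e. Qed.

Lemma integral_iidS n (f : n.+1.-tuple T -> \bar R) :
  measurable_fun [set: n.+1.-tuple T] f -> (forall t, 0 <= f t) ->
  \int[iid n.+1]_t f t = \int[mu]_x \int[iid n]_t f (cons_pair (x, t)).
Proof.
move=> mf f0.
have mfc : measurable_fun [set: T * n.-tuple T] (f \o @cons_pair n).
  by apply: (measurableT_comp mf); exact: measurable_cons_pair.
transitivity (\int[(mu \x iid n)%E]_p (f \o @cons_pair n) p).
  exact: ge0_integral_distribution.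
by rewrite fubini_tonelli1; [by []|exact: mfc|move=> p; exact: f0].
Qed.

Lemma measurable_integral_iid n (f : n.+1.-tuple T -> \bar R) :
  measurable_fun [set: n.+1.-tuple T] f -> (forall t, 0 <= f t) ->
  measurable_fun setT (fun x => \int[iid n]_t f (cons_pair (x, t))).
Proof.
move=> mf f0; apply: (@measurable_fun_fubini_tonelli_F _ _ _ _ _ (iid n)
  (f \o @cons_pair n)); last by move=> p; exact: f0.
by apply: (measurableT_comp mf); exact: measurable_cons_pair.
Qed.

Definition box n (B : 'I_n -> set T) : set (n.-tuple T) :=
  [set t | forall i, B i (tnth t i)].

Lemma boxE n (B : 'I_n -> set T) :
  box B = \bigcap_(i in [set: 'I_n]) (@tnth n T ^~ i @^-1` B i).
Proof. by apply/seteqP; split => [t tB i _|t tB i]; exact: tB. Qed.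

Lemma measurable_box n (B : 'I_n -> set T) :
  (forall i, measurable (B i)) -> measurable (box B).
Proof.
move=> mB; rewrite boxE; apply: fin_bigcap_measurable => // i _.
by rewrite -[X in measurable X]setTI; apply: measurable_tnth.
Qed.

Lemma iid_box n (B : 'I_n -> set T) : (forall i, measurable (B i)) ->
  iid n (box B) = \prod_i mu (B i).
Proof.
elim: n B => [|n IH] B mB.
  by rewrite big_ord0 /= diracE mem_set// => -[].
transitivity ((mu \x iid n)%E (@cons_pair n @^-1` box B)); first by [].
have -> : @cons_pair n @^-1` box B = B ord0 `*` box (fun i => B (lift ord0 i)).
  apply/seteqP; split => [[x t] /= Bxt|[x t] [/= Bx Bt] i].
    split; first exact: (Bxt ord0).
    by move=> i; have := Bxt (lift ord0 i); rewrite tnthS.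
  have [->//|i0] := eqVneq i ord0.
  have [j ->] : exists j, i = lift ord0 j.
    by case: (unliftP ord0 i) i0 => [j ->|->]; [exists j|rewrite eqxx].
  by rewrite tnthS.
rewrite product_measure1E//; last by apply: measurable_box => i; exact: mB.
by rewrite big_ord_recl; congr (_ * _)%E; apply: IH => i; exact: mB.
Qed.

(** Boxes are stable under intersection and generate the sigma-algebra of tuples. *)
Lemma iid_unique n (m : {measure set (n.-tuple T) -> \bar R}) :
  (forall B : 'I_n -> set T, (forall i, measurable (B i)) ->
     m (box B) = \prod_i mu (B i)) ->
  forall A, measurable A -> m A = iid n A.
Proof.
move=> mE A mA.
pose G := [set C : set (n.-tuple T) | exists2 B : 'I_n -> set T,
   (forall i, measurable (B i)) & C = box B].
have GT : G setT.
  by exists (fun=> setT) => //; apply/esym/seteqP; split.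
apply: (measure_unique G (fun=> setT)) => //.
- apply/seteqP; split; last first.
    apply: smallest_sub; first exact: sigma_algebra_measurable.
    by move=> _ [B mB ->]; exact: measurable_box.
  apply: smallest_sub; first exact: smallest_sigma_algebra.
  (* [inord] below needs a nonempty index type; for n = 0 the generating family is empty. *)
  case: n {m mE A mA} @G GT => [|n] G GT C; first by rewrite big_ord0.
  rewrite -bigcup_mkord_ord => -[i ilt] [D mD] <-.
  apply: sub_sigma_algebra; rewrite setTI.
  exists (fun j => if j == inord i then D else setT).
    by move=> j; case: ifP.
  apply/seteqP; split => [t /= Dt j|t /(_ (inord i))/=]; last by rewrite eqxx.
  by case: eqP => // ->.
- move=> _ _ [B mB ->] [C mC ->]; exists (fun i => B i `&` C i).
    by move=> i; exact: measurableI.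
  by apply/seteqP; split => [t [Bt Ct] i|t BCt]; [split|split=> i; case: (BCt i)].
- by rewrite bigcup_const//; exists 0%N.
- by move=> _ [B mB ->]; rewrite mE// -iid_box.
- move=> _; have [B mB ->] := GT; rewrite mE// -iid_box//.
  by rewrite (le_lt_trans (probability_le1 _ _)) ?ltry//; exact: measurable_box.
Qed.

End iid_law.

Section sample_law.
Local Open Scope ereal_scope.
Context {dO dT : measure_display} {Omega : measurableType dO}
  {T : measurableType dT} {R : realType} (P : probability Omega R)
  (mu : probability T R).

Definition sample n (X : 'I_n -> {RV P >-> T}) (w : Omega) : n.-tuple T :=
  [tuple X i w | i < n].

Lemma measurable_sample n (X : 'I_n -> {RV P >-> T}) :
  measurable_fun [set: Omega] (sample X).
Proof.
apply/measurable_fun_tnthP => i; rewrite (_ : _ \o _ = X i)//.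
by apply/funext => w /=; rewrite tnth_mktuple.
Qed.

HB.instance Definition _ n (X : 'I_n -> {RV P >-> T}) :=
  isMeasurableFun.Build _ _ _ _ (sample X) (measurable_sample X).

(** [u] will be [inl] or [inr]: it extracts one of the two samples from the jointly independent
    family. *)
Lemma integral_sample (I : finType) (Z : I -> {RV P >-> T}) n (u : 'I_n -> I)
    (f : n.-tuple T -> \bar R) :
  injective u -> mutually_independent Z -> (forall i, has_law (Z (u i)) mu) ->
  measurable_fun [set: n.-tuple T] f -> (forall t, 0 <= f t) ->
  \int[P]_w f (sample (fun i => Z (u i)) w) = \int[iid mu n]_t f t.
Proof.
move=> uI indep lawZ mf f0.
rewrite -[LHS](@ge0_integral_distribution _ _ _ _ _ P (sample (fun i => Z (u i))) f)//.
apply: eq_measure_integral => A mA _.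
apply: iid_unique => // B mB.
(* Independence speaks of sets indexed by all of [I]: the sides of the box are carried along [u] and
   padded by [setT] off its image. *)
pose C s := if [pick i | u i == s] is Some i then B i else setT.
have Cu i : C (u i) = B i.
  by rewrite /C; case: pickP => [j /eqP/uI ->//|/(_ i)]; rewrite eqxx.
have mC s : measurable (C s) by rewrite /C; case: pickP.
have := indep (u @: 'I_n)%SET C mC.
have -> : \bigcap_(s in [set` (u @: 'I_n)%SET]) (Z s @^-1` C s) =
    sample (fun i => Z (u i)) @^-1` box B.
  apply/seteqP; split => [w /= Zw i|w /= Bw s /=].
    rewrite tnth_mktuple -Cu; apply: (Zw (u i)).
    by rewrite /= imset_f ?inE.
  by move=> /imsetP[i _ ->]; rewrite Cu; have := Bw i; rewrite tnth_mktuple.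
move=> PB; apply: etrans PB _.
rewrite big_imset /=; last by move=> i j _ _ /uI.
by apply: eq_bigr => i _; rewrite Cu -(lawZ i (B i)).
Qed.

End sample_law.

(** * Symmetrization *)

Section symmetrization.
Local Open Scope ereal_scope.
Context {d : measure_display} {T : measurableType d} {R : realType}.
Variable mu : probability T R.

(** The base value 0 stands for the zero function, which lies in every class considered; it keeps
    the maximum nonnegative and meaningful for K = 0. *)
Definition max0 K (s : 'I_K -> R) : R := \big[Num.max/0%R]_k s k.

Lemma max0_ge0 K (s : 'I_K -> R) : (0 <= max0 s)%R.
Proof. exact: bigmax_ge_id. Qed.

Lemma max0_ge K (s : 'I_K -> R) k : (s k <= max0 s)%R.
Proof. exact: le_bigmax. Qed.

Lemma max0_le K (s : 'I_K -> R) (c : R) : (0 <= c)%R -> (forall k, s k <= c)%R ->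
  (max0 s <= c)%R.
Proof. by move=> c0 sc; apply: bigmax_le. Qed.

Lemma max0_attained K (s : 'I_K -> R) : max0 s = 0%R \/ exists k, max0 s = s k.
Proof.
rewrite /max0; elim/big_ind: _ => [|x y|k _]; [by left| |by right; exists k].
by rewrite /Num.max; case: ifP.
Qed.

Lemma measurable_max0 {dU : measure_display} {U : measurableType dU} K
    (s : 'I_K -> U -> R) : (forall k, measurable_fun [set: U] (s k)) ->
  measurable_fun [set: U] (fun x => max0 (s ^~ x)).
Proof.
rewrite /max0; elim: K s => [|K IH] s ms.
  by under eq_fun do rewrite big_ord0; exact: measurable_cst.
under eq_fun do rewrite big_ord_recl.
by apply: measurable_maxr => //; apply: IH.
Qed.

Definition centered (phi : T -> R) :=
  mu.-integrable setT (EFin \o phi) /\ \int[mu]_x (phi x)%:E = 0.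

Lemma integral_cst_probability (r : R) : \int[mu]_x r%:E = r%:E.
Proof. by rewrite (integral_cst mu measurableT r%:E) [X in _ * X](@probability_setT _ _ _ mu) mule1. Qed.

(** Jensen's inequality from the tangent of exp at c. An infinite right-hand side is set apart, so
    that otherwise both integrands are integrable. *)
Lemma expR_le_integral_centered (c : R) phi : centered phi ->
  (expR c)%:E <= \int[mu]_x (expR (c + phi x))%:E.
Proof.
move=> [iphi phi0].
have mphi : measurable_fun setT phi by apply/measurable_EFinP; exact: measurable_int iphi.
have me : measurable_fun setT (fun x => (expR (c + phi x))%:E).
  apply/measurable_EFinP; apply: (measurableT_comp (@measurable_expR R)).
  by apply: measurable_funD.
have e0 x : 0 <= (expR (c + phi x))%:E by rewrite lee_fin expR_ge0.
have [->|fin] := eqVneq (\int[mu]_x (expR (c + phi x))%:E) +oo; first by rewrite leey.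
have ie : mu.-integrable setT (fun x => (expR (c + phi x))%:E).
  apply/integrableP; split => //.
  under eq_integral do rewrite gee0_abs//.
  by rewrite ltey.
have il : mu.-integrable setT (fun x => (expR c)%:E + (expR c)%:E * (phi x)%:E).
  apply: integrableD => //; first exact: finite_measure_integrable_cst.
  exact: integrableZl.
apply: (@le_trans _ _ (\int[mu]_x ((expR c)%:E + (expR c)%:E * (phi x)%:E))).
  rewrite integralD//=; [|exact: finite_measure_integrable_cst|exact: integrableZl].
  by rewrite integral_cst_probability integralZl// phi0 mule0 adde0.
apply: le_integral => // x _; rewrite -EFinM -EFinD lee_fin expRD.
by rewrite -{1}(mulr1 (expR c)) -mulrDr ler_pM2l ?expR_gt0// expR_ge1Dx.
Qed.

(** Jensen's inequality for the index that attains [max0 s]; if the base value 0 is attained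
    instead, the integrand is at least 1 everywhere. *)
Lemma max0_le_integral_centered K (phi : 'I_K -> T -> R) (s : 'I_K -> R) :
  (forall k, centered (phi k)) ->
  (expR (max0 s))%:E <= \int[mu]_x (expR (max0 (fun k => s k + phi k x)%R))%:E.
Proof.
move=> cphi.
have mphi k : measurable_fun setT (phi k).
  by have [iphi _] := cphi k; apply/measurable_EFinP; exact: measurable_int iphi.
have mm : measurable_fun setT
    (fun x => (expR (max0 (fun k => s k + phi k x)%R))%:E).
  apply/measurable_EFinP; apply: (measurableT_comp (@measurable_expR R)).
  by apply: measurable_max0 => k; apply: measurable_funD.
have [->|[k ->]] := max0_attained s.
  rewrite expR0 -[leLHS]integral_cst_probability.
  apply: ge0_le_integral => //.
  by move=> x _; rewrite lee_fin -expR0 ler_expR max0_ge0.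
apply: (le_trans (expR_le_integral_centered _ (cphi k))).
apply: ge0_le_integral => //.
- apply/measurable_EFinP; apply: (measurableT_comp (@measurable_expR R)).
  by apply: measurable_funD.
- move=> x _; rewrite lee_fin ler_expR.
  exact: (max0_ge (fun k => s k + phi k x)%R).
Qed.

Lemma centered_scale (c : R) phi : centered phi -> centered (fun x => c * phi x)%R.
Proof.
move=> [iphi phi0]; split.
  rewrite (_ : _ \o _ = (fun x => c%:E * (EFin \o phi) x)); first exact: integrableZl.
  by apply/funext => x /=; rewrite EFinM.
by under eq_integral do rewrite EFinM; rewrite integralZl// phi0 mule0.
Qed.

(** The offset [a] makes recursion on n possible: a sample that has been fixed is absorbed into it,
    and the coefficients [c] are shifted. *)
Definition max0_mgf n K (phi : 'I_K -> T -> R) (c : nat -> R) (a : 'I_K -> R) :=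
  \int[iid mu n]_t
    (expR (max0 (fun k => a k + \sum_(i < n) c i * phi k (tnth t i))%R))%:E.

Lemma max0_mgf_ge0 n K (phi : 'I_K -> T -> R) c a : 0 <= max0_mgf n phi c a.
Proof. by apply: integral_ge0 => t _; rewrite lee_fin expR_ge0. Qed.

Lemma measurable_max0_mgf n K (phi : 'I_K -> T -> R) (c : nat -> R) (a : 'I_K -> R) :
  (forall k, measurable_fun setT (phi k)) ->
  measurable_fun [set: n.-tuple T]
    (fun t => (expR (max0 (fun k => a k + \sum_(i < n) c i * phi k (tnth t i))%R))%:E).
Proof.
move=> mphi; apply/measurable_EFinP; apply: (measurableT_comp (@measurable_expR R)).
apply: measurable_max0 => k; apply: measurable_funD => //.
apply: measurable_sum => i; apply: measurable_funM => //.
by apply: (measurableT_comp (mphi k)); exact: measurable_tnth.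
Qed.

Lemma max0_mgf0 K (phi : 'I_K -> T -> R) (c : nat -> R) (a : 'I_K -> R) :
  (forall k, measurable_fun setT (phi k)) ->
  max0_mgf 0 phi c a = (expR (max0 a))%:E.
Proof.
move=> mphi; rewrite /max0_mgf integral_iid0; last exact: measurable_max0_mgf.
by congr (expR _)%:E; apply: eq_bigr => k _; rewrite big_ord0 addr0.
Qed.

Lemma max0_mgfS n K (phi : 'I_K -> T -> R) (c : nat -> R) (a : 'I_K -> R) :
  (forall k, measurable_fun setT (phi k)) ->
  max0_mgf n.+1 phi c a =
  \int[mu]_x max0_mgf n phi (c \o S) (fun k => a k + c 0%N * phi k x)%R.
Proof.
move=> mphi; rewrite /max0_mgf integral_iidS; last first.
- by move=> t; rewrite lee_fin expR_ge0.
- exact: measurable_max0_mgf.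
apply: eq_integral => x _; apply: eq_integral => t _; congr (expR _)%:E.
apply: eq_bigr => k _; rewrite big_ord_recl addrA; congr (_ + _ + _)%R.
by apply: eq_bigr => i _; rewrite tnthS.
Qed.

Lemma measurable_max0_mgfS n K (phi : 'I_K -> T -> R) (c : nat -> R) (a : 'I_K -> R) :
  (forall k, measurable_fun setT (phi k)) ->
  measurable_fun setT
   (fun x => max0_mgf n phi (c \o S) (fun k => a k + c 0%N * phi k x)%R).
Proof.
move=> mphi.
have h0 (t : n.+1.-tuple T) : 0 <= (expR (max0 (fun k => a k +
   \sum_(i < n.+1) c i * phi k (tnth t i))%R))%:E by rewrite lee_fin expR_ge0.
have := measurable_integral_iid mu (@measurable_max0_mgf n.+1 K phi c a mphi) h0.
apply: eq_measurable_fun => x _; apply: eq_integral => t _; congr (expR _)%:E.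
apply: eq_bigr => k _; rewrite big_ord_recl addrA; congr (_ + _ + _)%R.
by apply: eq_bigr => i _; rewrite tnthS.
Qed.

(** An independent centered summand can only increase the moment: Fubini integrates the new
    coordinate first, and Jensen's inequality applies to it with the others fixed. *)
Lemma le_max0_mgfS n K (phi : 'I_K -> T -> R) (c : nat -> R) (a : 'I_K -> R) :
  (forall k, centered (phi k)) ->
  max0_mgf n phi (c \o S) a <= max0_mgf n.+1 phi c a.
Proof.
move=> cphi.
have mphi k : measurable_fun setT (phi k).
  by have [iphi _] := cphi k; apply/measurable_EFinP; exact: measurable_int iphi.
rewrite max0_mgfS// /max0_mgf.
pose F (p : T * n.-tuple T) := (expR (max0 (fun k => a k + c 0%N * phi k p.1 +
   \sum_(i < n) c i.+1 * phi k (tnth p.2 i))%R))%:E.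
have mF : measurable_fun [set: T * n.-tuple T] F.
  apply/measurable_EFinP; apply: (measurableT_comp (@measurable_expR R)).
  apply: measurable_max0 => k; apply: measurable_funD => //.
    apply: measurable_funD => //; apply: measurable_funM => //.
    exact: (measurableT_comp (mphi k)).
  apply: measurable_sum => i; apply: measurable_funM => //.
  apply: (measurableT_comp (mphi k)) => //.
  by apply: (measurableT_comp (measurable_tnth i)).
have F0 p : 0 <= F p by rewrite lee_fin expR_ge0.
rewrite [leRHS](_ : _ = \int[mu]_x \int[iid mu n]_t F (x, t))//.
rewrite (fubini_tonelli F mF F0).
apply: ge0_le_integral => //.
- exact: (@measurable_max0_mgf n K phi (c \o S)).
- exact: measurable_fun_fubini_tonelli_G.
move=> t _.
have := @max0_le_integral_centered K (fun k x => c 0%N * phi k x)%R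
  (fun k => a k + \sum_(i < n) c i.+1 * phi k (tnth t i))%R
  (fun k => centered_scale (c 0%N) (cphi k)).
rewrite /F /= => /le_trans; apply.
by rewrite le_eqVlt; apply/orP; left; apply/eqP; apply: eq_integral => x _;
  congr (expR _)%:E; apply: eq_bigr => k _; rewrite addrAC.
Qed.

(* A signed sum dominates each of its two halves by Jensen's inequality, and the
   opposite signs recover the other half: no ghost sample is needed. *)
Lemma plain_mgf_le n K (phi : 'I_K -> T -> R) (c : nat -> R) (a b : 'I_K -> R) :
  (forall k, centered (phi k)) -> (forall i, c i = 1 \/ c i = -1)%R ->
  max0_mgf n phi (fun=> 1%R) (fun k => a k + b k)%R <=
  max0_mgf n phi c a * max0_mgf n phi (fun i => - c i)%R b.
Proof.
move=> cphi.
have mphi k : measurable_fun setT (phi k).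
  by have [iphi _] := cphi k; apply/measurable_EFinP; exact: measurable_int iphi.
elim: n c a b => [|n IH] c a b c1.
  rewrite !max0_mgf0// -EFinM lee_fin -expRD ler_expR.
  by apply: max0_le => [|k]; rewrite ?addr_ge0 ?lerD ?max0_ge0 ?max0_ge.
have IHc := IH (c \o S) _ _ (fun i => c1 i.+1).
rewrite max0_mgfS//.
have mR (c' : nat -> R) (u : 'I_K -> R) : measurable_fun setT
   (fun x => max0_mgf n phi (c' \o S) (fun k => u k + c' 0%N * phi k x)%R).
  exact: measurable_max0_mgfS.
(* A coordinate of sign +1 is integrated inside the first factor, while the second factor receives
   it afterwards and only grows by [le_max0_mgfS]. For sign -1 the two factors exchange roles. *)
have [c0|c0] := c1 0%N.
- apply: (@le_trans _ _ (\int[mu]_x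
    (max0_mgf n phi (c \o S) (fun k => a k + c 0%N * phi k x)%R *
     max0_mgf n phi (fun i => - c i.+1)%R b))).
    apply: ge0_le_integral => //.
    + by move=> x _; exact: max0_mgf_ge0.
    + by apply: emeasurable_funM => //; exact: mR.
    move=> x _; apply: le_trans (IHc _ _); rewrite le_eqVlt; apply/orP; left.
    apply/eqP; congr max0_mgf; apply/funext => k; rewrite c0 !mul1r.
    by rewrite addrAC.
  rewrite ge0_integralZr//; last 2 first.
  + by move=> x _; exact: max0_mgf_ge0.
  + exact: max0_mgf_ge0.
  rewrite -max0_mgfS//; apply: lee_pmul; rewrite ?max0_mgf_ge0//.
  exact: (@le_max0_mgfS n K phi (fun i => - c i)%R b cphi).
- apply: (@le_trans _ _ (\int[mu]_x
    (max0_mgf n phi (c \o S) a *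
     max0_mgf n phi (fun i => - c i.+1)%R (fun k => b k + (- c 0%N) * phi k x)%R))).
    apply: ge0_le_integral => //.
    + by move=> x _; exact: max0_mgf_ge0.
    + by apply: emeasurable_funM => //; exact: (mR (fun i => - c i)%R).
    move=> x _; apply: le_trans (IHc _ _); rewrite le_eqVlt; apply/orP; left.
    apply/eqP; congr max0_mgf; apply/funext => k; rewrite c0 opprK !mul1r.
    by rewrite addrA.
  rewrite ge0_integralZl//; last 3 first.
  + exact: (mR (fun i => - c i)%R b).
  + by move=> x _; exact: max0_mgf_ge0.
  + exact: max0_mgf_ge0.
  rewrite -(@max0_mgfS n K phi (fun i => - c i)%R)//.
  by apply: lee_pmul; rewrite ?max0_mgf_ge0//; exact: le_max0_mgfS.
Qed.

End symmetrization.

Lemma mule_le_sqr {R : realType} (x y : \bar R) (b : R) :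
  (0 <= x -> 0 <= y -> x < +oo -> y < +oo ->
  (fine x + fine y <= b + b)%R -> x * y <= (b ^+ 2)%:E)%E.
Proof.
case: x => [x| |]//; case: y => [y| |]//; rewrite -EFinM !lee_fin /= => x0 y0 _ _ xy.
by have := sqr_ge0 (x - y); nra.
Qed.

(** Negation permutes the sign patterns, so the average of v e + v (neg_sign e) is at most 2 b and
    some pattern does not exceed it. *)
Lemma exists_sign_pair_le {R : realType} n (v : {ffun 'I_n -> bool} -> R) (b : R) :
  \sum_e v e <= 2 ^+ n * b -> exists e, v e + v (neg_sign e) <= b + b.
Proof.
move=> vb; apply: contrapT => /forallNP h.
have : \sum_(e : {ffun 'I_n -> bool}) (b + b) < \sum_e (v e + v (neg_sign e)).
  apply: ltr_sum => [|e _]; last by rewrite ltNge; apply/negP; exact: h.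
  by apply/hasP; exists [ffun=> true]; rewrite ?mem_index_enum.
apply/negP; rewrite -leNgt big_split /=.
have -> : \sum_e v (neg_sign e) = \sum_e v e.
  by rewrite [RHS](reindex_inj (can_inj neg_signK)).
rewrite sumr_const card_ffun card_bool card_ord -mulr_natl natrX mulrDr.
exact: lerD.
Qed.

(** * Moments of centered sums through signed sums *)

Section deviation_mgf.
Local Open Scope ereal_scope.
Context {d : measure_display} {T : measurableType d} {R : realType}.
Variables (mu : probability T R) (n : nat) (theta : R).
Hypothesis theta0 : (0 <= theta)%R.
Implicit Types (phi f g : T -> R) (t : n.-tuple T).

Definition integrable_fun phi := mu.-integrable setT (EFin \o phi).

Definition expect phi : R := fine (\int[mu]_x (phi x)%:E).

Definition deviation phi t : R := (\sum_i (phi (tnth t i) - expect phi))%R.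

Lemma integrable_fun_measurable phi : integrable_fun phi -> measurable_fun setT phi.
Proof. by move=> iphi; apply/measurable_EFinP; exact: measurable_int iphi. Qed.

Lemma integral_expect phi : integrable_fun phi -> \int[mu]_x (phi x)%:E = (expect phi)%:E.
Proof. by move=> iphi; rewrite fineK//; exact: integrable_fin_num. Qed.

Lemma integrable_fun_abs phi : integrable_fun phi -> integrable_fun (fun x => `|phi x|%R).
Proof. by move=> iphi; have := integrable_abse iphi. Qed.

Lemma integrable_funZ (c : R) phi : integrable_fun phi -> integrable_fun (fun x => c * phi x)%R.
Proof.
move=> iphi; rewrite /integrable_fun (_ : _ \o _ = (fun x => c%:E * (EFin \o phi) x)).
  exact: integrableZl.
by apply/funext => x /=; rewrite EFinM.
Qed.

Lemma expectZ (c : R) phi : integrable_fun phi -> expect (fun x => c * phi x)%R = (c * expect phi)%R.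
Proof.
move=> iphi; rewrite /expect; under eq_integral do rewrite EFinM.
by rewrite integralZl// integral_expect.
Qed.

Lemma integrable_fun_sum K (h : 'I_K -> T -> R) : (forall k, integrable_fun (h k)) ->
  integrable_fun (fun x => \sum_k h k x)%R.
Proof.
move=> ih; rewrite /integrable_fun (_ : _ \o _ = (fun x => \sum_k (EFin \o h k) x)).
  by apply: integrable_sum => // k _; exact: ih.
by apply/funext => x /=; rewrite sumEFin.
Qed.

Lemma expect_sum K (h : 'I_K -> T -> R) : (forall k, integrable_fun (h k)) ->
  expect (fun x => \sum_k h k x)%R = (\sum_k expect (h k))%R.
Proof.
move=> ih; rewrite [LHS]/expect; under eq_integral do rewrite -sumEFin.
rewrite integral_sum//.
transitivity (fine (\sum_k (expect (h k))%:E)); last by rewrite sumEFin.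
by congr fine; apply: eq_bigr => k _; rewrite integral_expect.
Qed.

Lemma deviationZ (c : R) phi t : integrable_fun phi ->
  deviation (fun x => c * phi x)%R t = (c * deviation phi t)%R.
Proof.
move=> iphi; rewrite /deviation expectZ// mulr_sumr.
by apply: eq_bigr => i _; rewrite mulrBr.
Qed.

Lemma deviation_sum K (h : 'I_K -> T -> R) t : (forall k, integrable_fun (h k)) ->
  deviation (fun x => \sum_k h k x)%R t = (\sum_k deviation (h k) t)%R.
Proof.
move=> ih; rewrite /deviation expect_sum// exchange_big /=.
by apply: eq_bigr => i _; rewrite sumrB.
Qed.

Lemma measurable_deviation phi : measurable_fun setT phi ->
  measurable_fun [set: n.-tuple T] (deviation phi).
Proof.
move=> mphi; apply: measurable_sum => i; apply: measurable_funB => //.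
by apply: (measurableT_comp mphi); exact: measurable_tnth.
Qed.

Lemma integrable_fun_relu phi : integrable_fun phi -> integrable_fun (fun x => relu (phi x)).
Proof.
move=> iphi; apply: (le_integrable _ _ _ iphi) => //.
  apply/measurable_EFinP; apply: measurable_maxr => //.
  exact: integrable_fun_measurable.
by move=> x _ /=; rewrite lee_fin relu_norm_le.
Qed.

Lemma integrable_fun_hull (D : set (T -> R)) f :
  (forall g, D g -> integrable_fun g) -> relu_hull D f -> integrable_fun f.
Proof.
move=> Di [K [a [g [Dg a1 ->]]]].
apply: integrable_fun_sum => k; apply: integrable_funZ.
by apply: integrable_fun_relu; exact: Di.
Qed.

Lemma integrable_fun_tower (D : set (T -> R)) j f :
  (forall g, D g -> integrable_fun g) -> relu_tower D j f -> integrable_fun f.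
Proof.
move=> Di; elim: j f => [|j IH] f /=; first exact: Di.
exact: integrable_fun_hull.
Qed.

Lemma deviation_relu g t : integrable_fun g ->
  (`|deviation (fun x => relu (g x)) t| <=
   2^-1 * `|deviation g t| + 2^-1 * `|deviation (fun x => `|g x|) t|)%R.
Proof.
move=> ig; have iag := integrable_fun_abs ig.
have -> : (fun x => relu (g x)) = (fun x => \sum_(b < 2) (if b == 0%N :> nat then 2^-1 * g x else 2^-1 * `|g x|))%R.
  by apply/funext => x; rewrite big_ord_recl big_ord1 /= relu_half.
rewrite deviation_sum; last first.
  by case=> -[|[|//]] b2 /=; exact: integrable_funZ.
rewrite big_ord_recl big_ord1 /= !deviationZ// (le_trans (ler_normD _ _))//.
by rewrite !normrM ger0_norm// invr_ge0.
Qed.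

Lemma measurable_max0_norm K (s : 'I_K -> n.-tuple T -> R) :
  (forall k, measurable_fun [set: n.-tuple T] (s k)) ->
  measurable_fun [set: n.-tuple T] (fun t => (expR (theta * max0 (fun k => `|s k t|)))%:E)%R.
Proof.
move=> ms; apply/measurable_EFinP; apply: (measurableT_comp (@measurable_expR R)).
apply: measurable_funM => //; apply: measurable_max0 => k.
exact: (measurableT_comp (@normr_measurable R setT)).
Qed.

Lemma max0_scale K (s : 'I_K -> R) : (theta * max0 s)%R = max0 (fun k => theta * s k)%R.
Proof.
rewrite /max0; elim/big_ind2: _ => //; first by rewrite mulr0.
by move=> x x' y y' <- <-; rewrite maxr_pMr.
Qed.

(** [max0_mgf] shifts its coefficients and so indexes them by nat; the padding value 1 keeps every
    one of them a sign. *)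
Definition sign_seq (e : {ffun 'I_n -> bool}) (i : nat) : R :=
  if insub i is Some j then ((-1) ^+ e j)%R else 1%R.

Lemma sign_seqE e (i : 'I_n) : sign_seq e i = ((-1) ^+ e i)%R.
Proof. by rewrite /sign_seq valK. Qed.

Lemma sign_seq1 e i : (sign_seq e i = 1 \/ sign_seq e i = -1)%R.
Proof.
rewrite /sign_seq; case: insub => [j|]; last by left.
by case: (e j); [right; rewrite expr1|left; rewrite expr0].
Qed.

(** The moment is at most u(e) u(-e) for every sign pattern e, where u(e) is the moment of the
    maximal signed sum. Choosing e with u(e) + u(-e) <= 2 b gives b^2 without comparing different
    patterns. *)
Lemma deviation_mgf_le K (phi : 'I_K -> T -> R) (b : R) :
  (forall k, integrable_fun (phi k)) ->
  \sum_(e : {ffun 'I_n -> bool}) \int[iid mu n]_t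
     (expR (theta * max0 (fun k => signed_sum e (fun i => phi k (tnth t i)))))%:E
  <= (2 ^+ n * b)%:E ->
  \int[iid mu n]_t (expR (theta * max0 (fun k => deviation (phi k) t)))%:E
  <= (b ^+ 2)%:E.
Proof.
move=> iphi le.
pose psi k x := (theta * (phi k x - expect (phi k)))%R.
have cpsi k : centered mu (psi k).
  have ic : mu.-integrable setT (fun=> (expect (phi k))%:E).
    exact: finite_measure_integrable_cst.
  apply: centered_scale; split; first exact: (integrableB measurableT (iphi k) ic).
  under eq_integral do rewrite EFinB.
  rewrite (integralB measurableT (iphi k) ic).
  by rewrite integral_expect// integral_cst_probability subee.
(* This offset undoes the centering of [psi] and leaves signed sums of the [phi k] themselves. The
   offsets for [e] and [neg_sign e] are opposite, so together they leave the centered sum without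
   offset. *)
pose a (c : nat -> R) k := (theta * (\sum_(i < n) c i * expect (phi k)))%R.
have mgfE (e : {ffun 'I_n -> bool}) :
    max0_mgf mu n psi (sign_seq e) (a (sign_seq e)) = \int[iid mu n]_t
     (expR (theta * max0 (fun k => signed_sum e (fun i => phi k (tnth t i)))))%:E.
  apply: eq_integral => t _; rewrite max0_scale; congr (expR _)%:E.
  apply: eq_bigr => k _; rewrite /a /psi /signed_sum !mulr_sumr -big_split /=.
  by apply: eq_bigr => i _; rewrite sign_seqE; ring.
have plainE : \int[iid mu n]_t (expR (theta * max0 (fun k => deviation (phi k) t)))%:E =
    max0_mgf mu n psi (fun=> 1%R) (fun=> 0%R).
  apply: eq_integral => t _; rewrite max0_scale; congr (expR _)%:E.
  apply: eq_bigr => k _; rewrite /psi add0r mulr_sumr.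
  by apply: eq_bigr => i _; rewrite mul1r.
pose u (e : {ffun 'I_n -> bool}) := max0_mgf mu n psi (sign_seq e) (a (sign_seq e)).
have u0 e : 0 <= u e by exact: max0_mgf_ge0.
have ule e : u e < +oo.
  apply: le_lt_trans (ltry (2 ^+ n * b)); apply: le_trans le.
  rewrite (bigD1 e)//= -mgfE leeDl// sume_ge0// => e' _.
  by apply: integral_ge0 => t _; rewrite lee_fin expR_ge0.
have ufin e : u e = (fine (u e))%:E by rewrite fineK// ge0_fin_numE.
have uu e : max0_mgf mu n psi (fun=> 1%R) (fun=> 0%R) <= u e * u (neg_sign e).
  have := @plain_mgf_le _ _ _ mu n K psi (sign_seq e) (a (sign_seq e))
    (fun k => - a (sign_seq e) k)%R cpsi (sign_seq1 e).
  under [X in max0_mgf _ _ _ (fun=> 1%R) X]funext do rewrite subrr.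
  move=> /le_trans; apply; rewrite le_eqVlt; apply/orP; left; apply/eqP.
  congr (_ * _); rewrite /u mgfE; apply: eq_integral => t _.
  rewrite max0_scale; congr (expR _)%:E.
  apply: eq_bigr => k _; rewrite /a /psi /signed_sum !mulr_sumr -sumrN -big_split /=.
  by apply: eq_bigr => i _; rewrite sign_seqE ffunE signrN; ring.
have hs : (\sum_(e : {ffun 'I_n -> bool}) fine (u e) <= 2 ^+ n * b)%R.
  rewrite -lee_fin -sumEFin; apply: le_trans le.
  by apply: lee_sum => e _; rewrite -ufin /u mgfE.
have [e he] := exists_sign_pair_le hs.
rewrite plainE; apply: le_trans (uu e) _.
exact: (mule_le_sqr (u0 e) (u0 _) (ule e) (ule _) he).
Qed.

End deviation_mgf.

Lemma ge0_integral_lincomb_le {d : measure_display} {T : measurableType d} {R : realType}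
    (mu : {measure set T -> \bar R}) (f g : T -> \bar R) (a b : R) (x y : \bar R) :
  measurable_fun setT f -> measurable_fun setT g ->
  (forall t, 0 <= f t)%E -> (forall t, 0 <= g t)%E -> 0 <= a -> 0 <= b ->
  (\int[mu]_t f t <= x)%E -> (\int[mu]_t g t <= y)%E ->
  (\int[mu]_t (a%:E * f t + b%:E * g t) <= a%:E * x + b%:E * y)%E.
Proof.
move=> mf mg f0 g0 a0 b0 fx gy.
have maf : measurable_fun setT (fun t => a%:E * f t)%E.
  by apply: emeasurable_funM => //; exact: measurable_cst.
have mbg : measurable_fun setT (fun t => b%:E * g t)%E.
  by apply: emeasurable_funM => //; exact: measurable_cst.
rewrite ge0_integralD//; last 2 first.
- by move=> t _; rewrite mule_ge0 ?lee_fin.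
- by move=> t _; rewrite mule_ge0 ?lee_fin.
rewrite !ge0_integralZl//.
by apply: leeD; apply: lee_wpmul2l; rewrite ?lee_fin.
Qed.

(** * Exponential moments over the ReLU tower *)

Section tower_mgf.
Local Open Scope ereal_scope.
Context {d : measure_display} {T : measurableType d} {R : realType}.
Variables (mu : probability T R) (n : nat) (theta : R).
Hypothesis theta0 : (0 <= theta)%R.
Variables (D : set (T -> R)) (b0 : n.-tuple T -> R) (e0 : R).
Hypothesis D0 : D (fun=> 0%R).
Hypothesis Di : forall f, D f -> integrable_fun mu f.
Hypothesis mb0 : measurable_fun [set: n.-tuple T] b0.
Hypothesis Db0 : forall t, rademacher_le D (tnth t) theta (b0 t).
Hypothesis ib0 : \int[iid mu n]_t (b0 t)%:E <= (2 ^+ n * expR e0)%:E.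

Let b0_ge0 t : (0 <= b0 t)%R.
Proof.
apply: le_trans (Db0 t (fun=> D0)); apply: sumr_ge0 => e _; exact: expR_ge0.
Qed.

Lemma expR_max0_norm K (s : 'I_K -> R) :
  (expR (theta * max0 (fun k => `|s k|)) <=
   expR (theta * max0 s) + expR (theta * max0 (fun k => - s k)))%R.
Proof.
have [->|[k ->]] := max0_attained (fun k => `|s k|%R).
  rewrite mulr0 expR0 (@le_trans _ _ (expR (theta * max0 s)))//.
    by rewrite -expR0 ler_expR mulr_ge0// max0_ge0.
  by rewrite lerDl expR_ge0.
case: (leP 0%R (s k)) => sk; rewrite ?(ger0_norm sk) ?(ltr0_norm sk).
  rewrite (@le_trans _ _ (expR (theta * max0 s)))//.
    by rewrite ler_expR ler_wpM2l// max0_ge.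
  by rewrite lerDl expR_ge0.
rewrite (@le_trans _ _ (expR (theta * max0 (fun k => - s k)%R)))//.
  by rewrite ler_expR ler_wpM2l// (max0_ge (fun k => - s k)%R).
by rewrite lerDr expR_ge0.
Qed.

Lemma measurable_deviation_max0 K (phi : 'I_K -> T -> R) :
  (forall k, integrable_fun mu (phi k)) ->
  measurable_fun [set: n.-tuple T]
    (fun t => (expR (theta * max0 (fun k => deviation mu (phi k) t)))%:E).
Proof.
move=> iphi; apply/measurable_EFinP; apply: (measurableT_comp (@measurable_expR R)).
apply: measurable_funM => //; apply: measurable_max0 => k.
by apply: measurable_deviation; exact: integrable_fun_measurable (iphi k).
Qed.

(** The maxima of the deviations and of their opposites are symmetrized separately, whence the
    factor 2. Signed sums of [- phi] are signed sums of [phi] for the negated pattern, so one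
    hypothesis serves both. *)
Lemma deviation_mgf_norm_le K (phi : 'I_K -> T -> R) (q : R) : (0 <= q)%R ->
  (forall k, integrable_fun mu (phi k)) ->
  (forall t, \sum_(e : {ffun 'I_n -> bool})
    expR (theta * max0 (fun k => signed_sum e (fun i => phi k (tnth t i)))) <= q * b0 t)%R ->
  \int[iid mu n]_t (expR (theta * max0 (fun k => `|deviation mu (phi k) t|)%R))%:E
  <= (2 * (q * expR e0) ^+ 2)%:E.
Proof.
move=> q0 iphi H.
have one_sided (chi : 'I_K -> T -> R) : (forall k, integrable_fun mu (chi k)) ->
  (forall t, \sum_(e : {ffun 'I_n -> bool})
    expR (theta * max0 (fun k => signed_sum e (fun i => chi k (tnth t i)))) <= q * b0 t)%R ->
  \int[iid mu n]_t (expR (theta * max0 (fun k => deviation mu (chi k) t)))%:E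
  <= ((q * expR e0) ^+ 2)%:E.
  move=> ichi Hchi; apply: deviation_mgf_le => //.
  have mS (e : {ffun 'I_n -> bool}) : measurable_fun [set: n.-tuple T]
     (fun t => (expR (theta * max0 (fun k => signed_sum e (fun i => chi k (tnth t i)))))%:E).
    apply/measurable_EFinP; apply: (measurableT_comp (@measurable_expR R)).
    apply: measurable_funM => //; apply: measurable_max0 => k.
    apply: measurable_sum => i; apply: measurable_funM => //.
    apply: (measurableT_comp (integrable_fun_measurable (ichi k))).
    exact: measurable_tnth.
  rewrite -ge0_integral_sum//.
  apply: (@le_trans _ _ (\int[iid mu n]_t (q%:E * (b0 t)%:E))).
    apply: ge0_le_integral => //.
    - by move=> t _; apply: sume_ge0 => e _; rewrite lee_fin expR_ge0.
    - by apply: emeasurable_sum => e; exact: mS.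
    - by apply: emeasurable_funM => //; exact/measurable_EFinP.
    - by move=> t _; rewrite sumEFin -EFinM lee_fin; exact: Hchi.
  rewrite ge0_integralZl//; last 2 first.
  - exact/measurable_EFinP.
  - by move=> t _; rewrite lee_fin.
  by rewrite mulrCA EFinM; apply: lee_wpmul2l; rewrite ?lee_fin.
have iNphi k : integrable_fun mu (fun x => -1 * phi k x)%R by exact: integrable_funZ.
apply: (@le_trans _ _ (\int[iid mu n]_t
   ((expR (theta * max0 (fun k => deviation mu (phi k) t)))%:E +
    (expR (theta * max0 (fun k => deviation mu (fun x => -1 * phi k x)%R t)))%:E))).
  apply: ge0_le_integral => //.
  - by apply: measurable_max0_norm => k; apply: measurable_deviation;
      exact: integrable_fun_measurable (iphi k).
  - by apply: emeasurable_funD; exact: measurable_deviation_max0.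
  move=> t _; rewrite -EFinD lee_fin.
  under [X in (_ <= _ + expR (_ * max0 X))%R]funext do rewrite deviationZ// mulN1r.
  exact: expR_max0_norm.
rewrite ge0_integralD//; [|exact: measurable_deviation_max0|exact: measurable_deviation_max0].
rewrite mulr2n mulrDl mul1r EFinD; apply: leeD; apply: one_sided => // t.
rewrite (reindex_inj (can_inj neg_signK))/=.
rewrite (le_trans _ (H t))//; apply: ler_sum => e _; rewrite ler_expR ler_wpM2l//.
rewrite le_eqVlt; apply/orP; left; apply/eqP; apply: eq_bigr => k _.
rewrite signed_sumN -signed_sum_oppr; apply: eq_bigr => i _.
by rewrite mulN1r opprK.
Qed.

Let r2 := Num.sqrt 2 : R.

Lemma expR_ln2_bound j :
  (2 * (r2 ^+ j * expR e0) ^+ 2 <= expR ((1 + j%:R) * ln 2 + 2 * e0))%R.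
Proof.
have -> : expR ((1 + j%:R) * ln 2 + 2 * e0) = (2 * 2 ^+ j * expR e0 ^+ 2)%R :> R.
  rewrite expRD mulrDl mul1r expRD !expRM_natl lnK ?posrE//.
by rewrite exprMn -exprM mulnC exprM sqr_sqrtr// mulrA.
Qed.

Lemma tower_deviation_mgf_le K (g : 'I_K -> T -> R) j :
  (forall k, relu_tower D j (g k)) ->
  \int[iid mu n]_t (expR (theta * max0 (fun k => `|deviation mu (g k) t|)%R))%:E
  <= (2 * (r2 ^+ j * expR e0) ^+ 2)%:E.
Proof.
move=> Dg; apply: deviation_mgf_norm_le.
- by rewrite exprn_ge0// sqrtr_ge0.
- by move=> k; apply: integrable_fun_tower (Dg k).
move=> t.
have /choice[f fE] (e : {ffun 'I_n -> bool}) : exists f, relu_tower D j f /\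
    max0 (fun k => signed_sum e (fun i => g k (tnth t i))) =
    signed_sum e (fun i => f (tnth t i)).
  have [->|[k ->]] := max0_attained (fun k => signed_sum e (fun i => g k (tnth t i))).
    exists (fun=> 0%R); split; first exact: relu_tower0.
    by rewrite /signed_sum big1// => i _; rewrite mulr0.
  by exists (g k).
have := rademacher_le_tower (j := j) theta0 D0 (Db0 t) (fun e => (fE e).1).
apply: le_trans; apply: ler_sum => e _; rewrite ler_expR ler_wpM2l// (fE e).2.
exact: ler_norm.
Qed.

Lemma tower_abs_deviation_mgf_le K (g : 'I_K -> T -> R) j :
  (forall k, relu_tower D j (g k)) ->
  \int[iid mu n]_t
    (expR (theta * max0 (fun k => `|deviation mu (fun x => `|g k x|) t|)%R))%:E
  <= (2 * (r2 ^+ j * expR e0) ^+ 2)%:E.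
Proof.
move=> Dg; apply: (@deviation_mgf_norm_le K (fun k x => `|g k x|%R)).
- by rewrite exprn_ge0// sqrtr_ge0.
- by move=> k; apply: integrable_fun_abs; apply: integrable_fun_tower (Dg k).
move=> t.
have /choice[f fE] (e : {ffun 'I_n -> bool}) : exists f, relu_tower D j f /\
    max0 (fun k => signed_sum e (fun i => `|g k (tnth t i)|%R)) =
    signed_sum e (fun i => `|f (tnth t i)|%R).
  have [->|[k ->]] := max0_attained (fun k => signed_sum e (fun i => `|g k (tnth t i)|%R)).
    exists (fun=> 0%R); split; first exact: relu_tower0.
    by rewrite /signed_sum big1// => i _; rewrite normr0 mulr0.
  by exists (g k).
have := rademacher_le_abs theta0 (rademacher_le_tower (j := j) theta0 D0 (Db0 t)) (fun e => (fE e).1).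
by apply: le_trans; apply: ler_sum => e _; rewrite ler_expR ler_wpM2l// (fE e).2.
Qed.

(** Finite families make the maximum measurable; a bound uniform in [K] is what lets a monotone
    limit reach countable families. *)
Definition deviation_mgf_bounded (C : set (T -> R)) (v : R) :=
  forall K (g : 'I_K -> T -> R), (forall k, C (g k)) ->
  \int[iid mu n]_t (expR (theta * max0 (fun k => `|deviation mu (g k) t|)%R))%:E
  <= (expR v)%:E.

(** Finitely many members of the hull involve finitely many generators altogether, collected in the
    finite type [J]. Deviations are linear, so each is dominated by the largest deviation of the
    relu of a generator. *)
Lemma deviation_hull_le (C : set (T -> R)) K (f : 'I_K -> T -> R) :
  (forall g, C g -> integrable_fun mu g) -> (forall k, relu_hull C (f k)) ->
  exists N (g : 'I_N -> T -> R), (forall l, C (g l)) /\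
    forall t : n.-tuple T, (max0 (fun k => `|deviation mu (f k) t|) <=
     2^-1 * max0 (fun l => `|deviation mu (g l) t|) +
     2^-1 * max0 (fun l => `|deviation mu (fun x => `|g l x|) t|))%R.
Proof.
move=> Ci Cf.
have /choice[p pP] (k : 'I_K) : exists p : {N : nat & (('I_N -> R) * ('I_N -> T -> R))%type},
   [/\ forall l, C ((projT2 p).2 l), (\sum_l `|(projT2 p).1 l| <= 1)%R
    & f k = fun x => (\sum_l (projT2 p).1 l * relu ((projT2 p).2 l x))%R].
  have [N [a [g [Cg a1 fE]]]] := Cf k.
  by exists (existT _ N (a, g)).
pose J := {k : 'I_K & 'I_(projT1 (p k))}.
pose gJ (s : J) : T -> R := (projT2 (p (tag s))).2 (tagged s).
exists #|{: J}|, (fun l => gJ (enum_val l)); split.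
  by move=> l; have [Cg _ _] := pP (tag (enum_val l)); exact: Cg.
move=> t; set u := max0 (fun l => `|deviation mu (gJ (enum_val l)) t|)%R.
set v := max0 (fun l => `|deviation mu (fun x => `|gJ (enum_val l) x|) t|)%R.
have u0 : (0 <= u)%R by exact: max0_ge0.
have v0 : (0 <= v)%R by exact: max0_ge0.
have uv0 : (0 <= 2^-1 * u + 2^-1 * v)%R by rewrite addr_ge0 ?mulr_ge0 ?invr_ge0.
apply: max0_le => // k; have [Cg a1 ->] := pP k.
have ir l : integrable_fun mu (fun x => relu ((projT2 (p k)).2 l x)).
  by apply: integrable_fun_relu; exact: Ci.
rewrite deviation_sum; last by move=> l; apply: integrable_funZ.
under eq_bigr do rewrite deviationZ//.
apply: norm_sum_hull => // l.
apply: (le_trans (deviation_relu _ (Ci _ (Cg l)))).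
pose s : J := Tagged (fun k => 'I_(projT1 (p k))) l.
apply: lerD; rewrite ler_wpM2l ?invr_ge0//.
  have := max0_ge (fun l => `|deviation mu (gJ (enum_val l)) t|)%R (enum_rank s).
  by rewrite enum_rankK.
have := max0_ge (fun l => `|deviation mu (fun x => `|gJ (enum_val l) x|) t|)%R (enum_rank s).
by rewrite enum_rankK.
Qed.

Lemma deviation_mgf_bounded_hull (C : set (T -> R)) (v w : R) :
  (forall g, C g -> integrable_fun mu g) ->
  deviation_mgf_bounded C v ->
  (forall K (g : 'I_K -> T -> R), (forall k, C (g k)) ->
    \int[iid mu n]_t
     (expR (theta * max0 (fun k => `|deviation mu (fun x => `|g k x|) t|)%R))%:E
    <= (expR w)%:E) ->
  deviation_mgf_bounded (relu_hull C) (2^-1 * v + 2^-1 * w).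
Proof.
move=> Ci Cv Cw K f Cf.
have [N [g [Cg fg]]] := deviation_hull_le Ci Cf.
(* This weight in the AM-GM inequality equalizes the two terms, so that the exponents v and w are
   averaged. *)
pose c := expR (2^-1 * (w - v)); have c0 : (0 < c)%R by exact: expR_gt0.
have mf k : measurable_fun [set: n.-tuple T] (deviation mu (f k)).
  apply: measurable_deviation; apply: integrable_fun_measurable.
  exact: (integrable_fun_hull Ci (Cf k)).
have mg k : measurable_fun [set: n.-tuple T] (deviation mu (g k)).
  by apply: measurable_deviation; apply: integrable_fun_measurable; exact: Ci.
have mag k : measurable_fun [set: n.-tuple T] (deviation mu (fun x => `|g k x|%R)).
  apply: measurable_deviation; apply: integrable_fun_measurable.
  by apply: integrable_fun_abs; exact: Ci.
have mG := measurable_max0_norm theta mg.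
have mA := measurable_max0_norm theta mag.
have c20 : (0 <= 2^-1 * c)%R by rewrite mulr_ge0 ?invr_ge0 ?expR_ge0.
have c'20 : (0 <= 2^-1 * c^-1)%R by rewrite mulr_ge0 ?invr_ge0 ?expR_ge0.
have -> : (expR (2^-1 * v + 2^-1 * w) = 2^-1 * c * expR v + 2^-1 * c^-1 * expR w)%R.
  rewrite /c -expRN -!mulrA -!expRD.
  rewrite (_ : 2^-1 * (w - v) + v = 2^-1 * v + 2^-1 * w)%R; last lra.
  rewrite (_ : - (2^-1 * (w - v)) + w = 2^-1 * v + 2^-1 * w)%R; last lra.
  lra.
have E0 (r : R) : 0 <= (expR r)%:E by rewrite lee_fin expR_ge0.
rewrite EFinD (EFinM (2^-1 * c)%R) (EFinM (2^-1 * c^-1)%R).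
apply: le_trans (ge0_integral_lincomb_le mG mA (fun=> E0 _) (fun=> E0 _) c20 c'20
  (Cv _ _ Cg) (Cw _ _ Cg)).
apply: ge0_le_integral => //.
- exact: (measurable_max0_norm theta mf).
- apply: emeasurable_funD; (apply: emeasurable_funM; first exact: measurable_cst).
    exact: mG.
  exact: mA.
move=> t _; rewrite -!EFinM -EFinD lee_fin.
apply: le_trans (_ : _ <= expR (2^-1 * (theta * max0 (fun k => `|deviation mu (g k) t|)) +
  2^-1 * (theta * max0 (fun k => `|deviation mu (fun x => `|g k x|) t|))))%R _.
  rewrite ler_expR; apply: le_trans (ler_wpM2l theta0 (fg t)) _.
  by rewrite le_eqVlt; apply/orP; left; apply/eqP; ring.
by rewrite (le_trans (expR_half_le _ _ c0))// mulrDr !mulrA.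
Qed.

(** Solves v_{j+1} = v_j / 2 + ((1 + j) ln 2 + 2 e0) / 2, the second term being the symmetrized
    bound for absolute values. The coefficient of ln 2 is j - 1 + 2^-j, against j + 1 in
    [deviation_mgf_bounded_direct]. *)
Lemma deviation_mgf_bounded_tower (v0 : R) j : deviation_mgf_bounded D v0 ->
  deviation_mgf_bounded (relu_tower D j)
    ((j%:R - 1 + 2^-1 ^+ j) * ln 2 + 2 * (1 - 2^-1 ^+ j) * e0 + 2^-1 ^+ j * v0).
Proof.
move=> Dv0; elim: j => [|j IH].
  rewrite /= expr0 (_ : _ + _ = v0)%R//; lra.
have := @deviation_mgf_bounded_hull (relu_tower D j) _ ((1 + j%:R) * ln 2 + 2 * e0)
  (fun g => integrable_fun_tower Di) IH.
rewrite (_ : 2^-1 * _ + _ = (j.+1%:R - 1 + 2^-1 ^+ j.+1) * ln 2 +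
  2 * (1 - 2^-1 ^+ j.+1) * e0 + 2^-1 ^+ j.+1 * v0)%R; last first.
  by rewrite exprS -natr1; field.
apply => K g Dg; apply: le_trans (tower_abs_deviation_mgf_le Dg) _.
by rewrite lee_fin expR_ln2_bound.
Qed.

Lemma deviation_mgf_bounded_direct j :
  deviation_mgf_bounded (relu_tower D j) ((1 + j%:R) * ln 2 + 2 * e0).
Proof.
move=> K g Dg; apply: le_trans (tower_deviation_mgf_le Dg) _.
by rewrite lee_fin expR_ln2_bound.
Qed.

End tower_mgf.

(** * Sub-Gaussian linear classes *)

Section exponential_inequalities.
Context {R : realType}.
Implicit Types x t u : R.

(** The tangent at t u, evaluated at u and at 0 and combined with weights t and 1 - t. *)
Lemma expR_chord t u : 0 <= t <= 1 -> expR (t * u) <= 1 + t * (expR u - 1).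
Proof.
move=> /andP[t0 t1]; set w := expR (t * u).
have w0 : 0 < w by exact: expR_gt0.
have h1 : w * (1 + (1 - t) * u) <= expR u.
  have -> : expR u = w * expR ((1 - t) * u) by rewrite /w -expRD; congr expR; ring.
  by rewrite ler_pM2l// expR_ge1Dx.
have h2 : w * (1 - t * u) <= 1.
  rewrite [leRHS](_ : 1 = w * expR (- (t * u))); last by rewrite /w -expRD subrr expR0.
  by rewrite ler_pM2l// expR_ge1Dx.
have : (1 - t) * (w * (1 - t * u)) <= (1 - t) * 1 by rewrite ler_wpM2l// subr_ge0.
have : t * (w * (1 + (1 - t) * u)) <= t * expR u by rewrite ler_wpM2l.
have -> : t * (w * (1 + (1 - t) * u)) = w - (1 - t) * (w * (1 - t * u)) by ring.
lra.
Qed.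

Lemma fact_double_ge (k : nat) : (2 ^ k * k`! <= (k.*2)`!)%N.
Proof.
elim: k => // k IH; rewrite doubleS !factS expnS.
have -> : (2 * 2 ^ k * (k.+1 * k`!) = (2 * k.+1) * (2 ^ k * k`!))%N by lia.
have -> : (k.*2.+2 * (k.*2.+1 * (k.*2)`!) = (2 * k.+1) * (k.*2.+1 * (k.*2)`!))%N.
  by rewrite -doubleS -mul2n; lia.
by rewrite leq_mul2l/=; apply: leq_trans IH _; rewrite leq_pmull.
Qed.

(** Termwise comparison of power series: odd terms cancel, and [fact_double_ge] handles the even
    ones. *)
Lemma expR_cosh_le x : expR x + expR (- x) <= 2 * expR (x ^+ 2 / 2).
Proof.
have cv y := @is_cvg_series_exp_coeff R y.
suff H N : series (exp_coeff x) N + series (exp_coeff (- x)) N <= 2 * expR (x ^+ 2 / 2).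
  rewrite /expR -limD//; apply: limr_le; first exact: is_cvgD.
  by near=> N; exact: H.
rewrite [leLHS](_ : _ = \sum_(0 <= i < N) (x ^+ i + (- x) ^+ i) / i`!%:R); last first.
  rewrite /series /= -big_split /=; apply: eq_bigr => i _.
  by rewrite /exp_coeff /= mulrDl.
have tge0 i : 0 <= (x ^+ i + (- x) ^+ i) / i`!%:R.
  rewrite divr_ge0// exprNn -signr_odd; case: (boolP (odd i)) => oi.
    by rewrite expr1 mulN1r subrr.
  by rewrite expr0 mul1r addr_ge0// real_exprn_even_ge0// num_real.
(* The terms are nonnegative, so the partial sum may be extended to 2 N of them, whose consecutive
   pairs match N terms on the right. *)
apply: (@le_trans _ _ (\sum_(0 <= i < N.*2) (x ^+ i + (- x) ^+ i) / i`!%:R)).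
  rewrite [leRHS](@big_cat_nat _ _ _ N)//=; last by rewrite -addnn leq_addr.
  by rewrite lerDl sumr_ge0.
apply: (@le_trans _ _ (2 * series (exp_coeff (x ^+ 2 / 2)) N)); last first.
  rewrite ler_wpM2l//; apply: nondecreasing_cvgn_le => //.
  apply/nondecreasing_seqP => k; rewrite /series /= big_nat_recr//= lerDl.
  by rewrite exp_coeff_ge0// divr_ge0 ?sqr_ge0.
rewrite /series /= mulr_sumr.
elim: N {tge0} => [|N IH]; first by rewrite !big_geq.
rewrite doubleS 2?big_nat_recr//= [leRHS]big_nat_recr//= -addrA.
apply: lerD => //.
rewrite [X in _ + X](_ : _ = 0) ?addr0; last first.
  by rewrite exprNn -signr_odd /= odd_double expr1 mulN1r subrr mul0r.
rewrite exprNn -signr_odd odd_double expr0 mul1r -mulr2n -[X in X / _]mulr_natl -mulrA.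
rewrite /exp_coeff /= ler_pM2l// [in leRHS]exprMn -mul2n exprM -mulrA.
apply: ler_wpM2l; first by apply: exprn_ge0; exact: sqr_ge0.
rewrite exprVn -invfM lef_pV2 ?posrE ?mulr_gt0 ?exprn_gt0 ?ltr0n ?fact_gt0//.
by rewrite -natrX -natrM ler_nat mul2n fact_double_ge.
Unshelve. all: by end_near. Qed.

End exponential_inequalities.

Section product_mgf.
Local Open Scope ereal_scope.
Context {d : measure_display} {T : measurableType d} {R : realType}.
Variable mu : probability T R.

Lemma integral_iid_expR_le n (g : 'I_n -> T -> R) (c : 'I_n -> R) :
  (forall i, measurable_fun setT (g i)) ->
  (forall i, \int[mu]_x (expR (g i x))%:E <= (expR (c i))%:E) ->
  \int[iid mu n]_t (expR (\sum_i g i (tnth t i)))%:E <= (expR (\sum_i c i))%:E.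
Proof.
elim: n g c => [|n IH] g c mg gc.
  rewrite integral_iid0; last first.
    apply/measurable_EFinP; apply: (measurableT_comp (@measurable_expR R)).
    by apply: measurable_sum => -[].
  by rewrite !big_ord0.
have me : measurable_fun [set: n.+1.-tuple T] (fun t => (expR (\sum_i g i (tnth t i)))%:E).
  apply/measurable_EFinP; apply: (measurableT_comp (@measurable_expR R)).
  apply: measurable_sum => i; apply: (measurableT_comp (mg i)).
  exact: measurable_tnth.
rewrite integral_iidS//.
pose I' := \int[iid mu n]_t (expR (\sum_i g (lift ord0 i) (tnth t i)))%:E.
have I'c : I' <= (expR (\sum_i c (lift ord0 i)))%:E.
  by apply: (IH (fun i => g (lift ord0 i)) (fun i => c (lift ord0 i))) => i; [exact: mg|exact: gc].
have I'0 : 0 <= I' by apply: integral_ge0 => t _; rewrite lee_fin expR_ge0.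
rewrite (_ : \int[mu]_x _ = \int[mu]_x ((expR (g ord0 x))%:E * I')); last first.
  apply: eq_integral => x _; rewrite /I' -ge0_integralZl//; last first.
  - apply/measurable_EFinP; apply: (measurableT_comp (@measurable_expR R)).
    apply: measurable_sum => i; apply: (measurableT_comp (mg _)).
    exact: measurable_tnth.
  apply: eq_integral => t _; rewrite -EFinM -expRD big_ord_recl; congr (expR (_ + _))%:E.
  by apply: eq_bigr => i _; rewrite tnthS.
rewrite ge0_integralZr//; last first.
  by apply/measurable_EFinP; apply: (measurableT_comp (@measurable_expR R)).
rewrite big_ord_recl expRD EFinM; apply: lee_pmul => //.
by apply: integral_ge0 => x _; rewrite lee_fin expR_ge0.
Qed.

End product_mgf.

(** * Gaussian linearization of squares *)

Section gaussian_linearization.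
Local Open Scope ereal_scope.
Context {R : realType}.
Notation leb := (@lebesgue_measure R).

Definition std_pdf (x : R) : R := normal_pdf 0 1 x.

Lemma std_pdf_ge0 x : (0 <= std_pdf x)%R. Proof. exact: normal_pdf_ge0. Qed.

Lemma measurable_std_pdf : measurable_fun setT std_pdf.
Proof. exact: measurable_normal_pdf. Qed.

(** Completing the square gives a multiple of the normal density of mean b / (1 - v) and variance 1
    / (1 - v). *)
Lemma gaussian_mgf (b v : R) : (v < 1)%R ->
  \int[leb]_x (expR (b * x + v * x ^+ 2 / 2) * std_pdf x)%:E
  = (expR (b ^+ 2 / (2 * (1 - v))) / Num.sqrt (1 - v))%:E.
Proof.
move=> v1; have u0 : (0 < 1 - v)%R by rewrite subr_gt0.
have un0 : (1 - v != 0)%R by rewrite gt_eqF.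
pose s := (Num.sqrt (1 - v))^-1%R; pose m := (b / (1 - v))%R.
have s0 : (s != 0)%R by rewrite invr_eq0 gt_eqF// sqrtr_gt0.
have s2 : (s ^+ 2 = (1 - v)^-1)%R by rewrite exprVn sqr_sqrtr// ltW.
pose C := (expR (b ^+ 2 / (2 * (1 - v))) / Num.sqrt (1 - v))%R.
transitivity (\int[leb]_x (C%:E * (normal_pdf m s x)%:E)).
  apply: eq_integral => x _; rewrite -EFinM; congr EFin.
  have peak : normal_peak s = (Num.sqrt (1 - v) * (Num.sqrt (pi *+ 2))^-1)%R.
    rewrite /normal_peak s2 -mulrnAr sqrtrM ?invr_ge0 ?ltW// sqrtrV ?ltW//.
    by rewrite invfM invrK.
  rewrite /std_pdf !normal_pdfE ?oner_eq0// peak /normal_peak expr1n mul1r.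
  rewrite /C /normal_fun s2 expr1n subr0.
  set P := ((Num.sqrt (pi *+ 2))^-1)%R.
  have q0 : (Num.sqrt (1 - v) != 0)%R by rewrite gt_eqF// sqrtr_gt0.
  transitivity (P * expR (b * x + v * x ^+ 2 / 2 - x ^+ 2 / 2))%R.
    rewrite [in RHS]expRD mulrCA; congr (_ * (_ * expR _))%R.
    by rewrite mulr2n; field.
  rewrite (_ : _ - _ = b ^+ 2 / (2 * (1 - v)) +
     - (x - m) ^+ 2 / ((1 - v)^-1 *+ 2))%R; last by rewrite /m mulr2n; field.
  by rewrite expRD; field.
rewrite integralZl//; last exact: integrable_normal_pdf.
by rewrite integral_normal_pdf mule1.
Qed.

Lemma expR_sqr_gaussian (z : R) :
  (expR (z ^+ 2 / 2))%:E = \int[leb]_x (expR (z * x) * std_pdf x)%:E.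
Proof.
have := @gaussian_mgf z 0 ltr01; rewrite !subr0 sqrtr1 invr1 !mulr1 => <-.
by apply: eq_integral => x _; rewrite !mul0r addr0.
Qed.

Context {d : measure_display} {T : measurableType d} (Q : probability T R).

(* Linearizing each square by an auxiliary Gaussian variable reduces the moment
   of a sum of squares to the sub-Gaussian bound for linear forms. *)
Lemma integral_expR_sum_sqr_le h (Z : 'I_h -> T -> R) (b : 'I_h -> R) :
  (forall j, measurable_fun setT (Z j)) ->
  (forall a : 'I_h -> R, \int[Q]_x (expR (\sum_j a j * Z j x))%:E <=
     (expR (\sum_j (a j * b j + a j ^+ 2 / 2)))%:E) ->
  \int[Q]_x (expR (\sum_j Z j x ^+ 2 / 8))%:E <=
  (expR (\sum_j b j ^+ 2 / 6) / Num.sqrt (3 / 4) ^+ h)%:E.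
Proof.
move=> mZ Zb.
pose K : R := (Num.sqrt (3 / 4))^-1%R.
have K0 : (0 < K)%R by rewrite invr_gt0 sqrtr_gt0 divr_gt0.
(* The first k coordinates carry squares and the linear form [a] vanishes on them. Linearizing the
   square at coordinate k frees this coordinate for the linear form and reduces k + 1 to k; at k = 0
   only the hypothesis on linear forms remains. *)
suff H k : (k <= h)%N -> forall a : 'I_h -> R, (forall j : 'I_h, (j < k)%N -> a j = 0%R) ->
    \int[Q]_x (expR (\sum_j a j * Z j x + \sum_(j < h | (j < k)%N) Z j x ^+ 2 / 8))%:E <=
    (K ^+ k * expR (\sum_(j < h | (j < k)%N) b j ^+ 2 / 6 +
                    \sum_j (a j * b j + a j ^+ 2 / 2)))%:E.
  have := H h (leqnn h) (fun=> 0%R) (fun _ _ => erefl).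
  rewrite [X in (_ * expR (_ + X))%R]big1 ?addr0; last first.
    by move=> j _; rewrite mul0r expr0n mul0r addr0.
  rewrite (eq_bigl xpredT) /=; last by move=> j; rewrite ltn_ord.
  rewrite mulrC exprVn; apply: le_trans.
  rewrite le_eqVlt; apply/orP; left; apply/eqP; apply: eq_integral => x _.
  rewrite [X in (X + _)%R]big1 ?add0r; last by move=> j _; rewrite mul0r.
  by congr (expR _)%:E; apply: eq_bigl => j; rewrite ltn_ord.
elim: k => [_ a _|k IH kh a a0].
  rewrite big_pred0// add0r expr0 mul1r; apply: le_trans (Zb a).
  rewrite le_eqVlt; apply/orP; left; apply/eqP; apply: eq_integral => x _.
  by rewrite [X in (_ + X)%R]big_pred0// addr0.
pose i := Ordinal kh.
have ai : a i = 0%R by apply: a0; rewrite /= ltnSn.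
have split_i (F : 'I_h -> R) : (\sum_(j < h | (j < k.+1)%N) F j =
    F i + \sum_(j < h | (j < k)%N) F j)%R.
  rewrite (bigD1 i)//=; congr (_ + _)%R; apply: eq_bigl => j.
  rewrite ltnS leq_eqVlt; case: (eqVneq j i) => [->|ji]; first by rewrite /= eqxx ltnn.
  rewrite andbT; case: eqP => // jk.
  by move/eqP: ji; case; apply/val_inj.
(* exp(Z^2 / 8) is the mean of exp(x Z / 2) over a standard Gaussian x, hence the coefficient x /
   2. *)
pose a' (x : R) (j : 'I_h) := if j == i then (x / 2)%R else a j.
have a'0 x (j : 'I_h) : (j < k)%N -> a' x j = 0%R.
  move=> jk; rewrite /a'; case: eqP => [ji|_]; first by rewrite ji /= ltnn in jk.
  by apply: a0; rewrite ltnS ltnW.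
have sum_a' x (c : 'I_h -> R) : (\sum_j a' x j * c j = x / 2 * c i + \sum_j a j * c j)%R.
  rewrite (bigD1 i)//= [in RHS](bigD1 i)//= ai mul0r add0r /a' eqxx; congr (_ + _)%R.
  by apply: eq_bigr => j /negbTE ->.
pose L (w : T) := (\sum_j a j * Z j w + \sum_(j < h | (j < k)%N) Z j w ^+ 2 / 8)%R.
have mL : measurable_fun setT L.
  apply: measurable_funD.
    by apply: measurable_sum => j; exact: measurable_funM.
  rewrite (_ : (fun w => _) = (fun w => \sum_(j < h) if (j < k)%N then Z j w ^+ 2 / 8 else 0)%R).
    apply: measurable_sum => j; case: (j < k)%N; last exact: measurable_cst.
    by apply: measurable_funM => //; exact: measurable_funX.
  by apply/funext => w; rewrite big_mkcond.
pose F (p : T * R) := (expR (L p.1 + p.2 / 2 * Z i p.1) * std_pdf p.2)%:E.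
have mF : measurable_fun [set: T * R] F.
  apply/measurable_EFinP; apply: measurable_funM.
    apply: (measurableT_comp (@measurable_expR R)); apply: measurable_funD.
      exact: (measurableT_comp mL).
    apply: measurable_funM; first exact: measurable_funM.
    exact: (measurableT_comp (mZ i)).
  exact: (measurableT_comp measurable_std_pdf).
have F0 p : 0 <= F p by rewrite lee_fin mulr_ge0 ?expR_ge0 ?std_pdf_ge0.
rewrite [leLHS](_ : _ = \int[Q]_w \int[leb]_x F (w, x)); last first.
  apply: eq_integral => w _; rewrite split_i /F /=.
  under eq_integral do rewrite expRD -mulrA EFinM.
  rewrite ge0_integralZl//; last 2 first.
  - apply/measurable_EFinP; apply: measurable_funM; last exact: measurable_std_pdf.
    apply: (measurableT_comp (@measurable_expR R)); apply: measurable_funM => //.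
    exact: measurable_funM.
  - by move=> x _; rewrite lee_fin mulr_ge0 ?expR_ge0 ?std_pdf_ge0.
  rewrite (_ : \int[leb]_x _ = (expR ((Z i w / 2) ^+ 2 / 2))%:E); last first.
    rewrite expR_sqr_gaussian; apply: eq_integral => x _; congr (expR _ * _)%:E.
    by field.
  rewrite -EFinM -expRD; congr (expR _)%:E; rewrite /L; lra.
rewrite (@fubini_tonelli _ _ _ _ _ Q leb F mF F0).
set c := (\sum_(j < h | (j < k)%N) b j ^+ 2 / 6 + \sum_j (a j * b j + a j ^+ 2 / 2))%R.
(* Coordinate i contributes b_i x / 2 + (x / 2)^2 / 2, a Gaussian moment with v = 1/4: this is the
   origin of 1 / sqrt(3/4) and of b_i^2 / 6. *)
apply: (@le_trans _ _ (\int[leb]_x ((K ^+ k * expR c)%:E *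
    (expR (b i / 2 * x + 4^-1 * x ^+ 2 / 2) * std_pdf x)%:E))).
  apply: ge0_le_integral => //.
  - by move=> x _; apply: integral_ge0 => w _; exact: F0.
  - exact: measurable_fun_fubini_tonelli_G.
  - apply: emeasurable_funM; first exact: measurable_cst.
    apply/measurable_EFinP; apply: measurable_funM; last exact: measurable_std_pdf.
    apply: (measurableT_comp (@measurable_expR R)); apply: measurable_funD.
      exact: measurable_funM.
    by apply: measurable_funM => //; apply: measurable_funM => //; exact: measurable_funX.
  move=> x _.
  rewrite [leLHS](_ : _ = (\int[Q]_w (expR (\sum_j a' x j * Z j w +
    \sum_(j < h | (j < k)%N) Z j w ^+ 2 / 8))%:E) * (std_pdf x)%:E); last first.
    rewrite -ge0_integralZr//; last 2 first.
    - apply/measurable_EFinP; apply: (measurableT_comp (@measurable_expR R)).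
      under eq_fun do rewrite sum_a' -addrA.
      by apply: measurable_funD => //; exact: measurable_funM.
    - by rewrite lee_fin std_pdf_ge0.
    apply: eq_integral => w _; rewrite -EFinM /F /= sum_a' /L.
    by congr (expR _ * _)%:E; rewrite addrC addrA.
  have := IH (ltnW kh) (a' x) (a'0 x) => IHx.
  apply: (le_trans (lee_wpmul2r _ IHx)); first by rewrite lee_fin std_pdf_ge0.
  rewrite -!EFinM lee_fin -!mulrA.
  apply: ler_wpM2l; first by rewrite exprn_ge0// ltW.
  rewrite [leRHS]mulrA; apply: ler_wpM2r; first exact: std_pdf_ge0.
  rewrite -expRD ler_expR le_eqVlt; apply/orP; left; apply/eqP.
  rewrite /c -addrA; congr (_ + _)%R.
  rewrite (bigD1 i)//= [in RHS](bigD1 i)//= ai /a' eqxx.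
  rewrite (eq_bigr (fun j => a j * b j + a j ^+ 2 / 2))%R; last by move=> j /negbTE ->.
  rewrite mul0r expr0n /= mul0r !add0r addrC; congr (_ + _)%R; lra.
rewrite ge0_integralZl//; last 3 first.
- apply/measurable_EFinP; apply: measurable_funM; last exact: measurable_std_pdf.
  apply: (measurableT_comp (@measurable_expR R)); apply: measurable_funD.
    exact: measurable_funM.
  by apply: measurable_funM => //; apply: measurable_funM => //; exact: measurable_funX.
- by move=> x _; rewrite lee_fin mulr_ge0 ?expR_ge0 ?std_pdf_ge0.
- by rewrite lee_fin mulr_ge0 ?expR_ge0// exprn_ge0// ltW.
rewrite gaussian_mgf; last lra.
rewrite -EFinM lee_fin le_eqVlt; apply/orP; left; apply/eqP.
rewrite split_i -addrA -/c [in RHS]expRD [in RHS]exprS (_ : 1 - 4^-1 = 3 / 4)%R; last by field.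
rewrite (_ : (b i / 2) ^+ 2 / _ = b i ^+ 2 / 6)%R; last by field.
by rewrite -/K; ring.
Qed.

End gaussian_linearization.

(** * Sub-Gaussian moments over the l1 and l2 balls *)

Section subgaussian_linear_class.
Local Open Scope ereal_scope.
Context {d : measure_display} {T : measurableType d} {R : realType}.
Variables (mu : probability T R) (h n : nat) (xi : 'I_h -> T -> R) (Gamma tau : R).
Hypothesis xi_int : forall j, integrable_fun mu (xi j).
Hypothesis tau_gt0 : (0 < tau)%R.
Hypothesis tau_le : (tau <= Gamma)%R.
Let m j := expect mu (xi j).
Hypothesis mean_le : (\sum_j m j ^+ 2 <= Gamma ^+ 2)%R.
Hypothesis xi_subgaussian : forall a : 'I_h -> R,
  \int[mu]_x (expR (\sum_j a j * (xi j x - m j)))%:E <=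
  (expR ((\sum_j a j ^+ 2) * tau ^+ 2 / 2))%:E.

Let Gamma_gt0 : (0 < Gamma)%R. Proof. exact: lt_le_trans tau_le. Qed.

Let mxi j : measurable_fun setT (xi j).
Proof. exact: integrable_fun_measurable. Qed.

Let lin_mgf (a : 'I_h -> R) :
  \int[mu]_x (expR (\sum_j a j * xi j x))%:E <=
  (expR (\sum_j a j * m j + (\sum_j a j ^+ 2) * tau ^+ 2 / 2))%:E.
Proof.
rewrite expRD EFinM.
apply: le_trans (lee_wpmul2l _ (xi_subgaussian a)); last by rewrite lee_fin expR_ge0.
rewrite -ge0_integralZl//; last first.
  apply/measurable_EFinP; apply: (measurableT_comp (@measurable_expR R)).
  by apply: measurable_sum => j; apply: measurable_funM => //; apply: measurable_funB.
rewrite le_eqVlt; apply/orP; left; apply/eqP; apply: eq_integral => x _.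
rewrite -EFinM -expRD -big_split /=; congr (expR _)%:E.
by apply: eq_bigr => j _; ring.
Qed.

Lemma signed_linear_mgf (a : 'I_h -> R) (c : 'I_n -> R) :
  (forall i, c i ^+ 2 = 1)%R ->
  \int[iid mu n]_t (expR (\sum_j a j * (\sum_i c i * xi j (tnth t i))))%:E <=
  (expR ((\sum_j a j * m j) * (\sum_i c i) +
         n%:R * ((\sum_j a j ^+ 2) * tau ^+ 2 / 2)))%:E.
Proof.
move=> c1.
have := @integral_iid_expR_le _ _ _ mu n (fun i x => \sum_j (a j * c i) * xi j x)%R
  (fun i => (\sum_j a j * m j) * c i + (\sum_j a j ^+ 2) * tau ^+ 2 / 2)%R.
rewrite big_split /= -mulr_sumr sumr_const card_ord.
rewrite mulr_natl => H; apply: le_trans (H _ _).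
- rewrite le_eqVlt; apply/orP; left; apply/eqP; apply: eq_integral => t _.
  congr (expR _)%:E; rewrite exchange_big /=; apply: eq_bigr => j _.
  by rewrite mulr_sumr; apply: eq_bigr => i _; rewrite mulrA.
- by move=> i; apply: measurable_sum => j; exact: measurable_funM.
- move=> i; apply: le_trans (lin_mgf _) _; rewrite lee_fin ler_expR.
  rewrite le_eqVlt; apply/orP; left; apply/eqP; congr (_ + _ * _ / _)%R.
    by rewrite mulr_suml; apply: eq_bigr => j _; rewrite mulrAC.
  by apply: eq_bigr => j _; rewrite exprMn c1 mulr1.
Qed.

Lemma deviation_linear_mgf (a : 'I_h -> R) :
  \int[iid mu n]_t (expR (\sum_j a j * deviation mu (xi j) t))%:E <=
  (expR (n%:R * ((\sum_j a j ^+ 2) * tau ^+ 2 / 2)))%:E.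
Proof.
have := @integral_iid_expR_le _ _ _ mu n (fun i x => \sum_j a j * (xi j x - m j))%R
  (fun i => (\sum_j a j ^+ 2) * tau ^+ 2 / 2)%R.
rewrite sumr_const card_ord mulr_natl => H; apply: le_trans (H _ _).
- rewrite le_eqVlt; apply/orP; left; apply/eqP; apply: eq_integral => t _.
  congr (expR _)%:E; rewrite exchange_big /=; apply: eq_bigr => j _.
  by rewrite mulr_sumr.
- move=> i; apply: measurable_sum => j; apply: measurable_funM => //.
  exact: measurable_funB.
- by move=> i; exact: xi_subgaussian.
Qed.

(** The sum factors over coordinates as (exp y + exp(- y))^n. *)
Lemma sum_sign_expR (y : R) :
  (\sum_(e : {ffun 'I_n -> bool}) expR (y * \sum_i (-1) ^+ e i) <=
   2 ^+ n * expR (n%:R * (y ^+ 2 / 2)))%R.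
Proof.
have -> : (\sum_(e : {ffun 'I_n -> bool}) expR (y * \sum_i (-1) ^+ e i) =
    \sum_(e : {ffun 'I_n -> bool}) \prod_i expR (y * (-1) ^+ e i))%R.
  by apply: eq_bigr => e _; rewrite mulr_sumr expR_sum.
rewrite -(bigA_distr_bigA (fun _ (b : bool) => expR (y * (-1) ^+ b)))/=.
rewrite prodr_const card_ord big_bool /= expr1 expr0 mulr1 mulrN1 addrC.
rewrite expRM_natl -exprMn lerXn2r ?nnegrE ?addr_ge0 ?mulr_ge0 ?expR_ge0//.
exact: expR_cosh_le.
Qed.

Section scaled.
Variable lambda : R.
Hypothesis lambda_ge0 : (0 <= lambda)%R.
Hypothesis n_gt0 : (0 < n)%N.
(** This scaling gives n theta^2 Gamma^2 = lambda^2, so the exponents obtained below depend neither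
    on n nor on Gamma. *)
Let theta := (lambda / (Num.sqrt n%:R * Gamma))%R.

Let sn_gt0 : (0 < Num.sqrt (n%:R : R))%R. Proof. by rewrite sqrtr_gt0 ltr0n. Qed.

Let theta_ge0 : (0 <= theta)%R.
Proof. by rewrite divr_ge0// mulr_ge0// ltW. Qed.

Let ntheta2 : (n%:R * theta ^+ 2 * Gamma ^+ 2 = lambda ^+ 2)%R.
Proof.
have n0 : (n%:R != 0 :> R)%R by rewrite pnatr_eq0 -lt0n.
rewrite /theta expr_div_n exprMn sqr_sqrtr ?ler0n//.
by field; rewrite n0 gt_eqF.
Qed.

Let ntheta2tau : (n%:R * theta ^+ 2 * tau ^+ 2 <= lambda ^+ 2)%R.
Proof.
rewrite -ntheta2; apply: ler_wpM2l; first by rewrite mulr_ge0 ?ler0n ?sqr_ge0.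
by rewrite lerXn2r// nnegrE ltW.
Qed.

Definition l1_linear_class : set (T -> R) :=
  [set f | exists2 v : 'I_h -> R, (\sum_j `|v j| <= 1)%R & f = fun x => (\sum_j v j * xi j x)%R].

Lemma expR_max0_norm_le_sum (s : 'I_h -> R) : (0 < h)%N ->
  (expR (theta * max0 (fun j => `|s j|)) <=
   \sum_j (expR (theta * s j) + expR (- (theta * s j))))%R.
Proof.
move=> h0.
have single j : (expR (theta * `|s j|) <=
    \sum_j (expR (theta * s j) + expR (- (theta * s j))))%R.
  rewrite (bigD1 j)//=; apply: ler_wpDr.
    by apply: sumr_ge0 => k _; rewrite addr_ge0 ?expR_ge0.
  by rewrite -{1}(ger0_norm theta_ge0) -normrM expR_norm_le.
have [->|[j ->]] := max0_attained (fun j => `|s j|%R); last exact: single.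
apply: le_trans (single (Ordinal h0)).
by rewrite mulr0 expR0 -expR0 ler_expR mulr_ge0.
Qed.

Lemma linear_le_max0 (v s : 'I_h -> R) : (\sum_j `|v j| <= 1)%R ->
  (`|\sum_j v j * s j| <= max0 (fun j => `|s j|))%R.
Proof.
move=> v1; apply: norm_sum_hull => //; first exact: max0_ge0.
by move=> j; exact: (max0_ge (fun j => `|s j|%R)).
Qed.

(** The maximum is dominated by those of the 2 h signed coordinates. Deviations are centered, so
    only the variance proxy, and not the mean, enters the exponent. *)
Lemma l1_linear_class_deviation : (0 < h)%N ->
  deviation_mgf_bounded mu n theta l1_linear_class
    (ln (2 * h%:R) + lambda ^+ 2 / 2).
Proof.
move=> h0 K g Dg.
have iXi j (b : R) : integrable_fun mu (fun x => b * xi j x)%R by exact: integrable_funZ.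
have mdev j : measurable_fun [set: n.-tuple T] (deviation mu (xi j)).
  exact: measurable_deviation.
have mE (b : R) j : measurable_fun [set: n.-tuple T]
    (fun t => (expR (b * deviation mu (xi j) t))%:E).
  apply/measurable_EFinP; apply: (measurableT_comp (@measurable_expR R)).
  exact: measurable_funM.
have bound (b : R) j : (b ^+ 2 = theta ^+ 2)%R ->
    \int[iid mu n]_t (expR (b * deviation mu (xi j) t))%:E <= (expR (lambda ^+ 2 / 2))%:E.
  move=> b2; pose a k : R := if k == j then b else 0%R.
  have sa (F : 'I_h -> R) : (\sum_k a k * F k = b * F j)%R.
    rewrite (bigD1 j)//= /a eqxx big1 ?addr0// => k /negbTE ->.
    by rewrite mul0r.
  have := deviation_linear_mgf a; rewrite (_ : \sum_k a k ^+ 2 = theta ^+ 2)%R; last first.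
    by under eq_bigr do rewrite expr2; rewrite sa /a eqxx -expr2.
  rewrite [leLHS](_ : _ = \int[iid mu n]_t (expR (b * deviation mu (xi j) t))%:E); last first.
    by apply: eq_integral => t _; rewrite sa.
  move=> /le_trans; apply; rewrite lee_fin ler_expR.
  by rewrite [leLHS](_ : _ = n%:R * theta ^+ 2 * tau ^+ 2 / 2)%R ?ler_wpM2r ?invr_ge0//; field.
apply: (@le_trans _ _ (\int[iid mu n]_t (\sum_j ((expR (theta * deviation mu (xi j) t))%:E +
   (expR (- theta * deviation mu (xi j) t))%:E)))).
  apply: ge0_le_integral => //.
  - apply: measurable_max0_norm => k; apply: measurable_deviation.
    have [v _ ->] := Dg k; apply: measurable_sum => j.
    exact: measurable_funM.
  - by apply: emeasurable_sum => j; apply: emeasurable_funD; exact: mE.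
  move=> t _; under eq_bigr do rewrite -EFinD.
  rewrite sumEFin lee_fin; under eq_bigr do rewrite mulNr.
  apply: le_trans (expR_max0_norm_le_sum _ h0); rewrite ler_expR ler_wpM2l//.
  apply: max0_le => [|k]; first exact: max0_ge0.
  have [v v1 ->] := Dg k; rewrite deviation_sum//.
  under eq_bigr do rewrite deviationZ//.
  exact: linear_le_max0.
rewrite ge0_integral_sum//; last 2 first.
- by move=> j; apply: emeasurable_funD; exact: mE.
- by move=> j t _; rewrite adde_ge0// lee_fin expR_ge0.
rewrite expRD lnK ?posrE ?mulr_gt0 ?ltr0n//.
apply: (@le_trans _ _ (\sum_(j < h) (2 * expR (lambda ^+ 2 / 2))%:E)).
  apply: lee_sum => j _; rewrite ge0_integralD//.
  rewrite mulr2n mulrDl mul1r EFinD; apply: leeD; apply: bound => //.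
  by rewrite sqrrN.
rewrite sumEFin lee_fin sumr_const card_ord -[leLHS]mulr_natl.
by rewrite le_eqVlt; apply/orP; left; apply/eqP; ring.
Qed.

Definition l1_rademacher_bound (t : n.-tuple T) : R :=
  (\sum_(e : {ffun 'I_n -> bool}) \sum_j
    (expR (theta * signed_sum e (fun i => xi j (tnth t i))) +
     expR (- (theta * signed_sum e (fun i => xi j (tnth t i))))))%R.

Lemma l1_rademacher_le t : (0 < h)%N ->
  rademacher_le l1_linear_class (tnth t) theta (l1_rademacher_bound t).
Proof.
move=> h0 f Df; apply: ler_sum => e _.
apply: le_trans (expR_max0_norm_le_sum _ h0); rewrite ler_expR ler_wpM2l//.
have [v v1 ->] := Df e.
rewrite (_ : signed_sum _ _ = \sum_j v j * signed_sum e (fun i => xi j (tnth t i)))%R.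
  exact: linear_le_max0.
rewrite /signed_sum; under eq_bigr do rewrite mulr_sumr.
rewrite exchange_big /=; apply: eq_bigr => j _; rewrite mulr_sumr.
by apply: eq_bigr => i _; rewrite mulrCA.
Qed.

(** Signed sums are not centered: the mean of coordinate j contributes exp(s_j lambda^2 / 2) with
    s_j = m_j^2 / Gamma^2 and total at most 1. The chord of exp replaces this by 1 + s_j (y - 1), so
    the h coordinates together cost h + y - 1 instead of h y. *)
Lemma integral_l1_rademacher_bound (y := expR (lambda ^+ 2 / 2)) : (0 < h)%N ->
  \int[iid mu n]_t (l1_rademacher_bound t)%:E <=
  (2 ^+ n * expR (ln (2 * y * (y + h%:R - 1))))%:E.
Proof.
move=> h0.
have y1 : (1 <= y)%R by rewrite -expR0 ler_expR divr_ge0 ?sqr_ge0.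
have y0 : (0 < y)%R by exact: expR_gt0.
have h1 : (1 <= h%:R :> R)%R by rewrite ler1n.
rewrite lnK; last by rewrite posrE mulr_gt0 ?mulr_gt0//; lra.
have mE (e : {ffun 'I_n -> bool}) (b : R) j : measurable_fun [set: n.-tuple T]
    (fun t => (expR (b * signed_sum e (fun i => xi j (tnth t i))))%:E).
  apply/measurable_EFinP; apply: (measurableT_comp (@measurable_expR R)).
  apply: measurable_funM => //; apply: measurable_sum => i; apply: measurable_funM => //.
  by apply: (measurableT_comp (mxi j)); exact: measurable_tnth.
have bound (e : {ffun 'I_n -> bool}) (b : R) j : (b ^+ 2 = theta ^+ 2)%R ->
    \int[iid mu n]_t (expR (b * signed_sum e (fun i => xi j (tnth t i))))%:E <=
    (y * expR (b * m j * \sum_i (-1) ^+ e i))%:E.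
  move=> b2; pose a k : R := if k == j then b else 0%R.
  have sa (F : 'I_h -> R) : (\sum_k a k * F k = b * F j)%R.
    rewrite (bigD1 j)//= /a eqxx big1 ?addr0// => k /negbTE ->.
    by rewrite mul0r.
  have H := @signed_linear_mgf a (fun i => (-1) ^+ e i)%R (fun i => sqrr_sign _ _).
  rewrite (_ : \sum_k a k ^+ 2 = theta ^+ 2)%R in H; last first.
    by under eq_bigr do rewrite expr2; rewrite sa /a eqxx -expr2.
  apply: le_trans (le_trans _ H) _.
    by rewrite le_eqVlt; apply/orP; left; apply/eqP; apply: eq_integral => t _; rewrite sa.
  rewrite lee_fin sa addrC expRD ler_wpM2r ?expR_ge0// ler_expR.
  by rewrite [leLHS](_ : _ = n%:R * theta ^+ 2 * tau ^+ 2 / 2)%R ?ler_wpM2r ?invr_ge0//; field.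
have F0 (e : {ffun 'I_n -> bool}) (b : R) j t :
  0 <= (expR (b * signed_sum e (fun i => xi j (tnth t i))))%:E by rewrite lee_fin expR_ge0.
rewrite [leLHS](_ : _ = \sum_(e : {ffun 'I_n -> bool}) \sum_j
   (\int[iid mu n]_t (expR (theta * signed_sum e (fun i => xi j (tnth t i))))%:E +
    \int[iid mu n]_t (expR (- theta * signed_sum e (fun i => xi j (tnth t i))))%:E)); last first.
  transitivity (\int[iid mu n]_t (\sum_(e : {ffun 'I_n -> bool}) \sum_j
   ((expR (theta * signed_sum e (fun i => xi j (tnth t i))))%:E +
    (expR (- theta * signed_sum e (fun i => xi j (tnth t i))))%:E))).
    apply: eq_integral => t _; rewrite /l1_rademacher_bound -sumEFin.
    apply: eq_bigr => e _; rewrite -sumEFin; apply: eq_bigr => j _.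
    by rewrite EFinD mulNr.
  rewrite ge0_integral_sum//; last 2 first.
  - move=> e; apply: emeasurable_sum => j; apply: emeasurable_funD; exact: mE.
  - by move=> e t _; apply: sume_ge0 => j _; rewrite adde_ge0.
  apply: eq_bigr => e _; rewrite ge0_integral_sum//; last 2 first.
  - by move=> j; apply: emeasurable_funD; exact: mE.
  - by move=> j t _; rewrite adde_ge0.
  by apply: eq_bigr => j _; rewrite ge0_integralD.
apply: (@le_trans _ _ (\sum_(e : {ffun 'I_n -> bool}) \sum_j
   (y * (expR (theta * m j * \sum_i (-1) ^+ e i) +
         expR (- theta * m j * \sum_i (-1) ^+ e i)))%:E)).
  apply: lee_sum => e _; apply: lee_sum => j _.
  by rewrite mulrDr EFinD; apply: leeD; apply: bound => //; rewrite sqrrN.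
under eq_bigr do rewrite sumEFin.
rewrite sumEFin lee_fin exchange_big /=.
pose s j := (m j ^+ 2 / Gamma ^+ 2)%R.
have G2 : (0 < Gamma ^+ 2)%R by rewrite exprn_gt0.
have s0 j : (0 <= s j)%R by rewrite divr_ge0 ?sqr_ge0// ltW.
have s_sum : (\sum_j s j <= 1)%R by rewrite -mulr_suml ler_pdivrMr// mul1r.
have s1 j : (s j <= 1)%R.
  by apply: le_trans s_sum; rewrite (bigD1 j)//= lerDl sumr_ge0.
apply: (@le_trans _ _ (\sum_j (2 ^+ n * (2 * y) * (1 + s j * (y - 1)))))%R.
  apply: ler_sum => j _; rewrite -mulr_sumr big_split /=.
  have := sum_sign_expR (theta * m j); have := sum_sign_expR (- theta * m j).
  have -> : (n%:R * ((- theta * m j) ^+ 2 / 2) = s j * (lambda ^+ 2 / 2))%R.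
    by rewrite -ntheta2 /s; field; rewrite gt_eqF.
  have -> : (n%:R * ((theta * m j) ^+ 2 / 2) = s j * (lambda ^+ 2 / 2))%R.
    by rewrite -ntheta2 /s; field; rewrite gt_eqF.
  move=> h2 h3.
  have h4 : (expR (s j * (lambda ^+ 2 / 2)) <= 1 + s j * (y - 1))%R.
    by apply: expR_chord; rewrite s0 s1.
  have p0 : (0 <= 2 ^+ n :> R)%R by rewrite exprn_ge0.
  have h5 := ler_wpM2l p0 h4.
  rewrite (_ : 2 ^+ n * (2 * y) * (1 + s j * (y - 1)) =
     y * (2 ^+ n * (1 + s j * (y - 1)) + 2 ^+ n * (1 + s j * (y - 1))))%R; last by ring.
  by rewrite ler_wpM2l ?(ltW y0)//; lra.
rewrite -mulr_sumr -mulrA ler_wpM2l ?exprn_ge0// ler_wpM2l ?mulr_ge0 ?(ltW y0)//.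
rewrite big_split /= sumr_const card_ord -mulr_suml.
have : ((\sum_j s j) * (y - 1) <= 1 * (y - 1))%R by rewrite ler_wpM2r// subr_ge0.
lra.
Qed.

Definition l2_linear_class : set (T -> R) :=
  [set f | exists2 v : 'I_h -> R, (\sum_j v j ^+ 2 <= 1)%R & f = fun x => (\sum_j v j * xi j x)%R].

(** Cauchy-Schwarz, by expanding the nonnegative sum of (s_j - u v_j)^2 where u is the inner
    product. *)
Lemma sqr_linear_le (v s : 'I_h -> R) : (\sum_j v j ^+ 2 <= 1)%R ->
  ((\sum_j v j * s j) ^+ 2 <= \sum_j s j ^+ 2)%R.
Proof.
move=> v1.
have expand w : (\sum_j (s j - w * v j) ^+ 2 =
    \sum_j s j ^+ 2 - 2 * w * (\sum_j v j * s j) + w ^+ 2 * \sum_j v j ^+ 2)%R.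
  by rewrite !mulr_sumr -sumrB -big_split /=; apply: eq_bigr => j _; ring.
set u := (\sum_j v j * s j)%R.
have : (0 <= \sum_j (s j - u * v j) ^+ 2)%R by apply: sumr_ge0 => j _; exact: sqr_ge0.
have := ler_wpM2l (sqr_ge0 u) v1.
rewrite expand -/u mulr1 expr2; lra.
Qed.

(** Comes from lambda |w| <= 2 lambda^2 + w^2 / 8 followed by Cauchy-Schwarz; the coefficient 1/8 is
    the one treated by [integral_expR_sum_sqr_le]. *)
Definition l2_rademacher_bound (t : n.-tuple T) : R :=
  (\sum_(e : {ffun 'I_n -> bool}) expR (2 * lambda ^+ 2 +
    \sum_j (signed_sum e (fun i => xi j (tnth t i)) / (Num.sqrt n%:R * Gamma)) ^+ 2 / 8))%R.

Lemma l2_rademacher_le t :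
  rademacher_le l2_linear_class (tnth t) theta (l2_rademacher_bound t).
Proof.
move=> f Df; apply: ler_sum => e _; rewrite ler_expR.
have [v v1 ->] := Df e.
set s := (Num.sqrt n%:R * Gamma)%R; have s0 : (0 < s)%R by rewrite mulr_gt0.
pose z j := (signed_sum e (fun i => xi j (tnth t i)) / s)%R.
have -> : (theta * `|signed_sum e (fun i => \sum_j v j * xi j (tnth t i))| =
    lambda * `|\sum_j v j * z j|)%R.
  have -> : signed_sum e (fun i => \sum_j v j * xi j (tnth t i))%R = (s * \sum_j v j * z j)%R.
    rewrite /signed_sum /z mulr_sumr; under eq_bigr do rewrite mulr_sumr.
    rewrite exchange_big /=; apply: eq_bigr => j _.
    rewrite [RHS](_ : _ = v j * \sum_i (-1) ^+ e i * xi j (tnth t i))%R; last first.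
      by rewrite /signed_sum; field; rewrite gt_eqF.
    by rewrite mulr_sumr; apply: eq_bigr => i _; rewrite mulrCA.
  by rewrite normrM (gtr0_norm s0) /theta -/s mulrA divfK// gt_eqF.
have := sqr_linear_le z v1; rewrite -mulr_suml -/z.
set w := (\sum_j v j * z j)%R; rewrite -(real_normK (num_real w)) => hz.
have := sqr_ge0 (4 * lambda - `|w|); rewrite -/s.
have -> : ((4 * lambda - `|w|) ^+ 2 = 16 * lambda ^+ 2 - 8 * (lambda * `|w|) + `|w| ^+ 2)%R.
  by ring.
lra.
Qed.

Lemma sum_sign_expR_sqr :
  (\sum_(e : {ffun 'I_n -> bool}) expR ((\sum_i (-1) ^+ e i) ^+ 2 / (6 * n%:R)) <=
   2 ^+ n / Num.sqrt (2 / 3) :> R)%R.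
Proof.
have n0 : (0 < n%:R :> R)%R by rewrite ltr0n.
(* With r^2 = 3 n the exponent is (S / r)^2 / 2 for the sum S of the signs, which a Gaussian x
   linearizes. Summing over signs leaves exp(x^2 / 6), that is v = 1/3 in [gaussian_mgf], whence 1 /
   sqrt(2/3). *)
pose r : R := Num.sqrt (3 * n%:R); have r0 : (0 < r)%R by rewrite sqrtr_gt0 mulr_gt0.
have r2 : (r ^+ 2 = 3 * n%:R)%R by rewrite sqr_sqrtr// mulr_ge0// ltW.
pose F (e : {ffun 'I_n -> bool}) (x : R) :=
  (expR ((\sum_i (-1) ^+ e i) / r * x) * std_pdf x)%:E.
have mF e : measurable_fun setT (F e).
  apply/measurable_EFinP; apply: measurable_funM; last exact: measurable_std_pdf.
  by apply: (measurableT_comp (@measurable_expR R)); exact: measurable_funM.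
have F0 e x : 0 <= F e x by rewrite lee_fin mulr_ge0 ?expR_ge0 ?std_pdf_ge0.
rewrite -lee_fin -sumEFin.
rewrite (eq_bigr (fun e => \int[@lebesgue_measure R]_x F e x)); last first.
  move=> e _; rewrite /F -expR_sqr_gaussian; congr (expR _)%:E.
  by rewrite expr_div_n r2; field; rewrite gt_eqF.
rewrite -ge0_integral_sum//.
apply: (@le_trans _ _ (\int[@lebesgue_measure R]_x ((2 ^+ n)%:E *
   (expR (0 * x + 3^-1 * x ^+ 2 / 2) * std_pdf x)%:E))).
  apply: ge0_le_integral => //.
  - by move=> x _; apply: sume_ge0 => e _; exact: F0.
  - by apply: emeasurable_sum => e; exact: mF.
  - apply: emeasurable_funM; first exact: measurable_cst.
    apply/measurable_EFinP; apply: measurable_funM; last exact: measurable_std_pdf.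
    apply: (measurableT_comp (@measurable_expR R)); apply: measurable_funD.
      exact: measurable_funM.
    by apply: measurable_funM => //; apply: measurable_funM => //; exact: measurable_funX.
  move=> x _; rewrite /F sumEFin -EFinM lee_fin -mulr_suml mulrA.
  rewrite ler_wpM2r ?std_pdf_ge0//.
  have := sum_sign_expR (x / r).
  rewrite (_ : n%:R * ((x / r) ^+ 2 / 2) = 0 * x + 3^-1 * x ^+ 2 / 2)%R; last first.
    by rewrite expr_div_n r2; field; rewrite gt_eqF.
  apply: le_trans; apply: ler_sum => e _; rewrite ler_expR.
  by rewrite [leLHS](_ : _ = x / r * \sum_i (-1) ^+ e i)%R//; ring.
rewrite ge0_integralZl//; last 2 first.
- apply/measurable_EFinP; apply: measurable_funM; last exact: measurable_std_pdf.
  apply: (measurableT_comp (@measurable_expR R)); apply: measurable_funD.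
    exact: measurable_funM.
  by apply: measurable_funM => //; apply: measurable_funM => //; exact: measurable_funX.
- by move=> x _; rewrite lee_fin mulr_ge0 ?expR_ge0 ?std_pdf_ge0.
rewrite gaussian_mgf; last lra.
rewrite -EFinM lee_fin (_ : 1 - 3^-1 = 2 / 3)%R; last by field.
by rewrite expr0n mul0r expR0 div1r.
Qed.

(** For fixed signs the h squares cost (4/3)^(h/2), and the means leave exp(S^2 / (6 n)), where S is
    the sum of the signs, because the squared means add up to at most Gamma^2. Averaging over signs
    adds (3/2)^(1/2). *)
Lemma integral_l2_rademacher_bound :
  \int[iid mu n]_t (l2_rademacher_bound t)%:E <=
  (2 ^+ n * expR (2 * lambda ^+ 2 + (h%:R * ln (4 / 3) + ln (3 / 2)) / 2))%:E.
Proof.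
have n0 : (0 < n%:R :> R)%R by rewrite ltr0n.
set s := (Num.sqrt n%:R * Gamma)%R; have s0 : (0 < s)%R by rewrite mulr_gt0.
have s2 : (s ^+ 2 = n%:R * Gamma ^+ 2)%R by rewrite exprMn sqr_sqrtr ?ler0n.
pose Z (e : {ffun 'I_n -> bool}) j (t : n.-tuple T) : R :=
  (signed_sum e (fun i => xi j (tnth t i)) / s)%R.
have mZ e j : measurable_fun [set: n.-tuple T] (Z e j).
  apply: measurable_funM => //; apply: measurable_sum => i; apply: measurable_funM => //.
  by apply: (measurableT_comp (mxi j)); exact: measurable_tnth.
have mEZ e : measurable_fun [set: n.-tuple T] (fun t => (expR (\sum_j Z e j t ^+ 2 / 8))%:E).
  apply/measurable_EFinP; apply: (measurableT_comp (@measurable_expR R)).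
  by apply: measurable_sum => j; apply: measurable_funM => //; exact: measurable_funX.
have bound (e : {ffun 'I_n -> bool}) :
    \int[iid mu n]_t (expR (\sum_j Z e j t ^+ 2 / 8))%:E <=
    (expR ((\sum_i (-1) ^+ e i) ^+ 2 / (6 * n%:R)) / Num.sqrt (3 / 4) ^+ h)%:E.
  pose b j := (m j * (\sum_i (-1) ^+ e i) / s)%R.
  apply: (@le_trans _ _ (expR (\sum_j b j ^+ 2 / 6) / Num.sqrt (3 / 4) ^+ h)%:E).
    apply: (integral_expR_sum_sqr_le (mZ e)) => a.
    have H := @signed_linear_mgf (fun j => a j / s)%R (fun i => (-1) ^+ e i)%R
      (fun i => sqrr_sign _ _).
    apply: le_trans (le_trans _ H) _.
      rewrite le_eqVlt; apply/orP; left; apply/eqP; apply: eq_integral => t _.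
      by congr (expR _)%:E; apply: eq_bigr => j _; rewrite /Z /signed_sum; ring.
    rewrite lee_fin ler_expR big_split /=; apply: lerD.
      rewrite mulr_suml le_eqVlt; apply/orP; left; apply/eqP.
      by apply: eq_bigr => j _; rewrite /b; ring.
    rewrite -mulr_suml (_ : \sum_j (a j / s) ^+ 2 = (\sum_j a j ^+ 2) / s ^+ 2)%R; last first.
      by rewrite mulr_suml; apply: eq_bigr => j _; rewrite expr_div_n.
    rewrite s2.
    have A0 : (0 <= \sum_j a j ^+ 2)%R by apply: sumr_ge0 => j _; exact: sqr_ge0.
    rewrite [leLHS](_ : _ = (\sum_j a j ^+ 2) / 2 * (tau ^+ 2 / Gamma ^+ 2))%R; last first.
      by field; rewrite !gt_eqF.
    rewrite ler_piMr ?divr_ge0// ler_pdivrMr ?exprn_gt0// mul1r.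
    by rewrite lerXn2r// nnegrE ltW.
  rewrite lee_fin ler_wpM2r ?invr_ge0 ?exprn_ge0 ?sqrtr_ge0// ler_expR.
  rewrite -mulr_suml (_ : \sum_j b j ^+ 2 = (\sum_j m j ^+ 2) * ((\sum_i (-1) ^+ e i) / s) ^+ 2)%R.
    rewrite expr_div_n s2 [leRHS](_ : _ = Gamma ^+ 2 *
       ((\sum_i (-1) ^+ e i) ^+ 2 / (n%:R * Gamma ^+ 2)) / 6)%R; last first.
      by field; rewrite !gt_eqF.
    rewrite ler_wpM2r ?invr_ge0// ler_wpM2r// divr_ge0 ?sqr_ge0//.
    by rewrite mulr_ge0 ?sqr_ge0// ltW.
  by rewrite mulr_suml; apply: eq_bigr => j _; rewrite /b -exprMn mulrA.
rewrite [leLHS](_ : _ = \sum_(e : {ffun 'I_n -> bool}) ((expR (2 * lambda ^+ 2))%:E *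
   \int[iid mu n]_t (expR (\sum_j Z e j t ^+ 2 / 8))%:E)); last first.
  transitivity (\int[iid mu n]_t (\sum_(e : {ffun 'I_n -> bool})
     ((expR (2 * lambda ^+ 2))%:E * (expR (\sum_j Z e j t ^+ 2 / 8))%:E))).
    apply: eq_integral => t _; rewrite /l2_rademacher_bound -sumEFin.
    by apply: eq_bigr => e _; rewrite expRD EFinM.
  rewrite ge0_integral_sum//; last first.
    by move=> e; apply: emeasurable_funM; [exact: measurable_cst|exact: mEZ].
  by apply: eq_bigr => e _; rewrite ge0_integralZl.
apply: (@le_trans _ _ (\sum_(e : {ffun 'I_n -> bool}) (expR (2 * lambda ^+ 2) *
   (expR ((\sum_i (-1) ^+ e i) ^+ 2 / (6 * n%:R)) / Num.sqrt (3 / 4) ^+ h))%:E)).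
  by apply: lee_sum => e _; rewrite EFinM; apply: lee_wpmul2l (bound e); rewrite lee_fin expR_ge0.
rewrite sumEFin lee_fin -mulr_sumr -mulr_suml.
have sq (x : R) : (0 < x -> expR (ln x / 2) = Num.sqrt x)%R.
  move=> x0; apply/eqP; rewrite -(@eqrXn2 _ 2) ?sqrtr_ge0 ?expR_ge0// sqr_sqrtr ?ltW//.
  by rewrite expr2 -expRD -splitr lnK.
have -> : (expR (2 * lambda ^+ 2 + (h%:R * ln (4 / 3) + ln (3 / 2)) / 2) =
    expR (2 * lambda ^+ 2) * (Num.sqrt (4 / 3) ^+ h * Num.sqrt (3 / 2)))%R.
  rewrite (_ : (h%:R * ln (4 / 3) + ln (3 / 2)) / 2 =
    h%:R * (ln (4 / 3) / 2) + ln (3 / 2) / 2)%R; last by field.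
  by rewrite !expRD (expRM_natl h) !sq.
have -> : Num.sqrt (4 / 3) = (Num.sqrt (3 / 4))^-1%R :> R.
  by rewrite -sqrtrV; [congr Num.sqrt; field|lra].
have -> : Num.sqrt (3 / 2) = (Num.sqrt (2 / 3))^-1%R :> R.
  by rewrite -sqrtrV; [congr Num.sqrt; field|lra].
rewrite [leRHS]mulrCA ler_pM2l ?expR_gt0// exprVn [leRHS]mulrCA [leLHS]mulrC.
by rewrite ler_wpM2l ?invr_ge0 ?exprn_ge0 ?sqrtr_ge0// sum_sign_expR_sqr.
Qed.

End scaled.
End subgaussian_linear_class.

(** * Choice of the exponent *)

Section chernoff_exponents.
Context {R : realType}.
Implicit Types (h d : nat) (L lambda u : R).

Let l : R := ln 2.

Lemma ln2_gt0 : 0 < l.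
Proof. by rewrite ln_gt0// ltr1n. Qed.

Lemma ln_le_mul_ln2 (x : R) p : 0 < x -> x <= 2 ^+ p -> ln x <= p%:R * l.
Proof.
move=> x0 xp; rewrite mulr_natl -lnXn//.
by rewrite ler_ln ?posrE ?exprn_gt0.
Qed.

Lemma ln_le_of_expR (x y : R) : 0 < x -> x <= expR y -> ln x <= y.
Proof. by move=> x0 xy; rewrite -[leRHS]expRK ler_ln ?posrE ?expR_gt0. Qed.

Lemma l2_exponent d h L : (2 <= d)%N -> (2 <= h)%N -> 0 <= L ->
  exists2 lambda, 0 <= lambda &
    d%:R * ln 2 + 2 * (2 * lambda ^+ 2 + (h%:R * ln (4 / 3) + ln (3 / 2)) / 2)
    - 2 * lambda * (Num.sqrt (6 * d%:R * ln 2 + 5 * h%:R / 4) +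
                    Num.sqrt (2 * h%:R * L)) <= - L.
Proof.
move=> d2 h2 L0; rewrite -/l.
have l0 := ln2_gt0.
have dr : 2 <= d%:R :> R by rewrite (ler_nat R 2).
have hr : 2 <= h%:R :> R by rewrite (ler_nat R 2).
set A := Num.sqrt (6 * _ * _ + _); set B := Num.sqrt _.
have dl : 2 * l <= d%:R * l by rewrite ler_pM2r.
have hL : 2 * L <= h%:R * L by rewrite ler_wpM2r.
have A2 : A ^+ 2 = 6 * (d%:R * l) + 5 * h%:R / 4 by rewrite sqr_sqrtr ?mulrA//; lra.
have B2 : B ^+ 2 = 2 * (h%:R * L) by rewrite sqr_sqrtr ?mulrA//; lra.
have A0 : 0 <= A by exact: sqrtr_ge0.
have B0 : 0 <= B by exact: sqrtr_ge0.
(* The minimizer of 4 lambda^2 - 2 lambda (A + B). The minimum - (A + B)^2 / 4 supplies h L / 2,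
   which covers L because h >= 2, and 5 h / 16, which covers h ln(4/3). *)
exists ((A + B) / 4); first lra.
have l43 : ln (4 / 3) <= 5 / 16 :> R.
  apply: ln_le_of_expR; first lra.
  have := expR_ge1Dxn 1 (_ : 0 <= 5 / 16 :> R).
  (* Squaring the tangent bound at 5/32 gives (37/32)^2 > 4/3, whereas the tangent bound at 5/16 is
     only 21/16. *)
  have <- : expR (5 / 32 + 5 / 32) = expR (5 / 16) :> R by congr expR; lra.
  rewrite expRD; have := expR_ge1Dx (5 / 32 : R); set z := expR _; nra.
have l32 : ln (3 / 2) <= l by rewrite ler_ln ?posrE; lra.
have h43 : h%:R * ln (4 / 3) <= h%:R * (5 / 16) :> R by rewrite ler_wpM2l.
have AB : 0 <= A * B by rewrite mulr_ge0.
rewrite [leLHS](_ : _ = d%:R * l + h%:R * ln (4 / 3) + ln (3 / 2) -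
  (A ^+ 2 + 2 * (A * B) + B ^+ 2) / 4); last by field.
rewrite A2 B2; lra.
Qed.

(** The gain h L / 2 of [l2_exponent] is too small for h = 1. The l1 moment bound has quadratic part
    2 lambda^2 instead of 4 lambda^2, and its minimum - (A + B)^2 / 2 contains the full L. *)
Lemma l2_exponent_dim1 d L : (2 <= d)%N -> 0 <= L ->
  exists2 lambda, 0 <= lambda &
    d%:R * ln 2 + 2 * ln (2 * expR (lambda ^+ 2 / 2) * (expR (lambda ^+ 2 / 2) + 1 - 1))
    - 2 * lambda * (Num.sqrt (6 * d%:R * ln 2 + 5 * 1 / 4) +
                    Num.sqrt (2 * 1 * L)) <= - L.
Proof.
move=> d2 L0; rewrite -/l.
have l0 := ln2_gt0.
have dr : 2 <= d%:R :> R by rewrite (ler_nat R 2).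
set A := Num.sqrt (6 * _ * _ + _); set B := Num.sqrt _.
have dl : 2 * l <= d%:R * l by rewrite ler_pM2r.
have A2 : A ^+ 2 = 6 * (d%:R * l) + 5 / 4 by rewrite sqr_sqrtr ?mulrA//; lra.
have B2 : B ^+ 2 = 2 * L by rewrite sqr_sqrtr ?mulr1//; lra.
have A0 : 0 <= A by exact: sqrtr_ge0.
have B0 : 0 <= B by exact: sqrtr_ge0.
exists ((A + B) / 2); first lra.
have AB : 0 <= A * B by rewrite mulr_ge0.
rewrite addrK -mulrA -expRD lnM ?posrE ?expR_gt0// expRK -/l.
rewrite [leLHS](_ : _ = d%:R * l + 2 * l -
  (A ^+ 2 + 2 * (A * B) + B ^+ 2) / 2); last by field.
rewrite A2 B2; lra.
Qed.

Section l1.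
Variables (d h : nat).
Hypotheses (d2 : (2 <= d)%N) (h1 : (1 <= h)%N).

Let eta : R := ln h%:R.
Let D : R := d%:R * l + eta.

Let h1r : 1 <= h%:R :> R. Proof. by rewrite ler1n. Qed.
Let eta0 : 0 <= eta. Proof. exact: ln_ge0. Qed.
Let expR_eta : expR eta = h%:R. Proof. by rewrite lnK// posrE (lt_le_trans ltr01). Qed.
Let d2r : 2 <= d%:R :> R. Proof. by rewrite (ler_nat R 2). Qed.

Let D0 : 0 < D.
Proof.
have : 0 < d%:R * l by rewrite mulr_gt0 ?ln2_gt0 ?(lt_le_trans _ d2r).
by have := eta0; rewrite /D; lra.
Qed.

(** The exponent of [l1_exponent] with u = lambda^2 / 2, w = ln(exp u + h - 1) and q = 2^-(d - 1);
    the multiples of ln 2 in it collapse to d ln 2. *)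
Definition l1_exponent_at (q u w : R) : R :=
  d%:R * l + 2 * (u + w) + q * (eta - u - 2 * w).

Let width_exp u : R := ln (expR u + h%:R - 1).

Let width_gt0 u : 0 < expR u + h%:R - 1.
Proof. by have := expR_gt0 u; have := h1r; lra. Qed.

Let width_exp_ge u : 0 <= u -> eta <= width_exp u.
Proof.
move=> u0; rewrite ler_ln ?posrE ?width_gt0 ?(lt_le_trans ltr01)//.
by have := expR_ge1Dx u; lra.
Qed.

Let width_exp_le u c : expR u + h%:R - 1 <= c -> width_exp u <= ln c.
Proof. by move=> uc; rewrite ler_ln ?posrE ?width_gt0 ?(lt_le_trans (width_gt0 u)). Qed.

Let exponent_at_le (q u : R) : 0 <= q -> 0 <= u ->
  l1_exponent_at q u (width_exp u) <= d%:R * l + 2 * (u + width_exp u).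
Proof.
move=> q0 u0; have hw := width_exp_ge u0; have e0 := eta0.
have : 0 <= q * (2 * width_exp u + u - eta) by rewrite mulr_ge0//; lra.
rewrite /l1_exponent_at; lra.
Qed.

(** Write exp(s D) = c exp(s eta) with c = 2^(d s) and bound the last factor by the chord 1 + s (h -
    1). What remains is c (1 - s) >= 1, which follows from c >= 14/5 and 1 - s >= 7/16. *)
Let width_exp_scaled (s : R) : 0 <= s <= 9 / 16 -> 3 / 2 <= d%:R * s ->
  width_exp (s * D) <= d%:R * s * l + eta.
Proof.
move=> /andP[s0 s1] ds.
have l0 := ln2_gt0.
set c := expR (d%:R * s * l).
have c28 : 14 / 5 <= c.
  apply: (@le_trans _ _ (expR (3 / 2 * l))); last by rewrite ler_expR ler_wpM2r// ltW.
  rewrite -(@ler_pXn2r _ 2%N) ?nnegrE ?expR_ge0 ?divr_ge0//.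
  rewrite -expRM_natl (_ : 2 * (3 / 2 * l) = 3%:R * l); last by field.
  rewrite expRM_natl lnK ?posrE//; lra.
rewrite -[leRHS]expRK; apply: width_exp_le.
rewrite expRD expR_eta -/c mulrDr expRD.
rewrite (_ : s * (d%:R * l) = d%:R * s * l); last by ring.
have hs : expR (s * eta) <= 1 + s * (h%:R - 1) by rewrite -expR_eta; apply: expR_chord; lra.
have c0 : 0 <= c by lra.
have := ler_wpM2l c0 hs; rewrite -/c.
have : 0 <= (h%:R - 1) * (c * (1 - s) - 1) by rewrite mulr_ge0 ?subr_ge0//; nra.
lra.

Qed.

(* When [B <= A / 2] it is enough to take [lambda = x A] and to treat [L = 0].
   The term in [q] matters only for d <= 4; for d >= 5, [x = 1 / 2] works as
   long as h <= 2^(d-2), and beyond that [x] is chosen so that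
   [expR (lambda ^+ 2 / 2) = h]. *)
Let small_exponent (q : R) : q = 2^-1 ^+ d.-1 ->
  exists2 x : R, 8^-1 <= x & l1_exponent_at q (x ^+ 2 * D) (width_exp (x ^+ 2 * D)) <= 4 * x * D.
Proof.
move=> qE; have l0 := ln2_gt0; have e0 := eta0; have D00 := D0.
have h1' := h1r; have h0 : 0 < h%:R :> R by lra.
have q0 : 0 <= q by rewrite qE exprn_ge0.
have [dE|d3] := eqVneq d 2%N.
  exists 1; first lra.
  (* Here exp(D) = 4 h, and 4 h + h - 1 <= 5 h. *)
  have w5 : width_exp (1 ^+ 2 * D) <= ln 5 + eta.
    rewrite -lnM ?posrE//; apply: width_exp_le.
    rewrite expr1n mul1r /D dE expRD expR_eta expRM_natl lnK ?posrE//; lra.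
  have l5 : ln 5 <= 3%:R * l by apply: ln_le_mul_ln2; lra.
  rewrite /l1_exponent_at qE /D; move: w5; set w := width_exp _.
  rewrite !dE /=; lra.
have [dE|d4] := eqVneq d 3%N.
  exists (3 / 4); first lra.
  have : width_exp ((3 / 4) ^+ 2 * D) <= d%:R * (3 / 4) ^+ 2 * l + eta.
    by apply: width_exp_scaled; rewrite ?dE; lra.
  rewrite /l1_exponent_at qE; set w := width_exp _.
  by rewrite /D !dE /=; lra.
have [dE|d5] := eqVneq d 4%N.
  exists (7 / 10); first lra.
  have : width_exp ((7 / 10) ^+ 2 * D) <= d%:R * (7 / 10) ^+ 2 * l + eta.
    by apply: width_exp_scaled; rewrite ?dE; lra.
  rewrite /l1_exponent_at qE; set w := width_exp _.
  by rewrite /D !dE /=; lra.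
have {d3 d4 d5} d5 : 5 <= d%:R :> R by rewrite (ler_nat R 5); lia.
have [hd|hd] := leP eta ((d%:R - 2) * l).
  exists 2^-1; first lra.
  apply: le_trans (exponent_at_le q0 _) _; first by rewrite mulr_ge0// ltW.
  rewrite (_ : 2^-1 ^+ 2 * D = D / 4); last by field.
  suff : width_exp (D / 4) <= D / 4 + eta / 2 by rewrite /D; lra.
  rewrite -[leRHS]expRK; apply: width_exp_le; rewrite expRD.
  set r := expR (eta / 2); set y := expR (D / 4).
  have r2 : h%:R = r ^+ 2 by rewrite expr2 -expRD -splitr expR_eta.
  have r1 : 1 <= r by rewrite -expR0 ler_expR; lra.
  have y0 : 0 <= y by exact: expR_ge0.
  set w := expR ((d%:R / 2 - 1) * l).
  have y2 : y ^+ 2 = 2 * w * r.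
    rewrite -[2 in RHS]lnK ?posrE// -/l -!expRD -expRM_natl.
    by congr expR; rewrite /D; field.
  have rw : r <= w by rewrite ler_expR; lra.
  have w28 : 14 / 5 <= w.
    apply: (@le_trans _ _ (expR (3 / 2 * l))); last by rewrite ler_expR ler_wpM2r//; lra.
    rewrite -(@ler_pXn2r _ 2%N) ?nnegrE ?expR_ge0 ?divr_ge0//.
    rewrite -expRM_natl (_ : 2 * (3 / 2 * l) = 3%:R * l); last by field.
    by rewrite expRM_natl lnK ?posrE//; lra.
  (* The goal y + r^2 - 1 <= y r is (r - 1) (y - (r + 1)) >= 0. *)
  have ry : r + 1 <= y.
    have r10 : 0 <= r + 1 by lra.
    rewrite -(@ler_pXn2r _ 2%N) ?nnegrE// y2.
    have h2 : 0 <= (r - 1) * (w - r) by rewrite mulr_ge0// subr_ge0.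
    have [w3|w3] := leP 3 w; first by nra.
    have : r * (3 - w) <= w * (3 - w) by rewrite ler_wpM2r//; lra.
    nra.
  rewrite r2.
  have : 0 <= (r - 1) * (y - (r + 1)) by rewrite mulr_ge0// subr_ge0.
  lra.
pose x := Num.sqrt (eta / D).
have x2 : x ^+ 2 = eta / D by rewrite sqr_sqrtr// divr_ge0// ltW.
have x0 : 0 <= x by exact: sqrtr_ge0.
have x2D : x ^+ 2 * D = eta by rewrite x2 divfK// gt_eqF.
exists x.
  rewrite -(@ler_pXn2r _ 2%N) ?nnegrE ?invr_ge0//.
  rewrite x2 ler_pdivlMr// /D; nra.
apply: le_trans (exponent_at_le q0 _) _; first by rewrite x2D.
rewrite x2D.
have : width_exp eta <= l + eta.
  rewrite -lnM ?posrE//; apply: width_exp_le; rewrite expR_eta; lra.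
suff : (d%:R + 2) * l + 4 * eta <= 4 * x * D by lra.
have s1 : 0 <= (d%:R + 2) * l + 4 * eta by rewrite addr_ge0 ?mulr_ge0 ?addr_ge0 ?(ltW l0).
have s2 : 0 <= 4 * x * D by rewrite !mulr_ge0// ltW.
rewrite -(@ler_pXn2r _ 2%N) ?nnegrE//.
rewrite (_ : (4 * x * D) ^+ 2 = 16 * (x ^+ 2 * D) * D); last by ring.
rewrite x2D /D.
have k1 : (d%:R + 2) <= 7 / 3 * (d%:R - 2) :> R by lra.
have k2 : (d%:R + 2) ^+ 2 <= 8 * (d%:R - 2) ^+ 2 :> R by nra.
have k3 : (d%:R - 2) * l * ((d%:R - 2) * l) <= (d%:R - 2) * l * eta.
  have k0 : 0 <= (d%:R - 2) * l by rewrite mulr_ge0 ?(ltW l0)//; lra.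
  by rewrite ler_wpM2l// ltW.
have k4 : (d%:R + 2) ^+ 2 * l ^+ 2 <= 8 * (d%:R - 2) ^+ 2 * l ^+ 2.
  by rewrite ler_wpM2r// sqr_ge0.
nra.
Qed.

Lemma l1_exponent L : 0 <= L ->
  exists2 lambda, 0 <= lambda &
    (d.-1%:R - 1 + 2^-1 ^+ d.-1) * ln 2 + 2 * (1 - 2^-1 ^+ d.-1) *
      ln (2 * expR (lambda ^+ 2 / 2) * (expR (lambda ^+ 2 / 2) + h%:R - 1))
    + 2^-1 ^+ d.-1 * (ln (2 * h%:R) + lambda ^+ 2 / 2)
    - 2 * lambda * (Num.sqrt (2 * d%:R * ln 2 + 2 * ln h%:R) +
                    Num.sqrt (2 * h%:R * L)) <= - L.
Proof.
move=> L0; set q := 2^-1 ^+ _; have l0 := ln2_gt0; have e0 := eta0; have D00 := D0.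
have h1' := h1r; have h0 : 0 < h%:R :> R by lra.
have q0 : 0 <= q by rewrite exprn_ge0.
set A := Num.sqrt (2 * _ * _ + _); set B := Num.sqrt _.
have hL : L <= h%:R * L by rewrite ler_peMl.
have DE : 2 * d%:R * ln 2 + 2 * ln h%:R = 2 * D by rewrite /D -/l -/eta; ring.
have A2 : A ^+ 2 = 2 * D by rewrite /A DE sqr_sqrtr// mulr_ge0// ltW.
have B2 : B ^+ 2 = 2 * (h%:R * L) by rewrite sqr_sqrtr ?mulrA//; lra.
have A0 : 0 <= A by exact: sqrtr_ge0.
have B0 : 0 <= B by exact: sqrtr_ge0.
suff [lambda la0 H] : exists2 lambda, 0 <= lambda &
    l1_exponent_at q (lambda ^+ 2 / 2) (width_exp (lambda ^+ 2 / 2))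
    - 2 * lambda * (A + B) <= - L.
  exists lambda => //; apply: le_trans H.
  rewrite le_eqVlt; apply/orP; left; apply/eqP; congr (_ - _).
  rewrite -mulrA lnM ?posrE ?mulr_gt0 ?expR_gt0 ?width_gt0//.
  rewrite lnM ?posrE ?expR_gt0 ?width_gt0// lnM ?posrE// expRK.
  have -> : d.-1%:R = d%:R - 1 :> R by rewrite -subn1 natrB// ltnW.
  by rewrite /l1_exponent_at /width_exp -/l -/eta; ring.
have [AB|AB] := leP (A / 2) B.
  (* Bounding w by u + eta leaves 2 lambda^2 - 2 lambda (A + B), minimal here. Since A B >= A^2 / 2,
     the minimum is at most - A^2 - B^2 / 2 = - 2 D - h L. *)
  exists ((A + B) / 2); first lra.
  set lambda := (A + B) / 2.
  apply: le_trans (lerB (exponent_at_le q0 _) (lexx _)) _; first by rewrite divr_ge0 ?sqr_ge0.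
  have : width_exp (lambda ^+ 2 / 2) <= lambda ^+ 2 / 2 + eta.
    rewrite -[leRHS]expRK; apply: width_exp_le; rewrite expRD expR_eta.
    have : 1 <= expR (lambda ^+ 2 / 2) by rewrite -expR0 ler_expR divr_ge0 ?sqr_ge0.
    set y := expR _ => y1; have : 0 <= (y - 1) * (h%:R - 1) by rewrite mulr_ge0// subr_ge0.
    lra.
  have la2 : lambda ^+ 2 = (A ^+ 2 + 2 * (A * B) + B ^+ 2) / 4 by rewrite /lambda; field.
  have : A * (A / 2) <= A * B by rewrite ler_wpM2l.
  have -> : 2 * lambda * (A + B) = 4 * lambda ^+ 2 by rewrite /lambda; field.
  rewrite la2 (_ : A * (A / 2) = A ^+ 2 / 2); last by field.
  have dl0 : 0 <= d%:R * l by rewrite mulr_ge0// ltW.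
  rewrite A2 B2 /D; lra.
(* With lambda = x A the terms without L are settled by [H]. The cross term pays for L: x >= 1/8 and
   B <= A / 2 give 2 x A B >= A B / 4 >= B^2 / 2 = h L. *)
have [x x8 H] := small_exponent (erefl q).
exists (x * A); first by rewrite mulr_ge0//; lra.
have -> : (x * A) ^+ 2 / 2 = x ^+ 2 * D by rewrite exprMn A2; field.
have : 8^-1 * A * B <= x * A * B by rewrite -!mulrA ler_wpM2r// mulr_ge0.
have -> : 2 * (x * A) * (A + B) = 2 * x * A ^+ 2 + 2 * (x * A * B) by ring.
rewrite A2.
have : B * B <= A / 2 * B by rewrite ler_wpM2r// ltW.
rewrite -expr2 B2; lra.
Qed.

End l1.
End chernoff_exponents.

Section linear_classes.
Context {d : measure_display} {T : measurableType d} {R : realType}.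
Variables (mu : probability T R) (h n : nat) (xi : 'I_h -> T -> R).
Hypothesis xi_int : forall j, integrable_fun mu (xi j).

Lemma l1_linear_class0 : l1_linear_class xi (fun=> 0).
Proof.
exists (fun=> 0); first by rewrite big1// => j _; rewrite normr0.
by apply/funext => x; rewrite big1// => j _; rewrite mul0r.
Qed.

Lemma l2_linear_class0 : l2_linear_class xi (fun=> 0).
Proof.
exists (fun=> 0); first by rewrite big1// => j _; rewrite expr0n.
by apply/funext => x; rewrite big1// => j _; rewrite mul0r.
Qed.

Lemma l1_linear_class_integrable f : l1_linear_class xi f -> integrable_fun mu f.
Proof. by move=> [v _ ->]; apply: integrable_fun_sum => j; exact: integrable_funZ. Qed.

Lemma l2_linear_class_integrable f : l2_linear_class xi f -> integrable_fun mu f.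
Proof. by move=> [v _ ->]; apply: integrable_fun_sum => j; exact: integrable_funZ. Qed.

Let measurable_signed_sum (e : {ffun 'I_n -> bool}) j :
  measurable_fun [set: n.-tuple T] (fun t => signed_sum e (fun i => xi j (tnth t i))).
Proof.
apply: measurable_sum => i; apply: measurable_funM => //.
apply: (measurableT_comp (integrable_fun_measurable (xi_int j))).
exact: measurable_tnth.
Qed.

Lemma measurable_l1_rademacher_bound Gamma lambda :
  measurable_fun [set: n.-tuple T] (l1_rademacher_bound xi Gamma lambda).
Proof.
apply: measurable_sum => e; apply: measurable_sum => j.
apply: measurable_funD; apply: (measurableT_comp (@measurable_expR R)).
  exact: measurable_funM.
by apply: (measurableT_comp (@oppr_measurable R setT)); exact: measurable_funM.
Qed.

Lemma measurable_l2_rademacher_bound Gamma lambda :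
  measurable_fun [set: n.-tuple T] (l2_rademacher_bound xi Gamma lambda).
Proof.
apply: measurable_sum => e; apply: (measurableT_comp (@measurable_expR R)).
apply: measurable_funD => //; apply: measurable_sum => j.
apply: measurable_funM => //; apply: measurable_funX.
exact: measurable_funM.
Qed.

End linear_classes.

Lemma l2_linear_class_dim1 {d} {T : measurableType d} {R : realType} (xi : 'I_1 -> T -> R) :
  l2_linear_class xi = l1_linear_class xi.
Proof.
apply/seteqP; split=> f [v v1 ->]; exists v => //; move: v1; rewrite !big_ord1.
  by rewrite -(real_normK (num_real _)) -[1 in X in X -> _](expr1n R 2) ler_pXn2r ?nnegrE.
by rewrite -(real_normK (num_real _)) -[1 in X in _ -> X](expr1n R 2) ler_pXn2r ?nnegrE.
Qed.

Section coordinates.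
Context {R : realType} {h : nat}.

Definition coordinate (j : 'I_h) (x : euclidean R h) : R := (x : 'cV[R]_h) j ord0.

Lemma l2_norm_sqr (a : 'cV[R]_h) : l2_norm a ^+ 2 = \sum_j a j ord0 ^+ 2.
Proof.
rewrite sqr_sqrtr; last by apply: sumr_ge0 => i _; apply: sumr_ge0 => j _; exact: sqr_ge0.
by apply: eq_bigr => i _; rewrite big_ord1.
Qed.

Variables (Gamma : R) (mu : probability (euclidean R h) R).
Hypothesis mu_uB : class_uB Gamma mu.

Lemma coord_integrable j : integrable_fun mu (coordinate j).
Proof. by case: mu_uB => _ H _ _; exact: H. Qed.

Lemma mean_coord j : mean mu j ord0 = expect mu (coordinate j).
Proof. by rewrite mxE. Qed.

Lemma sum_expect_coord_le : \sum_j expect mu (coordinate j) ^+ 2 <= Gamma ^+ 2.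
Proof.
case: mu_uB => _ _ m _.
under eq_bigr do rewrite -mean_coord.
by rewrite -l2_norm_sqr ler_pXn2r ?nnegrE ?sqrtr_ge0// (le_trans _ m)// sqrtr_ge0.
Qed.

Lemma coord_subgaussian : exists tau, [/\ 0 < tau, tau <= Gamma
  & forall a : 'I_h -> R, (\int[mu]_x
       (expR (\sum_j a j * (coordinate j x - expect mu (coordinate j))))%:E <=
    (expR ((\sum_j a j ^+ 2) * tau ^+ 2 / 2))%:E)%E].
Proof.
case: mu_uB => _ _ _ [tau [tau0 tauG H]]; exists tau; split=> // a.
have := H (\col_j a j); rewrite l2_norm_sqr.
under [in X in (_ <= X)%E -> _]eq_bigr do rewrite mxE.
apply: le_trans; rewrite le_eqVlt; apply/orP; left; apply/eqP.
apply: eq_integral => x _; congr (expR _)%:E; rewrite mxE.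
by apply: eq_bigr => j _; rewrite -mean_coord !mxE.
Qed.

End coordinates.

(* [c] is a deviation, in units of [Gamma / sqrt n], that is exceeded with
   probability at most [expR (- L)]; the optimal [lambda] does not depend on
   the measure or on the sample size, so that two samples can be combined. *)
Definition chernoff_bounded {R : realType} (h : nat) (D : set (euclidean R h -> R)) (L c : R) :=
  exists lambda v : R, [/\ 0 <= lambda, v - 2 * lambda * c <= - L
    & forall Gamma (mu : probability (euclidean R h) R) n,
      0 < Gamma -> class_uB Gamma mu -> (0 < n)%N ->
      deviation_mgf_bounded mu n (lambda / (Num.sqrt n%:R * Gamma)) D v].

Section network_mgf.
Context {R : realType}.
Variables (d h : nat) (L : R).
Hypotheses (d2 : (2 <= d)%N) (h1 : (1 <= h)%N) (L0 : 0 <= L).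

Let d1E : 1 + d.-1%:R = d%:R :> R.
Proof. by rewrite addrC natr1 prednK// ltnW. Qed.

Lemma l1_tower_chernoff : chernoff_bounded (h := h) (relu_tower (l1_linear_class coordinate) d.-1) L
  (Num.sqrt (2 * d%:R * ln 2 + 2 * ln h%:R) + Num.sqrt (2 * h%:R * L)).
Proof.
have [lambda la0 H] := l1_exponent d2 h1 L0; exists lambda; eexists; split => //.
  exact: H.
move=> Gamma mu n G0 mu_uB n0; have [tau [tau0 tauG sg]] := coord_subgaussian mu_uB.
have ci := coord_integrable mu_uB; have sm := sum_expect_coord_le mu_uB.
have th0 : 0 <= lambda / (Num.sqrt n%:R * Gamma) by rewrite divr_ge0// mulr_ge0 ?sqrtr_ge0 ?ltW.
apply: (deviation_mgf_bounded_tower th0 (@l1_linear_class0 _ _ _ _ _)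
  (l1_linear_class_integrable ci) (measurable_l1_rademacher_bound ci Gamma lambda)).
- by move=> t; apply: (l1_rademacher_le tau0 tauG la0).
- exact: (integral_l1_rademacher_bound ci tau0 tauG sm sg lambda n0 h1).
- exact: (l1_linear_class_deviation ci tau0 tauG sg la0 n0 h1).
Qed.

Lemma l2_tower_chernoff : chernoff_bounded (h := h) (relu_tower (l2_linear_class coordinate) d.-1) L
  (Num.sqrt (6 * d%:R * ln 2 + 5 * h%:R / 4) + Num.sqrt (2 * h%:R * L)).
Proof.
(* In dimension 1 the l1 and l2 balls coincide, and the l1 moment bound is used since [l2_exponent]
   requires h >= 2. *)
have [h2|] := ltnP 1 h; last first.
  case: h h1 => [//|[_ _|//]].
  have [lambda la0 H] := l2_exponent_dim1 d2 L0; exists lambda; eexists; split => //.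
    exact: H.
  move=> Gamma mu n G0 mu_uB n0; have [tau [tau0 tauG sg]] := coord_subgaussian mu_uB.
  have ci := coord_integrable mu_uB; have sm := sum_expect_coord_le mu_uB.
  have th0 : 0 <= lambda / (Num.sqrt n%:R * Gamma) by rewrite divr_ge0// mulr_ge0 ?sqrtr_ge0 ?ltW.
  rewrite l2_linear_class_dim1 -d1E.
  apply: (deviation_mgf_bounded_direct th0 (@l1_linear_class0 _ _ _ _ _)
    (l1_linear_class_integrable ci) (measurable_l1_rademacher_bound ci Gamma lambda)).
  - by move=> t; apply: (l1_rademacher_le tau0 tauG la0).
  - exact: (integral_l1_rademacher_bound ci tau0 tauG sm sg lambda n0 isT).
have [lambda la0 H] := l2_exponent d2 h2 L0; exists lambda; eexists; split => //.
  exact: H.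
move=> Gamma mu n G0 mu_uB n0; have [tau [tau0 tauG sg]] := coord_subgaussian mu_uB.
have ci := coord_integrable mu_uB; have sm := sum_expect_coord_le mu_uB.
have th0 : 0 <= lambda / (Num.sqrt n%:R * Gamma) by rewrite divr_ge0// mulr_ge0 ?sqrtr_ge0 ?ltW.
rewrite -d1E.
apply: (deviation_mgf_bounded_direct th0 (@l2_linear_class0 _ _ _ _ _)
  (l2_linear_class_integrable ci) (measurable_l2_rademacher_bound ci Gamma lambda)).
- by move=> t; exact: (l2_rademacher_le tau0 tauG lambda n0).
- exact: (integral_l2_rademacher_bound ci tau0 tauG sm sg lambda n0).
Qed.

End network_mgf.

(** * Networks *)

Section networks_in_tower.
Context {R : realType}.
Variables (d : nat) (k : nat -> nat) (sigma : nat -> R -> R) (M : nat -> R).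
Hypothesis sigma_relu : forall i, (1 <= i < d)%N -> sigma i = @relu R.
Hypothesis M_gt0 : forall i, (1 <= i <= d)%N -> 0 < M i.

Let Mprod i := \prod_(1 <= s < i.+1) M s.

Let MprodS i : Mprod i.+1 = Mprod i * M i.+1.
Proof. by rewrite /Mprod big_nat_recr. Qed.

Let Mprod_gt0 i : (i <= d)%N -> 0 < Mprod i.
Proof.
elim: i => [|i IH] id; first by rewrite /Mprod big_geq.
by rewrite MprodS mulr_gt0 ?IH ?M_gt0// ltnW.
Qed.

Lemma reluZ (c t : R) : 0 <= c -> relu (c * t) = c * relu t.
Proof. by move=> c0; rewrite /relu maxr_pMr// mulr0. Qed.

Lemma hidden_layerS (W : forall i, 'M[R]_(k i.+1, k i)) x i r : (i.+1 < d)%N ->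
  hidden_layer sigma W x i.+1 r ord0 =
  relu (\sum_j W i.+1 r j * hidden_layer sigma W x i j ord0).
Proof. by move=> id; rewrite /= mxE sigma_relu// mxE. Qed.

Let l1_class := l1_linear_class (@coordinate R (k 1%N)).
Let l2_class := l2_linear_class (@coordinate R (k 1%N)).

Lemma l1_layer_tower (W : forall i, 'M[R]_(k i.+1, k i)) i (v : 'I_(k i.+1) -> R) :
  (forall i, (1 <= i < d)%N -> one_inf_norm (W i) <= M i) ->
  (i < d)%N -> \sum_j `|v j| <= M i.+1 ->
  exists2 g, relu_tower l1_class i g &
    forall x, \sum_j v j * hidden_layer sigma W x i j ord0 = Mprod i.+1 * g x.
Proof.
move=> WM; elim: i v => [|i IH] v id vM; have Mi := M_gt0 (i := _.+1) id.
  exists (fun x => \sum_j v j / M 1%N * coordinate j x).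
    exists (fun j => v j / M 1%N) => //.
    under eq_bigr do rewrite normrM (gtr0_norm (_ : 0 < (M 1%N)^-1)) ?invr_gt0//.
    by rewrite -mulr_suml ler_pdivrMr// mul1r.
  move=> x; rewrite /Mprod big_nat1 mulr_sumr; apply: eq_bigr => j _.
  by rewrite /= /coordinate; field; rewrite gt_eqF.
have row r : \sum_j `|W i.+1 r j| <= M i.+1.
  apply: le_trans (WM i.+1 id); rewrite /one_inf_norm.
  by rewrite (bigD1 r)//= le_max lexx.
have /choice[g gE] r : exists g, relu_tower l1_class i g /\
    forall x, \sum_j W i.+1 r j * hidden_layer sigma W x i j ord0 = Mprod i.+1 * g x.
  by have [g] := IH (W i.+1 r) (ltnW id) (row r); exists g.
exists (fun x => \sum_r v r / M i.+2 * relu (g r x)).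
  exists (k i.+2), (fun r => v r / M i.+2), g; split=> //.
  - by move=> r; have [] := gE r.
  - under eq_bigr do rewrite normrM (gtr0_norm (_ : 0 < (M i.+2)^-1)) ?invr_gt0//.
    by rewrite -mulr_suml ler_pdivrMr// mul1r.
move=> x; rewrite MprodS mulr_sumr; apply: eq_bigr => r _.
rewrite hidden_layerS// (gE r).2 reluZ; last by rewrite ltW// Mprod_gt0// ltnW.
by field; rewrite gt_eqF.
Qed.

Lemma row_norm_sqr_le (W : forall i, 'M[R]_(k i.+1, k i)) i :
  0 <= M i -> frobenius_norm (W i) <= M i -> \sum_r \sum_j W i r j ^+ 2 <= M i ^+ 2.
Proof.
move=> M0 WM; rewrite -[leLHS]sqr_sqrtr; last first.
  by apply: sumr_ge0 => r _; apply: sumr_ge0 => j _; exact: sqr_ge0.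
by rewrite ler_pXn2r ?nnegrE ?sqrtr_ge0.
Qed.

Lemma sum_norm_mul_le (p : nat) (v s : 'I_p -> R) (a b : R) : 0 <= a -> 0 <= b ->
  \sum_j v j ^+ 2 <= a ^+ 2 -> \sum_j s j ^+ 2 <= b ^+ 2 ->
  \sum_j `|v j| * `|s j| <= a * b.
Proof.
rewrite le_eqVlt => /predU1P[<-|a0] b0 va sb.
  rewrite mul0r big1// => j _; suff -> : v j = 0 by rewrite normr0 mul0r.
  apply/eqP; rewrite -sqrf_eq0 eq_le sqr_ge0 andbT.
  move: va; rewrite expr0n /=; apply: le_trans; rewrite (bigD1 j)//= lerDl.
  by apply: sumr_ge0 => l _; exact: sqr_ge0.
have v1 : \sum_j (`|v j| / a) ^+ 2 <= 1.
  under eq_bigr do rewrite expr_div_n real_normK ?num_real//.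
  by rewrite -mulr_suml ler_pdivrMr ?exprn_gt0// mul1r.
have := sqr_linear_le (fun j => `|s j|) v1.
under [X in _ <= X -> _]eq_bigr do rewrite real_normK ?num_real//.
move=> /le_trans/(_ sb); rewrite ler_pXn2r ?nnegrE//; last first.
  by apply: sumr_ge0 => j _; rewrite mulr_ge0 ?divr_ge0// ltW.
have -> : \sum_j `|v j| / a * `|s j| = (\sum_j `|v j| * `|s j|) / a.
  by rewrite mulr_suml; apply: eq_bigr => j _; rewrite mulrAC.
by rewrite ler_pdivrMr// mulrC.
Qed.

(** Each row is normalized by its own norm [rho r]. By Cauchy-Schwarz the weights v_r rho_r /
    (M_{i+2} M_{i+1}) then have l1 norm at most 1, so the Frobenius constraint leads to the same l1
    hulls and only the bottom class differs. *)
Lemma l2_layer_tower (W : forall i, 'M[R]_(k i.+1, k i)) i (v : 'I_(k i.+1) -> R) :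
  (forall i, (1 <= i < d)%N -> frobenius_norm (W i) <= M i) ->
  (i < d)%N -> \sum_j v j ^+ 2 <= M i.+1 ^+ 2 ->
  exists2 g, relu_tower l2_class i g &
    forall x, \sum_j v j * hidden_layer sigma W x i j ord0 = Mprod i.+1 * g x.
Proof.
move=> WM; elim: i v => [|i IH] v id vM; have Mi := M_gt0 (i := _.+1) id.
  exists (fun x => \sum_j v j / M 1%N * coordinate j x).
    exists (fun j => v j / M 1%N) => //.
    under eq_bigr do rewrite expr_div_n.
    by rewrite -mulr_suml ler_pdivrMr ?exprn_gt0// mul1r.
  move=> x; rewrite /Mprod big_nat1 mulr_sumr; apply: eq_bigr => j _.
  by rewrite /= /coordinate; field; rewrite gt_eqF.
have Mi' := M_gt0 (i := i.+1) (ltnW id).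
pose rho r := Num.sqrt (\sum_j W i.+1 r j ^+ 2).
have S0 r : 0 <= \sum_j W i.+1 r j ^+ 2 by apply: sumr_ge0 => j _; exact: sqr_ge0.
have rho0 r : 0 <= rho r by exact: sqrtr_ge0.
have rho2 r : rho r ^+ 2 = \sum_j W i.+1 r j ^+ 2 by rewrite sqr_sqrtr.
have rhoM : \sum_r rho r ^+ 2 <= M i.+1 ^+ 2.
  by under eq_bigr do rewrite rho2; apply: row_norm_sqr_le; rewrite ?WM// ltW.
have /choice[g gE] r : exists g, relu_tower l2_class i g /\
    forall x, \sum_j W i.+1 r j * hidden_layer sigma W x i j ord0 =
      rho r / M i.+1 * (Mprod i.+1 * g x).
  (* A zero row cannot be normalized; its output vanishes and the zero function represents it. *)
  have [r0|r0] := eqVneq (rho r) 0.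
    exists (fun=> 0); split; first by apply: relu_tower0; exact: l2_linear_class0.
    move=> x; rewrite r0 !mul0r big1// => j _.
    suff -> : W i.+1 r j = 0 by rewrite mul0r.
    apply/eqP; rewrite -sqrf_eq0 eq_le sqr_ge0 andbT.
    rewrite [leRHS](_ : 0 = \sum_j W i.+1 r j ^+ 2); last by rewrite -rho2 r0 expr0n.
    rewrite (bigD1 j)//= lerDl.
    by apply: sumr_ge0 => l _; exact: sqr_ge0.
  have [|g Dg gE] := IH (fun j => W i.+1 r j * (M i.+1 / rho r)) (ltnW id).
    under eq_bigr do rewrite exprMn.
    by rewrite -mulr_suml -rho2 expr_div_n mulrC divfK// sqrf_eq0.
  exists g; split=> // x; rewrite -gE mulr_sumr; apply: eq_bigr => j _.
  by field; rewrite r0 gt_eqF.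
exists (fun x => \sum_r v r * rho r / (M i.+2 * M i.+1) * relu (g r x)).
  exists (k i.+2), (fun r => v r * rho r / (M i.+2 * M i.+1)), g; split=> //.
  - by move=> r; have [] := gE r.
  - have MM : 0 < M i.+2 * M i.+1 by rewrite mulr_gt0.
    under eq_bigr do rewrite normrM (gtr0_norm (_ : 0 < (M i.+2 * M i.+1)^-1)) ?invr_gt0// normrM.
    rewrite -mulr_suml ler_pdivrMr// mul1r.
    by apply: sum_norm_mul_le => //; exact: ltW.
move=> x; rewrite MprodS mulr_sumr; apply: eq_bigr => r _.
rewrite hidden_layerS// (gE r).2 reluZ ?divr_ge0// ?(ltW Mi')// reluZ; last first.
  by rewrite ltW// Mprod_gt0// ltnW.
by field; rewrite !gt_eqF.
Qed.

Lemma networkE (w : params R d k) x :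
  network sigma w x = \sum_j output_weight w j ord0 *
    hidden_layer sigma (hidden_weight w) x d.-1 j ord0.
Proof. by rewrite /network mxE; apply: eq_bigr => j _; rewrite mxE. Qed.

Hypothesis d_gt0 : (0 < d)%N.

Let d1E : d.-1.+1 = d. Proof. exact: prednK. Qed.

Let Md1E : M d.-1.+1 = M d. Proof. by rewrite d1E. Qed.

Lemma network_1inf_tower f : network_class sigma (params_1inf d k M) f ->
  exists2 g, relu_tower l1_class d.-1 g & forall x, f x = \prod_(1 <= i < d.+1) M i * g x.
Proof.
move=> [w [wM vM] <-].
have [||g Dg gE] := @l1_layer_tower (hidden_weight w) d.-1 (fun j => output_weight w j ord0) wM.
- by rewrite d1E.
- by rewrite Md1E.
by exists g => // x; rewrite networkE gE d1E.
Qed.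

Lemma network_F_tower f : network_class sigma (params_F d k M) f ->
  exists2 g, relu_tower l2_class d.-1 g & forall x, f x = \prod_(1 <= i < d.+1) M i * g x.
Proof.
move=> [w [wM vM] <-].
have [||g Dg gE] := @l2_layer_tower (hidden_weight w) d.-1 (fun j => output_weight w j ord0) wM.
- by rewrite d1E.
- by rewrite Md1E -l2_norm_sqr ler_pXn2r ?nnegrE ?sqrtr_ge0// ltW// M_gt0// leqnn d_gt0.
by exists g => // x; rewrite networkE gE d1E.
Qed.

End networks_in_tower.

Section tower_lipschitz.
Context {R : realType} {h : nat}.
Implicit Types (g : euclidean R h -> R) (x y : 'cV[R]_h).

Definition l1_lipschitz g := forall x y, `|g x - g y| <= l1_norm (x - y).

Lemma l1_class_lipschitz g : l1_linear_class (@coordinate R h) g -> l1_lipschitz g.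
Proof.
move=> [v v1 ->] x y.
rewrite -sumrB (le_trans (ler_norm_sum _ _ _))//; apply: ler_sum => j _.
rewrite -mulrBr normrM !mxE /coordinate ler_piMl//.
by apply: le_trans v1; rewrite (bigD1 j)//= lerDl sumr_ge0.
Qed.

Lemma l2_class_lipschitz g : l2_linear_class (@coordinate R h) g -> l1_lipschitz g.
Proof.
move=> [v v1 ->] x y.
rewrite -sumrB (le_trans (ler_norm_sum _ _ _))//; apply: ler_sum => j _.
rewrite -mulrBr normrM !mxE /coordinate ler_piMl//.
rewrite -(@ler_pXn2r _ 2%N) ?nnegrE// expr1n real_normK ?num_real//.
apply: le_trans v1; rewrite (bigD1 j)//= lerDl.
by apply: sumr_ge0 => l _; exact: sqr_ge0.
Qed.

Lemma tower_lipschitz (D : set (euclidean R h -> R)) j g :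
  (forall f, D f -> l1_lipschitz f) -> relu_tower D j g -> l1_lipschitz g.
Proof.
move=> Dl; elim: j g => [|j IH] g /=; first exact: Dl.
move=> [K [a [u [Du a1 ->]]]] x y; rewrite -sumrB.
under eq_bigr do rewrite -mulrBr.
apply: norm_sum_hull => //; first exact: sumr_ge0.
by move=> i; apply: le_trans (relu_lip _ _) _; exact: IH.
Qed.

Lemma tower_at0 (D : set (euclidean R h -> R)) j g :
  (forall f, D f -> f 0 = 0) -> relu_tower D j g -> g 0 = 0.
Proof.
move=> D00; elim: j g => [|j IH] g /=; first exact: D00.
move=> [K [a [u [Du a1 ->]]]]; rewrite big1// => i _.
by rewrite (IH _ (Du i)) /relu maxxx mulr0.
Qed.

End tower_lipschitz.

(** * Countable subfamilies *)

Section countable_approximation.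
Context {R : realType}.

(** Elements are sorted into buckets by the integer parts of p * Phi_i for i < N. There are
    countably many codes (p, list of integers); one element is picked from each nonempty bucket, and
    two elements of a bucket differ by at most 1 / p in each of the N values. *)
Lemma countable_approximation (U : Type) (F : set U) (Phi : nat -> U -> R) u0 : F u0 ->
  exists phi : nat -> U, (forall k, F (phi k)) /\
    forall u, F u -> forall N e, 0 < e ->
    exists k, forall i, (i < N)%N -> `|Phi i (phi k) - Phi i u| <= e.
Proof.
move=> Fu0.
pose bucket (c : nat * seq int) u := F u /\
  forall i, (i < size c.2)%N -> Num.floor (c.1%:R * Phi i u) = nth 0 c.2 i.
have /choice[phi phiE] k : exists u, F u /\
    forall c u', unpickle k = Some c -> bucket c u' -> bucket c u.
  case E : (unpickle k) => [c|]; last by exists u0.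
  have [[u bu]|nb] := pselect (exists u, bucket c u).
    by exists u; split; [have [] := bu|move=> _ u' [<-] _].
  by exists u0; split=> // _ u [<-] bu; case: nb; exists u.
exists phi; split=> [k|u Fu N e e0]; first by have [] := phiE k.
pose p := Num.bound e^-1.
have pe : 1 < p%:R * e by rewrite -ltr_pdivrMr// div1r archi_boundP// invr_ge0 ltW.
have p0 : 0 < p%:R :> R by rewrite -(ltr_pM2r e0) mul0r (lt_trans ltr01).
pose c := (p, mkseq (fun i => Num.floor (p%:R * Phi i u)) N).
have bu : bucket c u.
  by split=> // i; rewrite size_mkseq => iN; rewrite nth_mkseq.
exists (pickle c) => i iN.
have [_ /(_ c u (pickleK c) bu)[_ /(_ i)]] := phiE (pickle c).
rewrite size_mkseq nth_mkseq// => /(_ iN) fE.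
have /andP[a1 a2] := floor_itv (p%:R * Phi i u).
have /andP[b1 b2] := floor_itv (p%:R * Phi i (phi (pickle c))).
move: b1 b2; rewrite fE !intrD => b1 b2; move: a1 a2; rewrite !intrD => a1 a2.
rewrite -(ler_pM2l p0) -{1}(gtr0_norm p0) -normrM mulrBr ler_norml.
by apply/andP; split; move: pe a1 a2 b1 b2; rewrite /=; lra.
Qed.

End countable_approximation.

Section empirical_integral.
Context {R : realType} {h : nat}.

Lemma ge0_integral_empirical n (x : 'I_n -> euclidean R h) (f : euclidean R h -> \bar R) :
  measurable_fun setT f -> (forall z, 0 <= f z)%E ->
  (\int[empirical_measure x]_z f z = (n%:R^-1)%:E * \sum_i f (x i))%E.
Proof.
move=> mf f0.
pose atom (i : nat) : {measure set (euclidean R h) -> \bar R} :=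
  oapp (fun i : 'I_n => (dirac (x i) : {measure set (euclidean R h) -> \bar R}))
    mzero (insub i).
have n0 : 0 <= (n%:R : R)^-1 by rewrite invr_ge0.
pose w := NngNum n0.
rewrite (eq_measure_integral (mscale w (msum atom n))); last first.
  move=> A _ _; rewrite /empirical_measure /mscale /msum /=.
  by congr (_ * _)%E; apply: eq_bigr => i _; rewrite /atom valK.
rewrite ge0_integral_mscale// ge0_integral_measure_sum//.
congr (_ * _)%E; apply: eq_bigr => i _.
by rewrite /atom valK /= integral_dirac// diracT mul1e.
Qed.

Lemma integral_empirical n (x : 'I_n -> euclidean R h) (f : euclidean R h -> R) :
  measurable_fun setT f ->
  (\int[empirical_measure x]_z (f z)%:E = (n%:R^-1 * \sum_i f (x i))%:E)%E.
Proof.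
move=> mf; have mEf : measurable_fun setT (EFin \o f) by exact/measurable_EFinP.
rewrite integralE !ge0_integral_empirical//;
  [|exact: measurable_funeneg|exact: measurable_funepos].
under eq_bigr do rewrite funeposE -EFin_max.
under [X in (_ - _ * X)%E]eq_bigr do rewrite funenegE -EFinN -EFin_max.
rewrite !sumEFin -!EFinM -EFinB -mulrBr -sumrB; congr (_ * _)%:E.
apply: eq_bigr => i _; rewrite /Num.max.
by case: ltP => ?; case: ltP => ?; lra.
Qed.

End empirical_integral.

Section rational_points.
Context {R : realType} {h : nat}.

Lemma rational_point_approximation (x : 'cV[R]_h) (e : R) : 0 < e ->
  exists r : 'cV[rat]_h, l1_norm (x - map_mx ratr r) <= e.
Proof.
(* Dividing by h + 1 keeps the denominator nonzero when h = 0. *)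
move=> e0; pose b := e / h.+1%:R; have b0 : 0 < b by rewrite divr_gt0.
have /choice[q qE] j : exists q : rat, `|x j ord0 - ratr q| <= b.
  have [q] := @rat_in_itvoo R (x j ord0 - b) (x j ord0) ltac:(rewrite ltrBlDr ltrDl//).
  rewrite in_itv /= => /andP[q1 q2]; exists q; rewrite ger0_norm; lra.
exists (\col_j q j); apply: (@le_trans _ _ (\sum_(j < h) b)).
  by apply: ler_sum => j _; rewrite !mxE; exact: qE.
rewrite sumr_const card_ord -mulr_natl /b mulrA ler_pdivrMr// mulrC.
by rewrite ler_wpM2l ?ler_nat// ltW.
Qed.

End rational_points.

Section separable_subfamily.
Context {R : realType} {h : nat}.
Variables (F : set (euclidean R h -> R)) (C : R) (E1 E2 : (euclidean R h -> R) -> R).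
Hypothesis F_lip : forall f, F f -> forall x y : 'cV[R]_h, `|f x - f y| <= C * l1_norm (x - y).
Hypothesis C0 : 0 <= C.

(** [E1] and [E2] will be the expectations under the two laws; point values serve the empirical
    measures. Equi-Lipschitz continuity reduces arbitrary points to rational ones, leaving countably
    many functionals. *)
Lemma separable_subfamily f0 : F f0 -> exists phi : nat -> euclidean R h -> R,
  (forall k, F (phi k)) /\
  forall f, F f -> forall (I : finType) (x : I -> euclidean R h) e, 0 < e ->
  exists k, [/\ forall i, `|phi k (x i) - f (x i)| <= e,
    `|E1 (phi k) - E1 f| <= e & `|E2 (phi k) - E2 f| <= e].
Proof.
move=> Ff0.
pose Phi i (f : euclidean R h -> R) : R := match i with
  | 0 => E1 f | 1 => E2 f
  | i.+2 => if unpickle i is Some r then f (map_mx ratr (r : 'cV[rat]_h)) else 0 end.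
have [phi [Fphi phiP]] := countable_approximation Phi Ff0.
exists phi; split=> // f Ff I x e e0.
(* With e' = e / (2 C + 1), moving both functions to the rational point costs 2 C e' and comparing
   them there costs e'. *)
have e4 : 0 < e / (2 * C + 1) by rewrite divr_gt0// ltr_pwDr// mulr_ge0.
have /choice[r rE] i := rational_point_approximation (x i : 'cV[R]_h) e4.
pose N := (\max_i (pickle (r i)).+3 + 2)%N.
have e40 : e / (2 * C + 1) <= e.
  by rewrite ler_pdivrMr ?ltr_pwDr ?mulr_ge0// ler_peMr ?lerDr ?mulr_ge0// ltW.
have [k kP] := phiP f Ff N _ e4.
exists k; split; last 2 first.
- by apply: le_trans (kP 0%N _) e40; rewrite /N addn2.
- by apply: le_trans (kP 1%N _) e40; rewrite /N addn2.
move=> i; have iN : ((pickle (r i)).+2 < N)%N.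
  by rewrite /N ltn_addr// (leq_bigmax (F := fun i => (pickle (r i)).+3) i).
have H := kP _ iN; rewrite /Phi pickleK in H.
have h1 := F_lip (Fphi k) (x i) (map_mx ratr (r i)).
have h2 := F_lip Ff (x i) (map_mx ratr (r i)).
have h3 := ler_wpM2l C0 (rE i).
have -> : e = 2 * (C * (e / (2 * C + 1))) + e / (2 * C + 1).
  by field; rewrite gt_eqF// ltr_pwDr// mulr_ge0.
move: h1 h2 H; rewrite !ler_norml => /andP[? ?] /andP[? ?] /andP[? ?].
by apply/andP; split; lra.
Qed.

End separable_subfamily.

(** * Deviation of the neural net distance *)

Section suprema.
Context {R : realType}.
Local Open Scope ereal_scope.

Lemma ereal_sup_dense (U : Type) (F : set U) (b : U -> R) (phi : nat -> U) :
  (forall k, F (phi k)) ->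
  (forall f, F f -> forall e, (0 < e)%R -> exists k, (`|b (phi k) - b f| <= e)%R) ->
  ereal_sup [set `|b f|%:E | f in F] = ereal_sup (range (fun k => `|b (phi k)|%:E)).
Proof.
move=> Fphi dense; apply/eqP; rewrite eq_le; apply/andP; split; last first.
  by apply: le_ereal_sup => _ [k _ <-]; exists (phi k).
apply: ge_ereal_sup => _ [f Ff <-]; apply/lee_addgt0Pr => e e0.
have [k hk] := dense f Ff e e0.
apply: (@le_trans _ _ (`|b (phi k)|%:E + e%:E)); last first.
  by apply: leeD => //; apply: ereal_sup_ubound; exists k.
rewrite -EFinD lee_fin; have := ler_distD (b (phi k)) (b f) 0%R.
by rewrite !subr0 distrC; lra.
Qed.

(** Finiteness of one supremum excludes the difference of two infinities; the other one is then
    finite as well. *)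
Lemma ereal_sup_dist_le (a e : nat -> R) (t : R) :
  (forall k, `|a k - e k| <= t)%R ->
  ereal_sup (range (fun k => `|e k|%:E)) < +oo ->
  `|ereal_sup (range (fun k => `|e k|%:E)) - ereal_sup (range (fun k => `|a k|%:E))| <= t%:E.
Proof.
move=> ae efin; have t0 : (0 <= t)%R by exact: le_trans (ae 0%N).
have shift (a' e' : nat -> R) : (forall k, `|a' k - e' k| <= t)%R ->
    ereal_sup (range (fun k => `|a' k|%:E)) <= ereal_sup (range (fun k => `|e' k|%:E)) + t%:E.
  move=> ae'; apply: ge_ereal_sup => _ [k _ <-].
  apply: (@le_trans _ _ (`|e' k|%:E + t%:E)); last first.
    by apply: leeD => //; apply: ereal_sup_ubound; exists k.
  rewrite -EFinD lee_fin; have := ler_distD (e' k) (a' k) 0%R.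
  by rewrite !subr0; have := ae' k; lra.
have pos (b : nat -> R) : 0 <= ereal_sup (range (fun k => `|b k|%:E)).
  apply: (@le_trans _ _ `|b 0%N|%:E); first by rewrite lee_fin.
  by apply: ereal_sup_ubound; exists 0%N.
have h1 := shift a e ae.
have h2 : ereal_sup (range (fun k => `|e k|%:E)) <= ereal_sup (range (fun k => `|a k|%:E)) + t%:E.
  by apply: shift => k; rewrite distrC.
move: h1 h2 (pos a) (pos e) efin.
case: (ereal_sup _) => [s| |]; case: (ereal_sup _) => [r| |]//=.
by rewrite !lee_fin ler_norml => *; lra.
Qed.

Lemma measurable_ereal_sup_norm {d} {T : measurableType d} (a : nat -> T -> R) :
  (forall k, measurable_fun setT (a k)) ->
  measurable_fun setT (fun x => ereal_sup (range (fun k => `|a k x|%:E))).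
Proof.
move=> ma.
have -> : (fun x => ereal_sup (range (fun k => `|a k x|%:E))) =
    (fun x => esups (fun k => `|a k x|%:E) 0%N).
  apply/funext => x; rewrite /esups /sdrop; congr ereal_sup.
  by apply/seteqP; split => y [k _ <-]; exists k.
apply: (@measurable_fun_esups _ T R setT (fun k x => `|a k x|%:E)) => k.
by apply/measurable_EFinP; exact: (measurableT_comp (@normr_measurable R setT)).
Qed.

End suprema.

Lemma expR_convex {R : realType} (p q a b : R) : 0 <= p -> 0 <= q -> p + q = 1 ->
  expR (p * a + q * b) <= p * expR a + q * expR b.
Proof.
move=> p0 q0 pq.
have -> : p * a + q * b = b + p * (a - b) by rewrite (_ : q = 1 - p); [ring|lra].
have ab := @expR_chord R p (a - b) ltac:(lra).
rewrite expRD; apply: le_trans (ler_wpM2l (expR_ge0 b) ab) _.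
have -> : expR a = expR b * expR (a - b) by rewrite -expRD addrC subrK.
by rewrite (_ : q = 1 - p); [rewrite le_eqVlt; apply/orP; left; apply/eqP; ring|lra].
Qed.

Section two_sample_chernoff.
Local Open Scope ereal_scope.
Context {R : realType} {h : nat} {dO : measure_display} {Omega : measurableType dO}
  {P : probability Omega R} {mu nu : probability (euclidean R h) R} {n m : nat}
  {X : 'I_n -> {RV P >-> euclidean R h}} {Y : 'I_m -> {RV P >-> euclidean R h}}.
Variables (G : set (euclidean R h -> R)) (Gamma L c p q : R).
Hypotheses (n0 : (0 < n)%N) (m0 : (0 < m)%N) (Gamma0 : (0 < Gamma)%R).
Hypotheses (mu_uB : class_uB Gamma mu) (nu_uB : class_uB Gamma nu).
Hypothesis indep : independent_samples mu nu X Y.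
Hypothesis G_chernoff : chernoff_bounded G L c.
Hypothesis mG : forall g, G g -> measurable_fun setT g.
Hypotheses (p0 : (0 <= p)%R) (q0 : (0 <= q)%R) (pq : (p + q = 1)%R).

Definition scaled_deviation K (g : 'I_K -> euclidean R h -> R) w : R :=
  (p * (max0 (fun k => `|deviation mu (g k) (sample X w)|) / (Num.sqrt n%:R * Gamma)) +
   q * (max0 (fun k => `|deviation nu (g k) (sample Y w)|) / (Num.sqrt m%:R * Gamma)))%R.

Let measurable_max_deviation (xi : probability (euclidean R h) R) l
    (Z : 'I_l -> {RV P >-> euclidean R h}) K (g : 'I_K -> euclidean R h -> R) :
  (forall k, G (g k)) ->
  measurable_fun setT (fun w => max0 (fun k => `|deviation xi (g k) (sample Z w)|)%R).
Proof.
move=> Gg; apply: measurable_max0 => k.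
apply: (measurableT_comp (@normr_measurable R setT)).
apply: (measurableT_comp _ (measurable_sample Z)).
by apply: measurable_deviation; exact: mG.
Qed.

Lemma measurable_scaled_deviation K (g : 'I_K -> euclidean R h -> R) :
  (forall k, G (g k)) -> measurable_fun setT (scaled_deviation g).
Proof.
by move=> Gg; apply: measurable_funD; apply: measurable_funM => //;
  apply: measurable_funM => //; exact: measurable_max_deviation.
Qed.

Lemma measurable_large_deviation K (g : 'I_K -> euclidean R h -> R) (t : R) :
  (forall k, G (g k)) -> measurable [set w | (t < scaled_deviation g w)%R].
Proof.
move=> /measurable_scaled_deviation/measurable_EFinP mD.
have := emeasurable_fun_o_infty measurableT mD t%:E.
by rewrite setTI; congr measurable.
Qed.

Lemma two_sample_chernoff K (g : 'I_K -> euclidean R h -> R) : (forall k, G (g k)) ->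
  P [set w | (2 * c < scaled_deviation g w)%R] <= (expR (- L))%:E.
Proof.
move=> Gg; have [lambda [v [la0 vL mgf]]] := G_chernoff.
have [lawX lawY ind] := indep.
pose theta l := (lambda / (Num.sqrt l%:R * Gamma))%R.
pose V (xi : probability (euclidean R h) R) l (Z : 'I_l -> {RV P >-> euclidean R h}) w : R :=
  expR (theta l * max0 (fun k => `|deviation xi (g k) (sample Z w)|)%R).
have mV xi l (Z : 'I_l -> {RV P >-> euclidean R h}) : measurable_fun setT (V xi l Z).
  apply: (measurableT_comp (@measurable_expR R)); apply: measurable_funM => //.
  exact: measurable_max_deviation.
have mmax xi l : measurable_fun [set: l.-tuple (euclidean R h)]
   (fun t => (expR (theta l * max0 (fun k => `|deviation xi (g k) t|)))%:E)%R.
  by apply: measurable_max0_norm => k; apply: measurable_deviation; exact: mG.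
have V1 : \int[P]_w (V mu n X w)%:E <= (expR v)%:E.
  apply: le_trans (mgf _ _ _ Gamma0 mu_uB n0 K g Gg).
  rewrite le_eqVlt; apply/orP; left; apply/eqP.
  apply: (integral_sample (f := fun t => (expR (theta n * max0 (fun k => `|deviation mu (g k) t|)))%:E)
    (u := inl) _ ind lawX (mmax mu n)) => [i j [] //|t].
  by rewrite lee_fin expR_ge0.
have V2 : \int[P]_w (V nu m Y w)%:E <= (expR v)%:E.
  apply: le_trans (mgf _ _ _ Gamma0 nu_uB m0 K g Gg).
  rewrite le_eqVlt; apply/orP; left; apply/eqP.
  apply: (integral_sample (f := fun t => (expR (theta m * max0 (fun k => `|deviation nu (g k) t|)))%:E)
    (u := inr) _ ind lawY (mmax nu m)) => [i j [] //|t].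
  by rewrite lee_fin expR_ge0.
set A := [set w | _].
have mA : measurable A.
  exact: measurable_large_deviation.
pose b : R := expR (- (2 * lambda * c)).
(* [W] dominates the indicator of [A]: on [A] the exponent lambda (scaled_deviation - 2 c) is
   nonnegative, and convexity splits its exponential with weights p and q. *)
pose W w : \bar R := (b * p)%:E * (V mu n X w)%:E + (b * q)%:E * (V nu m Y w)%:E.
have bp0 : (0 <= b * p)%R by rewrite mulr_ge0 ?expR_ge0.
have bq0 : (0 <= b * q)%R by rewrite mulr_ge0 ?expR_ge0.
have mW1 : measurable_fun setT (fun w => (b * p)%:E * (V mu n X w)%:E).
  by apply: emeasurable_funM => //; exact/measurable_EFinP.
have mW2 : measurable_fun setT (fun w => (b * q)%:E * (V nu m Y w)%:E).
  by apply: emeasurable_funM => //; exact/measurable_EFinP.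
have mW : measurable_fun setT W by exact: emeasurable_funD.
have W0 w : 0 <= W w by rewrite adde_ge0// mule_ge0 ?lee_fin ?expR_ge0.
have W1 w : A w -> 1 <= W w.
  rewrite /A /scaled_deviation /= => cw.
  have hW : W w = (b * (p * V mu n X w + q * V nu m Y w))%:E.
    by rewrite /W -!EFinM -EFinD mulrDr !mulrA.
  rewrite hW lee_fin; apply: (@le_trans _ _ (b * expR (p * (theta n *
     max0 (fun k => `|deviation mu (g k) (sample X w)|)) + q * (theta m *
     max0 (fun k => `|deviation nu (g k) (sample Y w)|)))))%R; last first.
    by rewrite ler_wpM2l ?expR_ge0// expR_convex.
  rewrite -expRD -[leLHS]expR0 ler_expR.
  have := ler_wpM2l la0 (ltW cw).
  set x := max0 _; set y := max0 _.
  have -> : (lambda * (p * (x / (Num.sqrt n%:R * Gamma)) + q * (y / (Num.sqrt m%:R * Gamma))) =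
    p * (theta n * x) + q * (theta m * y))%R by rewrite /theta; ring.
  lra.
rewrite -[leLHS]mul1e -integral_cst//.
apply: (@le_trans _ _ (\int[P]_(w in A) W w)).
  apply: ge0_le_integral => //.
  - exact: measurable_funTS.
apply: (@le_trans _ _ (\int[P]_w W w)).
  by apply: ge0_subset_integral.
rewrite /W ge0_integralD//; last 2 first.
- by move=> w _; rewrite mule_ge0 ?lee_fin ?expR_ge0.
- by move=> w _; rewrite mule_ge0 ?lee_fin ?expR_ge0.
rewrite !ge0_integralZl//; last 4 first.
- exact/measurable_EFinP.
- by move=> w _; rewrite lee_fin expR_ge0.
- exact/measurable_EFinP.
- by move=> w _; rewrite lee_fin expR_ge0.
apply: (@le_trans _ _ ((b * p)%:E * (expR v)%:E + (b * q)%:E * (expR v)%:E)).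
  by apply: leeD; apply: lee_wpmul2l; rewrite ?lee_fin.
rewrite -!EFinM -EFinD lee_fin -mulrDl -mulrDr pq mulr1 -expRD ler_expR.
by rewrite addrC.
Qed.

End two_sample_chernoff.

Arguments scaled_deviation {R h dO Omega P} mu nu {n m} X Y Gamma p q {K} g w.

Section deviation_bound.
Context {R : realType} {h : nat} {dO : measure_display} {Omega : measurableType dO}
  {P : probability Omega R} {mu nu : probability (euclidean R h) R} {n m : nat}
  {X : 'I_n -> {RV P >-> euclidean R h}} {Y : 'I_m -> {RV P >-> euclidean R h}}.
Variables (F G : set (euclidean R h -> R)) (C Gamma L c : R).
Hypotheses (n0 : (0 < n)%N) (m0 : (0 < m)%N) (Gamma0 : 0 < Gamma) (C0 : 0 < C).
Hypotheses (mu_uB : class_uB Gamma mu) (nu_uB : class_uB Gamma nu).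
Hypothesis indep : independent_samples mu nu X Y.
Hypothesis F_nonempty : exists f, F f.
Hypothesis F_G : forall f, F f -> exists2 g, G g & forall x, f x = C * g x.
Hypothesis G_chernoff : chernoff_bounded G L c.
Hypothesis G_integrable : forall (xi : probability (euclidean R h) R) g,
  class_uB Gamma xi -> G g -> integrable_fun xi g.
Hypothesis G_lip : forall g, G g -> l1_lipschitz g.
Hypothesis G_at0 : forall g, G g -> g 0 = 0.

Let F_lip f : F f -> forall x y : 'cV[R]_h, `|f x - f y| <= C * l1_norm (x - y).
Proof.
move=> /F_G[g Gg fg] x y; rewrite !fg -mulrBr normrM gtr0_norm//.
by rewrite ler_wpM2l ?(ltW C0)//; exact: G_lip.
Qed.

Let F_integrable (xi : probability (euclidean R h) R) f :
  class_uB Gamma xi -> F f -> integrable_fun xi f.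
Proof.
move=> xi_uB /F_G[g Gg fg]; rewrite (_ : f = fun x => C * g x); last exact/funext.
by apply: integrable_funZ; exact: G_integrable.
Qed.

Let mF f : F f -> measurable_fun setT f.
Proof. by move=> Ff; apply: integrable_fun_measurable (F_integrable mu_uB Ff). Qed.

Let mG g : G g -> measurable_fun setT g.
Proof. by move=> Gg; apply: integrable_fun_measurable (G_integrable mu_uB Gg). Qed.

Let mean_gap f := expect mu f - expect nu f.

Let sample_gap w (f : euclidean R h -> R) :=
  n%:R^-1 * \sum_i f (X i w) - m%:R^-1 * \sum_j f (Y j w).

Let distanceE : neural_net_distance F mu nu =
  ereal_sup [set `|mean_gap f|%:E | f in F].
Proof.
congr ereal_sup; apply: eq_imagel => f Ff.
by rewrite !integral_expect//; exact: F_integrable.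
Qed.

Let empirical_distanceE w : neural_net_distance F
    (empirical_measure (fun i => X i w)) (empirical_measure (fun j => Y j w)) =
  ereal_sup [set `|sample_gap w f|%:E | f in F].
Proof.
congr ereal_sup; apply: eq_imagel => f Ff.
by rewrite !integral_empirical//; exact: mF.
Qed.

(** Vanishing at 0 and the Lipschitz bound give |f x| <= C times the l1 norm of x, which is
    integrable. This makes the distance between the two laws finite. *)
Let expect_norm_le (xi : probability (euclidean R h) R) f : class_uB Gamma xi -> F f ->
  `|expect xi f| <= C * \sum_j expect xi (fun x => `|coordinate j x|).
Proof.
move=> xi_uB Ff.
have ci j : integrable_fun xi (fun x => `|coordinate j x|).
  by apply: integrable_fun_abs; exact: (coord_integrable xi_uB).
have f_int := F_integrable xi_uB Ff.
rewrite -lee_fin -expect_sum// -expectZ; last exact: integrable_fun_sum.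
have b_int := integrable_funZ C (integrable_fun_sum ci).
rewrite -integral_expect//.
have -> : (`|expect xi f|%:E = `|\int[xi]_x (f x)%:E|)%E by rewrite integral_expect.
apply: le_trans (le_abse_integral _ _ _) _ => //; first exact: measurable_int f_int.
apply: le_integral => //.
- by have := integrable_abse f_int.
move=> x _; rewrite lee_fin.
have [g Gg fg] := F_G Ff; have := G_lip Gg x 0.
rewrite G_at0// subr0 subr0 fg normrM gtr0_norm// => gx.
by rewrite ler_wpM2l// ltW.
Qed.

Let distance_finite : (ereal_sup [set `|mean_gap f|%:E | f in F] < +oo)%E.
Proof.
pose b (xi : probability (euclidean R h) R) := C * \sum_j expect xi (fun x => `|coordinate j x|).
apply: (@le_lt_trans _ _ (b mu + b nu)%:E); last exact: ltry.
apply: ge_ereal_sup => _ [f Ff <-]; rewrite lee_fin (le_trans (ler_normB _ _))//.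
by apply: lerD; exact: expect_norm_le.
Qed.

(** The weights p and q are chosen so that Gamma s times the scaled deviation is exactly the sum of
    the two deviations divided by n and by m; this produces the factor n^(-1/2) + m^(-1/2). *)
Let s := (Num.sqrt (n%:R : R))^-1 + (Num.sqrt m%:R)^-1.
Let p := (Num.sqrt (n%:R : R))^-1 / s.
Let q := (Num.sqrt (m%:R : R))^-1 / s.

Let sn0 : 0 < (Num.sqrt (n%:R : R))^-1. Proof. by rewrite invr_gt0 sqrtr_gt0 ltr0n. Qed.
Let sm0 : 0 < (Num.sqrt (m%:R : R))^-1. Proof. by rewrite invr_gt0 sqrtr_gt0 ltr0n. Qed.
Let s0 : 0 < s. Proof. by rewrite addr_gt0. Qed.

Let p0 : 0 <= p. Proof. by rewrite divr_ge0 ?ltW. Qed.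
Let q0 : 0 <= q. Proof. by rewrite divr_ge0 ?ltW. Qed.
Let pq : p + q = 1. Proof. by rewrite /p /q -mulrDl divff// gt_eqF. Qed.

Let sdev K (g : 'I_K -> euclidean R h -> R) := scaled_deviation mu nu X Y Gamma p q g.

Let sample_mean_deviation l (Z : 'I_l -> {RV P >-> euclidean R h})
    (xi : probability (euclidean R h) R) f g w : (0 < l)%N -> class_uB Gamma xi ->
  G g -> (f = fun x => C * g x) ->
  l%:R^-1 * (\sum_i f (Z i w)) - expect xi f = C * (l%:R^-1 * deviation xi g (sample Z w)).
Proof.
move=> l0 xi_uB Gg ->; rewrite expectZ; last exact: G_integrable.
rewrite /deviation sumrB sumr_const card_ord -[_ *+ l]mulr_natl.
under [in RHS]eq_bigr do rewrite tnth_mktuple.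
by rewrite -mulr_sumr; field; rewrite pnatr_eq0 -lt0n.
Qed.

Lemma sample_gap_deviation w K (g : 'I_K -> euclidean R h -> R) i f :
  G (g i) -> (f = fun x => C * g i x) ->
  `|sample_gap w f - mean_gap f| <= C * Gamma * s * sdev g w.
Proof.
move=> Gg fg.
rewrite /sample_gap /mean_gap (_ : _ - _ - _ =
  (n%:R^-1 * (\sum_i f (X i w)) - expect mu f) -
  (m%:R^-1 * (\sum_j f (Y j w)) - expect nu f)); last by ring.
rewrite (@sample_mean_deviation n X mu f (g i) w n0 mu_uB Gg fg).
rewrite (@sample_mean_deviation m Y nu f (g i) w m0 nu_uB Gg fg) -mulrBr normrM gtr0_norm// -!mulrA.
rewrite ler_wpM2l ?(ltW C0)// (le_trans (ler_normB _ _))//.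
rewrite !normrM !normfV !normr_nat.
rewrite /sdev /scaled_deviation.
set a := max0 _; set b := max0 _.
have ha : `|deviation mu (g i) (sample X w)| <= a by exact: (max0_ge (fun k => `|_ (g k) _|)).
have hb : `|deviation nu (g i) (sample Y w)| <= b by exact: (max0_ge (fun k => `|_ (g k) _|)).
have -> : Gamma * (s * (p * (a / (Num.sqrt n%:R * Gamma)) + q * (b / (Num.sqrt m%:R * Gamma)))) =
    (Num.sqrt n%:R ^+ 2)^-1 * a + (Num.sqrt m%:R ^+ 2)^-1 * b.
  have := sn0; have := sm0; have := s0; rewrite /p /q !invr_gt0 => ? ? ?.
  by field; rewrite !gt_eqF.
rewrite !sqr_sqrtr ?ler0n//; apply: lerD; (apply: ler_wpM2l; first by rewrite invr_ge0 ler0n).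
  exact: ha.
exact: hb.
Qed.

Let sdev_mono (g : nat -> euclidean R h -> R) K K' w : (K <= K')%N ->
  sdev (fun i : 'I_K => g i) w <= sdev (fun i : 'I_K' => g i) w.
Proof.
move=> KK'; have mono (a : nat -> R) : max0 (fun i : 'I_K => `|a i|) <= max0 (fun i : 'I_K' => `|a i|).
  apply: max0_le; first exact: max0_ge0.
  by move=> i; apply: (max0_ge (fun i : 'I_K' => `|a i|) (widen_ord KK' i)).
by apply: lerD; rewrite ler_wpM2l// ler_wpM2r ?invr_ge0 ?mulr_ge0 ?sqrtr_ge0 ?(ltW Gamma0)//;
  exact: (mono (fun i => deviation _ (g i) _)).
Qed.

(** The finite-family events increase with K and their bound does not depend on K, so continuity
    from below applies. *)
Lemma uniform_deviation_probability (g : nat -> euclidean R h -> R) : (forall k, G (g k)) ->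
  let bad := \bigcup_K [set w | 2 * c < sdev (fun i : 'I_K => g i) w] in
  measurable bad /\ (P bad <= (expR (- L))%:E)%E.
Proof.
move=> Gg; set B := fun K => [set w | 2 * c < sdev (fun i : 'I_K => g i) w] => bad.
have mB K : measurable (B K).
  by apply: (measurable_large_deviation Gamma p q mG) => i; exact: Gg.
have mbad : measurable bad by apply: bigcup_measurable => K _; exact: mB.
split=> //.
have Bmono : {homo B : K K' / (K <= K')%N >-> (K <= K')%O}.
  move=> K K' KK'; apply/subsetPset => w; rewrite /B /=.
  by move=> /lt_le_trans; apply; exact: sdev_mono.
have cB := @nondecreasing_cvg_mu _ _ _ P _ mB mbad Bmono.
rewrite -(cvg_lim _ cB)//; apply: lime_le; first by apply/cvg_ex; eexists; exact: cB.
apply: nearW => K.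
by apply: (two_sample_chernoff n0 m0 Gamma0 mu_uB nu_uB indep G_chernoff mG) => // i; exact: Gg.
Qed.

Theorem distance_error_probability :
  with_probability_at_least P (1 - expR (- L))
    [set w | (distance_error F mu nu X Y w <= (2 * Gamma * C * c * s)%:E)%E].
Proof.
have [f0 Ff0] := F_nonempty.
have [phi [Fphi dense]] := separable_subfamily (expect mu) (expect nu)
  F_lip (ltW C0) Ff0.
have /choice[g gE] k : exists g, G g /\ phi k = fun x => C * g x.
  by have [g Gg fg] := F_G (Fphi k); exists g; split=> //; exact/funext.
have distE : neural_net_distance F mu nu = ereal_sup (range (fun k => `|mean_gap (phi k)|%:E)).
  rewrite distanceE; apply: ereal_sup_dense => // f Ff e e0.
  (* Only the two expectations matter here, hence the empty family of points. *)
  have [k [_ h1 h2]] := dense f Ff 'I_0 (fun=> 0) (e / 2) (divr_gt0 e0 (ltr0Sn _ 1)).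
  exists k; rewrite /mean_gap (_ : _ - _ = (expect mu (phi k) - expect mu f) -
    (expect nu (phi k) - expect nu f)); last by ring.
  by rewrite (le_trans (ler_normB _ _))//; lra.
have empE w : neural_net_distance F
    (empirical_measure (fun i => X i w)) (empirical_measure (fun j => Y j w)) =
    ereal_sup (range (fun k => `|sample_gap w (phi k)|%:E)).
  rewrite empirical_distanceE; apply: ereal_sup_dense => // f Ff e e0.
  (* For the empirical distance only the values at the n + m sample points matter; the approximating
     index may depend on the outcome w. *)
  pose x (t : 'I_n + 'I_m) := match t with inl i => X i w | inr j => Y j w end.
  have [k [hk _ _]] := dense f Ff _ x (e / 2) (divr_gt0 e0 (ltr0Sn _ 1)).
  have avg l (z : 'I_l -> euclidean R h) : (0 < l)%N ->
      (forall i, `|phi k (z i) - f (z i)| <= e / 2) ->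
      `|l%:R^-1 * (\sum_i phi k (z i)) - l%:R^-1 * (\sum_i f (z i))| <= e / 2.
    move=> l0 hz; rewrite -mulrBr -sumrB normrM ger0_norm ?invr_ge0//.
    rewrite mulrC ler_pdivrMr ?ltr0n// (le_trans (ler_norm_sum _ _ _))//.
    apply: (@le_trans _ _ (\sum_(i < l) e / 2)); first by apply: ler_sum => i _; exact: hz.
    by rewrite sumr_const card_ord mulr_natr.
  exists k; have h1 := avg n (fun i => X i w) n0 (fun i => hk (inl i)).
  have h2 := avg m (fun j => Y j w) m0 (fun j => hk (inr j)).
  rewrite /sample_gap; move: h1 h2; rewrite !ler_norml => /andP[? ?] /andP[? ?].
  by apply/andP; split; lra.
have errE w : distance_error F mu nu X Y w =
    (`|neural_net_distance F mu nu - ereal_sup (range (fun k => `|sample_gap w (phi k)|%:E))|)%E.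
  by rewrite /distance_error empE.
have mE : measurable [set w | (distance_error F mu nu X Y w <= (2 * Gamma * C * c * s)%:E)%E].
  have mD : measurable_fun setT (distance_error F mu nu X Y).
    rewrite (funext errE); apply: (measurableT_comp (@abse_measurable R setT)).
    apply: emeasurable_funB; first exact: measurable_cst.
    apply: measurable_ereal_sup_norm => k; apply: measurable_funB.
      apply: measurable_funM => //; apply: measurable_sum => i.
      exact: (measurableT_comp (mF (Fphi k))).
    apply: measurable_funM => //; apply: measurable_sum => j.
    exact: (measurableT_comp (mF (Fphi k))).
  by have := emeasurable_fun_infty_c measurableT mD (2 * Gamma * C * c * s)%:E; rewrite setTI.
split=> //.
have [mbad Pbad] := uniform_deviation_probability (fun k => (gE k).1).
set bad := \bigcup_K _ in mbad Pbad.
apply: (@le_trans _ _ (P (~` bad))).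
  rewrite probability_setC// EFinB; exact: leeB.
apply: le_measure; rewrite ?inE//; first exact: measurableC.
move=> w nbad /=; rewrite errE distE.
apply: ereal_sup_dist_le; last by rewrite -distE distanceE.
move=> k; have [Gg pE] := gE k.
(* The family of the first k + 1 functions has [g k] as its last member. *)
apply: le_trans (@sample_gap_deviation w k.+1 (fun i => g i) ord_max _ Gg pE) _.
have -> : 2 * Gamma * C * c * s = C * Gamma * s * (2 * c) by ring.
rewrite ler_wpM2l ?mulr_ge0 ?(ltW C0) ?(ltW Gamma0) ?(ltW s0)// leNgt.
by apply/negP => hbad; apply: nbad; exists k.+1.
Qed.

End deviation_bound.

Lemma l1_coordinate_class_at0 {R : realType} {h : nat} (f : euclidean R h -> R) :
  l1_linear_class coordinate f -> f 0 = 0.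
Proof. by move=> [v _ ->]; rewrite big1// => j _; rewrite /coordinate mxE mulr0. Qed.

Lemma l2_coordinate_class_at0 {R : realType} {h : nat} (f : euclidean R h -> R) :
  l2_linear_class coordinate f -> f 0 = 0.
Proof. by move=> [v _ ->]; rewrite big1// => j _; rewrite /coordinate mxE mulr0. Qed.

Definition zero_params (R : realType) d k : params R d k := @Params R d k (fun=> 0) 0.

Lemma params_F_zero {R : realType} d k (M : nat -> R) : (0 < d)%N ->
  (forall i, (1 <= i <= d)%N -> 0 < M i) -> params_F d k M (zero_params R d k).
Proof.
move=> d0 M0; have z p q : frobenius_norm (0 : 'M[R]_(p, q)) = 0.
  rewrite /frobenius_norm big1 ?sqrtr0// => i _; rewrite big1// => j _.
  by rewrite mxE expr0n.
split=> [i /andP[i1 id]|] /=; rewrite ?/l2_norm z ltW// M0//; first by rewrite i1 ltnW.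
by rewrite d0 leqnn.
Qed.

Lemma params_1inf_zero {R : realType} d k (M : nat -> R) : (0 < d)%N ->
  (forall i, (1 <= i <= d)%N -> 0 < M i) -> params_1inf d k M (zero_params R d k).
Proof.
move=> d0 M0; split=> [i /andP[i1 id]|] /=.
  have Mi : 0 <= M i by rewrite ltW// M0// i1 ltnW.
  by apply: bigmax_le => // r _; rewrite big1// => j _; rewrite mxE normr0.
rewrite /l1_norm big1 ?ltW ?M0 ?d0 ?leqnn// => i _.
by rewrite mxE normr0.
Qed.

Theorem corollary3 (R : realType) (d : nat) (k : nat -> nat) (n m : nat)
    (sigma : nat -> R -> R) (M_F M_1inf : nat -> R) (Gamma_uB delta : R)
    (mu nu : probability (euclidean R (k 1%N)) R)
    (dO : measure_display) (Omega : measurableType dO)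
    (P : probability Omega R)
    (X : 'I_n -> {RV P >-> euclidean R (k 1%N)})
    (Y : 'I_m -> {RV P >-> euclidean R (k 1%N)}) :
  let h := k 1%N in
  (2 <= d)%N ->
  (forall i, (1 <= i <= d)%N -> (1 <= k i)%N) ->
  (1 <= n)%N -> (1 <= m)%N ->
  (forall i, (1 <= i < d)%N -> sigma i = @relu R) ->
  (forall i, (1 <= i <= d)%N -> 0 < M_F i) ->
  (forall i, (1 <= i <= d)%N -> 0 < M_1inf i) ->
  0 < Gamma_uB ->
  class_uB Gamma_uB mu -> class_uB Gamma_uB nu ->
  independent_samples mu nu X Y ->
  0 < delta < 1 ->
  4 * Num.sqrt (ln (1 / delta)) <=
    Num.sqrt (6 * h%:R) * (minn n m)%:R
      * Num.sqrt (m%:R^-1 + n%:R^-1) ->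
  with_probability_at_least P (1 - delta)
    [set omega |
      (distance_error (network_class sigma (params_F d k M_F)) mu nu X Y omega
       <= (2 * Gamma_uB * (\prod_(1 <= i < d.+1) M_F i)
           * (Num.sqrt (6 * d%:R * ln 2 + 5 * h%:R / 4)
              + Num.sqrt (2 * h%:R * ln (1 / delta)))
           * ((Num.sqrt n%:R)^-1 + (Num.sqrt m%:R)^-1))%:E)%E]
  /\
  with_probability_at_least P (1 - delta)
    [set omega |
      (distance_error
         (network_class sigma (params_1inf d k M_1inf)) mu nu X Y omega
       <= (2 * Gamma_uB * (\prod_(1 <= i < d.+1) M_1inf i)
           * (Num.sqrt (2 * d%:R * ln 2 + 2 * ln h%:R)
              + Num.sqrt (2 * h%:R * ln (1 / delta)))
           * ((Num.sqrt n%:R)^-1 + (Num.sqrt m%:R)^-1))%:E)%E].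

Proof.
move=> h d2 k_gt0 n0 m0 relu_sigma MF_gt0 M1_gt0 G0 mu_uB nu_uB indep /andP[delta0 delta1] _.
have d0 : (0 < d)%N by exact: ltnW.
have h1 : (1 <= h)%N by apply: k_gt0; rewrite d0.
set L := ln (1 / delta).
have L0 : 0 <= L by rewrite ln_ge0// ler_pdivlMr// mul1r ltW.
(* This L makes exp(- L) the allowed failure probability. *)
have deltaE : delta = expR (- L) by rewrite /L div1r lnV ?posrE// opprK lnK.
have prod_gt0 (M : nat -> R) : (forall i, (1 <= i <= d)%N -> 0 < M i) ->
    0 < \prod_(1 <= i < d.+1) M i.
  move=> M0; rewrite big_nat_cond; apply: prodr_gt0 => i /andP[hi _].
  by apply: M0; rewrite -ltnS.
rewrite {1 2}deltaE; split.
- have := @distance_error_probability R h dO Omega P mu nu n m X Y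
    (network_class sigma (params_F d k M_F)) (relu_tower (l2_linear_class coordinate) d.-1)
    _ Gamma_uB L _ n0 m0 G0 (prod_gt0 _ MF_gt0) mu_uB nu_uB indep _
    (network_F_tower relu_sigma MF_gt0 d0) (l2_tower_chernoff d2 h1 L0) _ _ _.
  apply.
  (* The zero network shows that the class is nonempty, as the choice of a countable subfamily
     requires. *)
  + by exists (network sigma (zero_params R d k)), (zero_params R d k) => //;
      exact: params_F_zero.
  + move=> xi g xi_uB; apply: integrable_fun_tower => f.
    exact: (l2_linear_class_integrable (coord_integrable xi_uB)).
  + by move=> g; apply: tower_lipschitz; exact: l2_class_lipschitz.
  + by move=> g; apply: tower_at0; exact: l2_coordinate_class_at0.
- have := @distance_error_probability R h dO Omega P mu nu n m X Y
    (network_class sigma (params_1inf d k M_1inf)) (relu_tower (l1_linear_class coordinate) d.-1)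
    _ Gamma_uB L _ n0 m0 G0 (prod_gt0 _ M1_gt0) mu_uB nu_uB indep _
    (network_1inf_tower relu_sigma M1_gt0 d0) (l1_tower_chernoff d2 h1 L0) _ _ _.
  apply.
  + by exists (network sigma (zero_params R d k)), (zero_params R d k) => //;
      exact: params_1inf_zero.
  + move=> xi g xi_uB; apply: integrable_fun_tower => f.
    exact: (l1_linear_class_integrable (coord_integrable xi_uB)).
  + by move=> g; apply: tower_lipschitz; exact: l1_class_lipschitz.
  + by move=> g; apply: tower_at0; exact: l1_coordinate_class_at0.
Qed.
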